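(* Let $(\mu_n)_{n\in\mathbb N}$ be a sequence of Fourier transformable measures on $\mathbb R^d$, and let $\mu$ be a measure on $\mathbb R^d$ such that (i) $(\mu_n)_{n\in\mathbb N}$ converges vaguely to $\mu$, (ii) $\mu$ is tempered, (iii) $\{\widehat{\mu_n} : n\in\mathbb N\}$ is a set of equi translation bounded measures. Then $\mu$ is Fourier transformable and $\lim_{n\to\infty}\widehat{\mu_n}=\widehat{\mu}$ in the vague topology.
   Context: A measure on $\mathbb R^d$ is a (complex) Radon measure, equivalently a linear functional $\mu$ on $C_c(\mathbb R^d)$ such that for every compact $K$ there is $a_K$ with $|\mu(g)|\le a_K\|g\|_\infty$ whenever $\mathrm{supp}(g)\subseteq K$; $|\mu|$ denotes its total variation measure. Conventions: $\widehat f(y)=\int f(x)e^{-2\pi i xy}\,dx$, $\check f(y)=\int f(x)e^{2\pi i xy}\,dx$, $\widetilde f(x)=\overline{f(-x)}$. A measure $\mu$ is Fourier transformable if there is a measure $\widehat\mu$ with $\check f\in L^2(\widehat\mu)$ and $\mu(f*\widetilde f)=\widehat\mu(|\check f|^2)$ for all $f\in C_c(\mathbb R^d)$; $\widehat\mu$ is its Fourier transform. A measure is tempered if it defines a tempered distribution. $\mu$ is translation bounded if $\|\mu\|_K:=\sup_{t\in\mathbb R^d}|\mu|(t+K)<\infty$ for all compact $K$; a family $(\mu_\alpha)$ is equi translation bounded if $\sup_\alpha\|\mu_\alpha\|_K<\infty$ for all compact $K$. $\mu_n\to\mu$ vaguely means $\mu_n(f)\to\mu(f)$ for all $f\in C_c(\mathbb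 R^d)$. *)

(* Defs.v *)
From Stdlib Require Import Reals.
From Coquelicot Require Import Coquelicot.
From mathcomp Require Import ssreflect ssrfun ssrbool eqtype ssrnat seq fintype bigop.
Set Implicit Arguments.
Unset Strict Implicit.
Unset Printing Implicit Defensive.
Local Open Scope R_scope.

Definition Rd (d : nat) := 'I_d -> R.

Definition vadd {d} (x y : Rd d) : Rd d := fun i => x i + y i.
Definition vopp {d} (x : Rd d) : Rd d := fun i => - x i.
Definition vsub {d} (x y : Rd d) : Rd d := fun i => x i - y i.
Definition vscale {d} (t : R) (x : Rd d) : Rd d := fun i => t * x i.
Definition vzero {d} : Rd d := fun _ => 0.
Definition dir {d} (i : 'I_d) : Rd d := fun j => if j == i then 1 else 0.
Definition dot {d} (x y : Rd d) : R := \big[Rplus/0]_(i < d) (x i * y i).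
(** sup norm (all norms on R^d are equivalent; used only for topology) *)
Definition supn {d} (x : Rd d) : R := \big[Rmax/0]_(i < d) Rabs (x i).

Definition vcons {d} (a : R) (y : Rd d) : Rd d.+1 :=
  fun i => match unlift ord0 i with None => a | Some j => y j end.

(** * Lebesgue integral on R^d of (continuous, compactly supported) functions,
    as an iterated improper Riemann integral (Fubini). *)
Fixpoint LintR (d : nat) : (Rd d -> R) -> R :=
  match d return (Rd d -> R) -> R with
  | 0 => fun f => f vzero
  | d'.+1 => fun f =>
      RInt_gen (fun t => LintR (fun y => f (vcons t y)))
               (Rbar_locally m_infty) (Rbar_locally p_infty)
  end.

Definition Lint {d} (f : Rd d -> C) : C :=
  (LintR (fun x => fst (f x)), LintR (fun x => snd (f x))).

Definition cont_fun {d} (g : Rd d -> C) : Prop :=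
  forall x eps, 0 < eps -> exists delta, 0 < delta /\
    forall y, supn (vsub y x) < delta -> Cmod (Cminus (g y) (g x)) < eps.

Definition is_compact {d} (K : Rd d -> Prop) : Prop :=
  (exists M, forall x, K x -> supn x <= M) /\
  (forall x, (forall eps, 0 < eps -> exists y, K y /\ supn (vsub y x) < eps) -> K x).

Definition in_supp {d} (g : Rd d -> C) (x : Rd d) : Prop :=
  forall eps, 0 < eps -> exists y, supn (vsub y x) < eps /\ g y <> RtoC 0.

Definition supp_in {d} (g : Rd d -> C) (K : Rd d -> Prop) : Prop :=
  forall x, in_supp g x -> K x.

Definition Cc {d} (g : Rd d -> C) : Prop :=
  cont_fun g /\ exists K, is_compact K /\ supp_in g K.

Definition measure_fun (d : nat) := (Rd d -> C) -> C.

Definition is_measure {d} (mu : measure_fun d) : Prop :=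
  (forall f g, Cc f -> Cc g ->
     mu (fun x => Cplus (f x) (g x)) = Cplus (mu f) (mu g)) /\
  (forall (c : C) f, Cc f -> mu (fun x => Cmult c (f x)) = Cmult c (mu f)) /\
  (forall K, is_compact K -> exists a, forall g, Cc g -> supp_in g K ->
     forall b, (forall x, Cmod (g x) <= b) -> Cmod (mu g) <= a * b).

(** |mu|(phi) <= c, for phi >= 0 in C_c:  |mu|(phi) = sup { |mu h| : h in C_c, |h| <= phi } *)
Definition tv_fun_le {d} (mu : measure_fun d) (phi : Rd d -> R) (c : R) : Prop :=
  forall h, Cc h -> (forall x, Cmod (h x) <= phi x) -> Cmod (mu h) <= c.

(** |mu|(S) <= c for a compact S:  |mu|(S) = inf { |mu|(phi) : phi in C_c, phi >= 1_S } *)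
Definition tv_set_le {d} (mu : measure_fun d) (S : Rd d -> Prop) (c : R) : Prop :=
  forall eps, 0 < eps -> exists phi : Rd d -> R,
    Cc (fun x => RtoC (phi x)) /\ (forall x, 0 <= phi x) /\
    (forall x, S x -> 1 <= phi x) /\ tv_fun_le mu phi (c + eps).

Definition translate {d} (t : Rd d) (K : Rd d -> Prop) : Rd d -> Prop :=
  fun x => K (vsub x t).

Definition equi_translation_bounded {d} (mus : nat -> measure_fun d) : Prop :=
  forall K, is_compact K -> exists c, forall n t, tv_set_le (mus n) (translate t K) c.

Definition vague_conv {d} (mus : nat -> measure_fun d) (mu : measure_fun d) : Prop :=
  forall f, Cc f -> filterlim (fun n => mus n f) eventually (locally (mu f)).

(** h continuous, int |h| d|nu| < oo ; (|h| is lsc, so its upper integral is the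
    sup over C_c minorants) *)
Definition L1_cont {d} (nu : measure_fun d) (h : Rd d -> C) : Prop :=
  exists c, forall k, Cc k -> (forall x, Cmod (k x) <= Cmod (h x)) -> Cmod (nu k) <= c.

(** nu(h) = v for h continuous in L^1(|nu|): nu(h phi) -> v as the cut-offs phi
    (0 <= phi <= 1, phi = 1 on larger and larger cubes) exhaust R^d *)
Definition ext_int {d} (nu : measure_fun d) (h : Rd d -> C) (v : C) : Prop :=
  forall eps, 0 < eps -> exists M, forall phi : Rd d -> R,
    Cc (fun x => RtoC (phi x)) -> (forall x, 0 <= phi x <= 1) ->
    (forall x, supn x <= M -> phi x = 1) ->
    Cmod (Cminus (nu (fun x => Cmult (h x) (RtoC (phi x)))) v) < eps.

Definition cexp_i (t : R) : C := (cos t, sin t).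

Definition fhat {d} (f : Rd d -> C) : Rd d -> C :=
  fun y => Lint (fun x => Cmult (f x) (cexp_i (- (2 * PI * dot x y)))).
Definition fcheck {d} (f : Rd d -> C) : Rd d -> C :=
  fun y => Lint (fun x => Cmult (f x) (cexp_i (2 * PI * dot x y))).
Definition ftilde {d} (f : Rd d -> C) : Rd d -> C :=
  fun x => Cconj (f (vopp x)).
Definition conv {d} (f g : Rd d -> C) : Rd d -> C :=
  fun x => Lint (fun y => Cmult (f y) (g (vsub x y))).
Definition sqmod {d} (g : Rd d -> C) : Rd d -> C :=
  fun x => RtoC (Cmod (g x) ^ 2).

Definition is_FT {d} (mu nu : measure_fun d) : Prop :=
  is_measure nu /\
  forall f, Cc f ->
    L1_cont nu (sqmod (fcheck f)) /\
    ext_int nu (sqmod (fcheck f)) (mu (conv f (ftilde f))).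

Definition fourier_transformable {d} (mu : measure_fun d) : Prop :=
  exists nu, is_FT mu nu.

Definition pd {d} (i : 'I_d) (g : Rd d -> C) : Rd d -> C :=
  fun x => (Derive (fun t => fst (g (vadd x (vscale t (dir i))))) 0,
            Derive (fun t => snd (g (vadd x (vscale t (dir i))))) 0).

Definition pdl {d} (l : seq 'I_d) (g : Rd d -> C) : Rd d -> C := foldr pd g l.

Definition Cc_inf {d} (g : Rd d -> C) : Prop :=
  Cc g /\
  (forall l, cont_fun (pdl l g)) /\
  (forall l i x,
     ex_derive (fun t => fst (pdl l g (vadd x (vscale t (dir i))))) 0 /\
     ex_derive (fun t => snd (pdl l g (vadd x (vscale t (dir i))))) 0).

Definition mono {d} (a : seq 'I_d) (x : Rd d) : R := \big[Rmult/1]_(i <- a) x i.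

(** mu defines a tempered distribution: phi |-> mu(phi) on C_c^oo is continuous
    for the Schwartz topology, i.e. bounded by finitely many Schwartz seminorms
    sup_x |x^a d^b phi(x)|, |a|,|b| <= N (then it extends uniquely to S(R^d)). *)
Definition tempered {d} (mu : measure_fun d) : Prop :=
  exists C0 N, forall phi, Cc_inf phi -> forall B,
    (forall a b : seq 'I_d, (size a <= N)%N -> (size b <= N)%N ->
       forall x, Rabs (mono a x) * Cmod (pdl b phi x) <= B) ->
    Cmod (mu phi) <= C0 * B.

(* Main.v *)
(** Fix [f] in [C_c]. The large sieve bounds the sum over the lattice of the maxima of [|fcheck f|^2] on
    unit cubes, so [|fcheck f|^2] is uniformly integrable for equi translation bounded measures, and
    [nu (|fcheck f|^2) = mu (f * f~)] survives vague limits of [mu] and [nu]; temperedness of [mu] then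
    comes for free. The vague limit of [muhats] exists, and is the only possible transform of [mu],
    because every [g] in [C_c] is uniformly [|fcheck f0|^2 T] up to a small multiple of [|fcheck f0|^2]
    on a large cube, where [T] is a combination of squares of trigonometric polynomials (Bernstein
    approximation in the variables [sin^2]). Multiplying [fcheck f0] by a trigonometric polynomial
    amounts to replacing [f0] by a combination of its translates, so the integral of
    [|fcheck f0|^2 T] against any transform of [m] is the value of [m] at a fixed test function. *)
From HB Require Import structures.
Require Import Defs.
From Stdlib Require Import Reals Lra Lia ZArith FunctionalExtensionality Classical ClassicalEpsilon.
From Coquelicot Require Import Coquelicot.
From mathcomp Require Import ssreflect ssrfun ssrbool eqtype ssrnat seq fintype bigop finfun.
Set Implicit Arguments.
Unset Strict Implicit.
Unset Printing Implicit Defensive.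
Local Open Scope R_scope.

(** * Vectors and continuous functions with compact support *)

(** Vague convergence tests only compactly supported functions, while [|fcheck f|^2] is in general
    not compactly supported and, for a merely continuous [f], need not decay fast enough pointwise
    to be summed over lattice cubes. Summability of the cube maxima replaces decay, and translation
    boundedness turns it into a tail bound common to all the measures. The definition of a transform
    controls only integrals of [|fcheck f|^2], so the approximating polynomial has to be assembled
    from squares. This dictates Bernstein's form: the weights [sin^2] of success and [cos^2] of
    failure are both squares of multipliers. Moreover an average of values of a function never
    exceeds its bound, even far outside the cube where the approximation is good, so the error there
    is a bounded multiple of [|fcheck f|^2], which the tail bound absorbs. A transform of [mu] given
    in advance is not known to be translation bounded; its tail bound comes instead from the
    finiteness of its integral of [|fcheck f|^2]. *)

Lemma supn_ge0 d (x : Rd d) : 0 <= supn x.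
Proof.
rewrite /supn; elim/big_ind: _ => [|a b Ha Hb|i _]; try lra.
  by apply: Rle_trans Ha (Rmax_l _ _).
exact: Rabs_pos.
Qed.

Lemma Rabs_le_supn d (x : Rd d) i : Rabs (x i) <= supn x.
Proof.
rewrite /supn; have := mem_index_enum i.
elim: (index_enum _) => [//|j s IH].
rewrite inE big_cons => /orP[/eqP ->|/IH H]; first exact: Rmax_l.
by apply: Rle_trans H (Rmax_r _ _).
Qed.

Lemma supn_lub d (x : Rd d) M : 0 <= M -> (forall i, Rabs (x i) <= M) -> supn x <= M.
Proof.
move=> HM H; rewrite /supn; elim/big_ind: _ => // a b Ha Hb.
exact: Rmax_lub.
Qed.

Lemma supn_lt d (x : Rd d) M : 0 < M -> (forall i, Rabs (x i) < M) -> supn x < M.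
Proof.
move=> HM H; rewrite /supn; elim/big_ind: _ => // a b Ha Hb.
exact: Rmax_lub_lt.
Qed.

Lemma supn_vadd d (x y : Rd d) : supn (vadd x y) <= supn x + supn y.
Proof.
apply: supn_lub => [|i]; first by have := supn_ge0 x; have := supn_ge0 y; lra.
have := Rabs_triang (x i) (y i).
by have := Rabs_le_supn x i; have := Rabs_le_supn y i; rewrite /vadd; lra.
Qed.

Lemma supn_vopp d (x : Rd d) : supn (vopp x) = supn x.
Proof. by rewrite /supn; apply: eq_bigr => i _; rewrite /vopp Rabs_Ropp. Qed.

Lemma supn_vsubC d (x y : Rd d) : supn (vsub x y) = supn (vsub y x).
Proof. by rewrite /supn; apply: eq_bigr => i _; rewrite /vsub Rabs_minus_sym. Qed.

Lemma supn_vzero d : supn (vzero : Rd d) = 0.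
Proof.
apply: Rle_antisym; last exact: supn_ge0.
by apply: supn_lub => [|i]; rewrite /vzero ?Rabs_R0; lra.
Qed.

Lemma vsub_diag d (x : Rd d) : vsub x x = vzero.
Proof. by apply: functional_extensionality => i; rewrite /vsub /vzero; lra. Qed.

Definition vtail {d} (x : Rd d.+1) : Rd d := fun i => x (lift ord0 i).

Lemma vcons0 d a (x : Rd d) : vcons a x ord0 = a.
Proof. by rewrite /vcons unlift_none. Qed.

Lemma vconsS d a (x : Rd d) i : vcons a x (lift ord0 i) = x i.
Proof. by rewrite /vcons liftK. Qed.

Lemma vec_ext d (x y : Rd d.+1) : x ord0 = y ord0 -> vtail x = vtail y -> x = y.
Proof.
move=> H0 HS; apply: functional_extensionality => i.
by case: (unliftP ord0 i) => [j|] ->; [exact: (equal_f HS j)|].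
Qed.

Lemma vtail_vcons d a (x : Rd d) : vtail (vcons a x) = x.
Proof. by apply: functional_extensionality => i; rewrite /vtail vconsS. Qed.

Lemma vcons_eta d (x : Rd d.+1) : vcons (x ord0) (vtail x) = x.
Proof. by apply: vec_ext; rewrite ?vcons0 ?vtail_vcons. Qed.

Lemma vsub_vcons d a b (x y : Rd d) :
  vsub (vcons a x) (vcons b y) = vcons (a - b) (vsub x y).
Proof.
apply: vec_ext; first by rewrite /vsub !vcons0.
by rewrite vtail_vcons; apply: functional_extensionality => i; rewrite /vtail /vsub !vconsS.
Qed.

Lemma Rd0_eq (x y : Rd 0) : x = y.
Proof. by apply: functional_extensionality; case. Qed.

Lemma supn_vcons d a (x : Rd d) : supn (vcons a x) = Rmax (Rabs a) (supn x).
Proof.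
rewrite /supn big_ord_recl vcons0; congr (Rmax _ _).
by apply: eq_bigr => i _; rewrite vconsS.
Qed.

(** Continuity is taken in Coquelicot's uniform space of functions on ['I_d], so that its rules for
    sums, products and compositions apply; [rcontP] translates to the sup norm. *)
Definition rcont {d} (u : Rd d -> R) : Prop :=
  forall x, @continuous (fct_UniformSpace 'I_d R_UniformSpace) R_UniformSpace u x.

Lemma rcontP d (u : Rd d -> R) :
  rcont u <-> forall x eps, 0 < eps -> exists delta, 0 < delta /\
    forall y, supn (vsub y x) < delta -> Rabs (u y - u x) < eps.
Proof.
split=> [H x eps Heps|H x].
  have /filterlim_locally/(_ (mkposreal _ Heps))[[r Hr] Hd] := H x.
  exists r; split=> // y Hy; apply: (Hd y) => i.
  exact: Rle_lt_trans (Rabs_le_supn (vsub y x) i) Hy.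
apply/filterlim_locally => -[eps Heps]; have [r [Hr Hd]] := H x eps Heps.
exists (mkposreal r Hr) => y Hy; by apply: (Hd y); apply: supn_lt.
Qed.

Lemma rcont_const d c : rcont (fun _ : Rd d => c).
Proof. move=> x; exact: continuous_const. Qed.
Arguments rcont_const {d} c.

Lemma rcont_proj d (i : 'I_d) : rcont (fun x : Rd d => x i).
Proof.
apply/rcontP => x eps Heps; exists eps; split=> // y.
by have := Rabs_le_supn (vsub y x) i; rewrite /vsub; lra.
Qed.
Arguments rcont_proj {d} i.

Lemma rcont_plus d (u v : Rd d -> R) : rcont u -> rcont v -> rcont (fun x => u x + v x).
Proof. move=> Hu Hv x; exact: (continuous_plus _ _ _ (Hu x) (Hv x)). Qed.

Lemma rcont_opp d (u : Rd d -> R) : rcont u -> rcont (fun x => - u x).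
Proof. move=> Hu x; exact: (continuous_opp _ _ (Hu x)). Qed.

Lemma rcont_minus d (u v : Rd d -> R) : rcont u -> rcont v -> rcont (fun x => u x - v x).
Proof. move=> Hu Hv; exact: (rcont_plus Hu (rcont_opp Hv)). Qed.

Lemma rcont_mult d (u v : Rd d -> R) : rcont u -> rcont v -> rcont (fun x => u x * v x).
Proof. move=> Hu Hv x; exact: (continuous_mult _ _ _ (Hu x) (Hv x)). Qed.

Lemma rcont_comp d (phi : R -> R) (u : Rd d -> R) :
  (forall t, continuous phi t) -> rcont u -> rcont (fun x => phi (u x)).
Proof. move=> Hp Hu x; exact: (continuous_comp _ _ _ (Hu x) (Hp _)). Qed.

Lemma rcont_inv d (u : Rd d -> R) : rcont u -> (forall x, u x <> 0) -> rcont (fun x => / u x).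
Proof.
move=> Hu H0 x; apply: (continuous_comp _ Rinv x (Hu x)); exact: continuous_Rinv.
Qed.

Lemma rcont_prod d (I : Type) (s : seq I) (u : I -> Rd d -> R) :
  (forall i, rcont (u i)) -> rcont (fun x => \big[Rmult/1]_(i <- s) u i x).
Proof.
move=> Hu; elim: s => [|i s IH].
  by move: (rcont_const (d := d) 1); congr rcont; apply: functional_extensionality => x; rewrite big_nil.
move: (rcont_mult (Hu i) IH); congr rcont.
by apply: functional_extensionality => x; rewrite big_cons.
Qed.

Lemma rcont_sum d (I : Type) (s : seq I) (u : I -> Rd d -> R) :
  (forall i, rcont (u i)) -> rcont (fun x => \big[Rplus/0]_(i <- s) u i x).
Proof.
move=> Hu; elim: s => [|i s IH].
  by move: (rcont_const (d := d) 0); congr rcont; apply: functional_extensionality => x; rewrite big_nil.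
move: (rcont_plus (Hu i) IH); congr rcont.
by apply: functional_extensionality => x; rewrite big_cons.
Qed.

Lemma rcont_supn d : rcont (@supn d).
Proof.
apply/rcontP => x eps Heps; exists eps; split=> // y Hy.
have H1 : supn y <= supn (vsub y x) + supn x.
  rewrite -{1}(_ : vadd (vsub y x) x = y); first exact: supn_vadd.
  by apply: functional_extensionality => i; rewrite /vadd /vsub; lra.
have H2 : supn x <= supn (vsub y x) + supn y.
  rewrite supn_vsubC -{1}(_ : vadd (vsub x y) y = x); first exact: supn_vadd.
  by apply: functional_extensionality => i; rewrite /vadd /vsub; lra.
by apply: Rabs_def1; lra.
Qed.

Definition clip (t : R) : R := Rmax 0 (Rmin 1 t).

Lemma clip_bounds t : 0 <= clip t <= 1.
Proof.
by rewrite /clip /Rmax /Rmin; repeat destruct (Rle_dec _ _); lra.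
Qed.

Lemma clip_ge1 t : 1 <= t -> clip t = 1.
Proof. by move=> H; rewrite /clip Rmin_left ?Rmax_right; lra. Qed.

Lemma clip_le0 t : t <= 0 -> clip t = 0.
Proof. by move=> H; rewrite /clip Rmin_right ?Rmax_left; lra. Qed.

Lemma Rmax_alt a b : Rmax a b = (a + b + Rabs (a - b)) / 2.
Proof. by rewrite /Rmax /Rabs; destruct (Rle_dec _ _); destruct (Rcase_abs _); lra. Qed.

Lemma Rmin_alt a b : Rmin a b = (a + b - Rabs (a - b)) / 2.
Proof. by rewrite /Rmin /Rabs; destruct (Rle_dec _ _); destruct (Rcase_abs _); lra. Qed.

Lemma rcont_div2 d (u : Rd d -> R) : rcont u -> rcont (fun x => u x / 2).
Proof. move=> H; exact: (rcont_mult H (rcont_const (/ 2))). Qed.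

Lemma rcont_abs d (u : Rd d -> R) : rcont u -> rcont (fun x => Rabs (u x)).
Proof. exact: (rcont_comp continuous_Rabs). Qed.

Lemma rcont_max d (u v : Rd d -> R) : rcont u -> rcont v -> rcont (fun x => Rmax (u x) (v x)).
Proof.
move=> Hu Hv.
rewrite (_ : (fun x => _) = fun x => (u x + v x + Rabs (u x - v x)) / 2); last first.
  by apply: functional_extensionality => x; exact: Rmax_alt.
exact: rcont_div2 (rcont_plus (rcont_plus Hu Hv) (rcont_abs (rcont_minus Hu Hv))).
Qed.

Lemma rcont_min d (u v : Rd d -> R) : rcont u -> rcont v -> rcont (fun x => Rmin (u x) (v x)).
Proof.
move=> Hu Hv.
rewrite (_ : (fun x => _) = fun x => (u x + v x - Rabs (u x - v x)) / 2); last first.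
  by apply: functional_extensionality => x; exact: Rmin_alt.
exact: rcont_div2 (rcont_minus (rcont_plus Hu Hv) (rcont_abs (rcont_minus Hu Hv))).
Qed.

Lemma rcont_clip d (u : Rd d -> R) : rcont u -> rcont (fun x => clip (u x)).
Proof. move=> H; exact: rcont_max (rcont_const 0) (rcont_min (rcont_const 1) H). Qed.

Lemma Cmod_le_abs (z : C) : Cmod z <= Rabs (fst z) + Rabs (snd z).
Proof.
have E : z = Cplus (RtoC (fst z)) (Cmult Ci (RtoC (snd z))).
  by case: z => a b; rewrite /RtoC /Ci /Cplus /Cmult /=; congr pair; ring.
rewrite {1}E; apply: Rle_trans (Cmod_triangle _ _) _.
rewrite Cmod_mult !Cmod_R.
have -> : Cmod Ci = 1 by rewrite /Cmod /Ci /= (_ : _ + _ = 1) ?sqrt_1 //; ring.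
by lra.
Qed.

Lemma abs_fst_le (z : C) : Rabs (fst z) <= Cmod z.
Proof. exact: Rle_trans (Rmax_l _ _) (Rmax_Cmod z). Qed.

Lemma abs_snd_le (z : C) : Rabs (snd z) <= Cmod z.
Proof. exact: Rle_trans (Rmax_r _ _) (Rmax_Cmod z). Qed.

Lemma cont_funP d (g : Rd d -> C) :
  cont_fun g <-> rcont (fun x => fst (g x)) /\ rcont (fun x => snd (g x)).
Proof.
split=> [H|[/rcontP H1 /rcontP H2] x eps Heps].
  split; apply/rcontP => x eps /(H x)[r [Hr Hd]]; exists r; split=> // y /Hd.
    exact: Rle_lt_trans (abs_fst_le _).
  exact: Rle_lt_trans (abs_snd_le _).
have [r1 [Hr1 Hd1]] := H1 x (eps / 2) ltac:(lra).
have [r2 [Hr2 Hd2]] := H2 x (eps / 2) ltac:(lra).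
exists (Rmin r1 r2); split=> [|y Hy]; first exact: Rmin_pos.
have := Cmod_le_abs (Cminus (g y) (g x)).
have := Hd1 y (Rlt_le_trans _ _ _ Hy (Rmin_l _ _)).
have := Hd2 y (Rlt_le_trans _ _ _ Hy (Rmin_r _ _)).
by rewrite /Cminus /Cplus /Copp /= /Rminus; lra.
Qed.

Lemma cont_fun_plus d (f g : Rd d -> C) :
  cont_fun f -> cont_fun g -> cont_fun (fun x => Cplus (f x) (g x)).
Proof.
move=> /cont_funP[f1 f2] /cont_funP[g1 g2]; apply/cont_funP; split; exact: rcont_plus.
Qed.

Lemma cont_fun_mult d (f g : Rd d -> C) :
  cont_fun f -> cont_fun g -> cont_fun (fun x => Cmult (f x) (g x)).
Proof.
move=> /cont_funP[f1 f2] /cont_funP[g1 g2]; apply/cont_funP; split.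
  exact: rcont_minus (rcont_mult f1 g1) (rcont_mult f2 g2).
exact: rcont_plus (rcont_mult f1 g2) (rcont_mult f2 g1).
Qed.

Lemma cont_fun_const d (c : C) : cont_fun (fun _ : Rd d => c).
Proof. apply/cont_funP; split; exact: rcont_const. Qed.

Lemma cont_fun_RtoC d (u : Rd d -> R) : rcont u -> cont_fun (fun x => RtoC (u x)).
Proof. move=> H; apply/cont_funP; split=> //; exact: rcont_const. Qed.

Lemma cont_fun_conj d (f : Rd d -> C) : cont_fun f -> cont_fun (fun x => Cconj (f x)).
Proof. move=> /cont_funP[f1 f2]; apply/cont_funP; split=> //; exact: rcont_opp. Qed.

Lemma rcont_Cmod d (f : Rd d -> C) : cont_fun f -> rcont (fun x => Cmod (f x)).
Proof.
move=> /cont_funP[f1 f2]; apply: (rcont_comp (phi := sqrt)) => [t|].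
  exact: continuous_sqrt.
have sq (u : Rd d -> R) : rcont u -> rcont (fun x => u x ^ 2).
  by move=> Hu; exact: (rcont_mult Hu (rcont_mult Hu (rcont_const 1))).
exact: rcont_plus (sq _ f1) (sq _ f2).
Qed.

Lemma cont_fun_comp d e (h : Rd e -> Rd d) (f : Rd d -> C) :
  cont_fun f -> (forall x y, supn (vsub (h y) (h x)) <= supn (vsub y x)) ->
  cont_fun (fun x => f (h x)).
Proof.
move=> Hf Hh x eps /(Hf (h x))[r [Hr Hd]]; exists r; split=> // y Hy.
exact/Hd/(Rle_lt_trans _ _ _ (Hh _ _)).
Qed.

Lemma cube_compact d M : is_compact (fun x : Rd d => supn x <= M).
Proof.
split; first by exists M.
move=> x H; apply: Rnot_lt_le => Hx.
have [y [Hy1 Hy2]] := H (supn x - M) ltac:(lra).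
have : supn x <= supn (vsub x y) + supn y.
  rewrite -{1}(_ : vadd (vsub x y) y = x); first exact: supn_vadd.
  by apply: functional_extensionality => i; rewrite /vadd /vsub; lra.
by rewrite supn_vsubC; lra.
Qed.

Lemma supp_in_cube d (g : Rd d -> C) M :
  (forall x, M < supn x -> g x = RtoC 0) -> supp_in g (fun x => supn x <= M).
Proof.
move=> H x Hx; apply: (proj2 (cube_compact d M)) => eps /Hx[y [Hy Hg]].
by exists y; split=> //; apply: Rnot_lt_le => /H.
Qed.

Lemma supp_in_zero d (g : Rd d -> C) K x : supp_in g K -> ~ K x -> g x = RtoC 0.
Proof.
move=> H HK; apply: NNPP => Hg; apply: HK; apply: H => eps Heps.
by exists x; split=> //; rewrite vsub_diag supn_vzero.
Qed.

Lemma CcP d (g : Rd d -> C) :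
  Cc g <-> cont_fun g /\ exists M, 0 <= M /\ forall x, M < supn x -> g x = RtoC 0.
Proof.
split=> [[Hg [K [[[M HM] _] HK]]]|[Hg [M [_ HM]]]].
  split=> //; exists (Rmax 0 M); split=> [|x Hx]; first exact: Rmax_l.
  apply: (supp_in_zero HK) => /HM; have := Rmax_r 0 M; lra.
split=> //; exists (fun x => supn x <= M); split; first exact: cube_compact.
exact: supp_in_cube.
Qed.

Lemma Cc_cont d (g : Rd d -> C) : Cc g -> cont_fun g.
Proof. by case. Qed.

Lemma Cc_plus d (f g : Rd d -> C) : Cc f -> Cc g -> Cc (fun x => Cplus (f x) (g x)).
Proof.
move=> /CcP[Hf [M [HM Hf0]]] /CcP[Hg [N [HN Hg0]]]; apply/CcP; split.
  exact: cont_fun_plus.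
exists (Rmax M N); split=> [|x Hx]; first exact: Rle_trans HM (Rmax_l _ _).
rewrite Hf0 ?Hg0 ?Cplus_0_l //; have := Rmax_l M N; have := Rmax_r M N; lra.
Qed.

Lemma Cc_multl d (h f : Rd d -> C) : cont_fun h -> Cc f -> Cc (fun x => Cmult (h x) (f x)).
Proof.
move=> Hh /CcP[Hf [M [HM Hf0]]]; apply/CcP; split; first exact: cont_fun_mult.
by exists M; split=> // x Hx; rewrite Hf0 // Cmult_0_r.
Qed.

Lemma Cc_multr d (h f : Rd d -> C) : cont_fun h -> Cc f -> Cc (fun x => Cmult (f x) (h x)).
Proof.
move=> Hh Hf; have := Cc_multl Hh Hf; congr Cc.
by apply: functional_extensionality => x; rewrite Cmult_comm.
Qed.

Lemma Cc_scal d (c : C) (f : Rd d -> C) : Cc f -> Cc (fun x => Cmult c (f x)).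
Proof. exact/Cc_multl/cont_fun_const. Qed.

Lemma Cc_0 d : Cc (fun _ : Rd d => RtoC 0).
Proof.
apply/CcP; split; first exact: cont_fun_const.
by exists 0; split=> //; lra.
Qed.

Lemma Cc_sum d (I : Type) (s : seq I) (F : I -> Rd d -> C) :
  (forall i, Cc (F i)) -> Cc (fun x => \big[Cplus/RtoC 0]_(i <- s) F i x).
Proof.
move=> HF; elim: s => [|i s IH].
  by move: (Cc_0 d); congr Cc; apply: functional_extensionality => x; rewrite big_nil.
move: (Cc_plus (HF i) IH); congr Cc.
by apply: functional_extensionality => x; rewrite big_cons.
Qed.

Lemma Cc_bounded_Cmod d (g : Rd d -> C) M :
  cont_fun g -> (forall x, M < supn x -> g x = RtoC 0) -> Cc g.
Proof.
move=> Hg HM; apply/CcP; split=> //; exists (Rmax 0 M); split=> [|x Hx].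
  exact: Rmax_l.
by apply: HM; have := Rmax_r 0 M; lra.
Qed.

(** * The iterated integral of real functions *)

Definition ucont {d} (u : Rd d -> R) : Prop :=
  forall eps, 0 < eps -> exists delta, 0 < delta /\
    forall x y, supn (vsub y x) < delta -> Rabs (u y - u x) < eps.

Lemma ucont_rcont d (u : Rd d -> R) : ucont u -> rcont u.
Proof.
move=> H; apply/rcontP => x eps /H[r [Hr Hd]].
by exists r; split=> // y; exact: Hd.
Qed.

(** Coquelicot's compactness of boxes is stated for the nested pairs [Tn d R]; [Tn_of] and [of_Tn]
    carry it over to vectors indexed by ordinals. *)
Fixpoint Tn_of d : Rd d -> Compactness.Tn d R :=
  match d with
  | 0 => fun _ => tt
  | d'.+1 => fun x => (x ord0, Tn_of (vtail x))
  end.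

Fixpoint of_Tn d : Compactness.Tn d R -> Rd d :=
  match d with
  | 0 => fun _ => vzero
  | d'.+1 => fun t => vcons (fst t) (of_Tn (snd t))
  end.

Lemma Tn_ofK d (x : Rd d) : of_Tn (Tn_of x) = x.
Proof.
elim: d x => [|d IH] x /=; first exact: Rd0_eq.
by rewrite IH vcons_eta.
Qed.

Lemma bounded_Tn_of d M (x : Rd d) : supn x <= M ->
  bounded_n d (Tn_of (fun _ : 'I_d => - M)) (Tn_of (fun _ : 'I_d => M)) (Tn_of x).
Proof.
elim: d x => [|d IH] x //= Hx; split.
  have /Rabs_le_between := Rle_trans _ _ _ (Rabs_le_supn x ord0) Hx; lra.
apply: IH; apply: supn_lub => [|i]; first by have := supn_ge0 x; lra.
exact: Rle_trans (Rabs_le_supn x _) Hx.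
Qed.

Lemma close_of_Tn d r (x t : Compactness.Tn d R) :
  0 < r -> close_n d r x t -> supn (vsub (of_Tn x) (of_Tn t)) < r.
Proof.
move=> Hr; elim: d x t => [|d IH] x t /=.
  by move=> _; rewrite vsub_diag supn_vzero.
case: x t => x1 x2 [t1 t2] [H1 /IH H2].
by rewrite vsub_vcons supn_vcons; apply: Rmax_lub_lt.
Qed.

Lemma supn_tri d (x y z : Rd d) : supn (vsub x z) <= supn (vsub x y) + supn (vsub y z).
Proof.
rewrite -(_ : vadd (vsub x y) (vsub y z) = vsub x z); first exact: supn_vadd.
by apply: functional_extensionality => i; rewrite /vadd /vsub; lra.
Qed.

Lemma supn_le_add d (x y : Rd d) : supn x <= supn y + supn (vsub x y).
Proof.
rewrite -{1}(_ : vadd y (vsub x y) = x); first exact: supn_vadd.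
by apply: functional_extensionality => i; rewrite /vadd /vsub; lra.
Qed.

(** Heine-Cantor on a box. The local radius at [t] is half a radius of continuity, so that a point
    near [x] is still controlled when [x] is near [t]. *)
Lemma rcont_ucont d (u : Rd d -> R) M :
  rcont u -> (forall x, M < supn x -> u x = 0) -> ucont u.
Proof.
move=> /rcontP Hu Hz eps Heps.
have Hdel (t : Compactness.Tn d R) : { r : posreal |
    forall y, supn (vsub y (of_Tn t)) < 2 * r -> Rabs (u y - u (of_Tn t)) < eps / 2 }.
  apply: constructive_indefinite_description.
  have [r [Hr Hd]] := Hu (of_Tn t) (eps / 2) ltac:(lra).
  have Hr2 : 0 < r / 2 by lra.
  by exists (mkposreal _ Hr2) => y /= Hy; apply: Hd; lra.
have [D HD] := compactness_value d (Tn_of (fun _ : 'I_d => - (M + 1)))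
  (Tn_of (fun _ : 'I_d => M + 1)) (fun t => proj1_sig (Hdel t)).
have D0 := cond_pos D.
(* The cap 1 settles points outside the enlarged cube of radius [M + 1]: if [x] lies there, then [y]
   lies outside the cube of radius [M], and both values are 0. *)
exists (Rmin D 1); split=> [|x y Hxy]; first by apply: Rmin_pos; lra.
have HxD := Rlt_le_trans _ _ _ Hxy (Rmin_l _ _).
have Hx1 := Rlt_le_trans _ _ _ Hxy (Rmin_r _ _).
case: (Rle_lt_dec (supn x) (M + 1)) => Hx; last first.
  have Hxy' := supn_le_add x y; rewrite supn_vsubC in Hxy'.
  by rewrite !Hz ?Rminus_0_r ?Rabs_R0; lra.
have /NNPP[t [_ [Hc HDt]]] := HD _ (bounded_Tn_of Hx).
case: (Hdel t) Hc HDt => /= r Hr Hc HDt.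
have := close_of_Tn (cond_pos r) Hc; rewrite Tn_ofK => Hxt.
have H1 : Rabs (u x - u (of_Tn t)) < eps / 2 by apply: Hr; have := cond_pos r; lra.
have H2 : Rabs (u y - u (of_Tn t)) < eps / 2.
  by apply: Hr; have := supn_tri y x (of_Tn t); lra.
rewrite (_ : u y - u x = (u y - u (of_Tn t)) - (u x - u (of_Tn t))); last by ring.
by apply: Rle_lt_trans (Rabs_triang _ _) _; rewrite Rabs_Ropp; lra.
Qed.

Lemma RInt_gen_compact (F : R -> R) M : 0 <= M ->
  (forall t, continuous F t) -> (forall t, M < Rabs t -> F t = 0) ->
  RInt_gen F (Rbar_locally m_infty) (Rbar_locally p_infty) = RInt F (- M) M.
Proof.
move=> HM HF H0; apply is_RInt_gen_unique => P HP.
apply: (Filter_prod _ _ _ (fun a => a < - M) (fun b => M < b)).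
- by exists (- M).
- by exists M.
move=> a b Ha Hb /=; exists (RInt F (- M) M); split; last exact: locally_singleton HP.
have zero p q : p <= q -> (forall t, p < t < q -> F t = 0) -> is_RInt F p q 0.
  move=> Hpq Hz; apply: (is_RInt_ext (fun _ => 0)) => [x|].
    by rewrite Rmin_left ?Rmax_right // => /Hz.
  by have := @is_RInt_const R_NormedModule p q 0; rewrite /scal /= /mult /= Rmult_0_r.
have H1 : is_RInt F a (- M) 0.
  apply: zero => [|t Ht]; first lra.
  by apply: H0; rewrite Rabs_left; lra.
have H2 : is_RInt F M b 0.
  apply: zero => [|t Ht]; first lra.
  by apply: H0; rewrite Rabs_right; lra.
have H3 : is_RInt F (- M) M (RInt F (- M) M).
  by apply: RInt_correct; apply: ex_RInt_continuous => t _; exact: HF.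
have := is_RInt_Chasles _ _ _ _ _ _ (is_RInt_Chasles _ _ _ _ _ _ H1 H3) H2.
by rewrite plus_zero_l plus_zero_r.
Qed.

(** The index [M] is a radius of a cube outside which the function vanishes. *)
Definition Rc {d} (M : R) (u : Rd d -> R) : Prop :=
  0 <= M /\ ucont u /\ forall x, M < supn x -> u x = 0.

Lemma Rc_slice d M (u : Rd d.+1 -> R) t : Rc M u -> Rc M (fun y => u (vcons t y)).
Proof.
move=> [HM [Hu Hz]]; split=> //; split=> [eps /Hu[r [Hr Hd]]|x Hx].
  exists r; split=> // x y Hxy; apply: Hd.
  rewrite vsub_vcons supn_vcons Rminus_eq_0 Rabs_R0.
  by apply: Rmax_lub_lt => //; have := supn_ge0 (vsub y x).
apply: Hz; rewrite supn_vcons; exact: Rlt_le_trans Hx (Rmax_r _ _).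
Qed.

Lemma Rc_slice0 d M (u : Rd d.+1 -> R) t :
  Rc M u -> M < Rabs t -> (fun y => u (vcons t y)) = (fun _ => 0).
Proof.
move=> [HM [Hu Hz]] Ht; apply: functional_extensionality => y; apply: Hz.
rewrite supn_vcons; exact: Rlt_le_trans Ht (Rmax_l _ _).
Qed.

Lemma Rc_lin d M (u v : Rd d -> R) a b :
  Rc M u -> Rc M v -> Rc M (fun x => a * u x + b * v x).
Proof.
move=> [HM [Hu Hu0]] [_ [Hv Hv0]]; split=> //.
have Hz x : M < supn x -> a * u x + b * v x = 0 by move=> Hx; rewrite Hu0 // Hv0 //; ring.
split=> //; apply: rcont_ucont Hz.
exact: rcont_plus (rcont_mult (rcont_const a) (ucont_rcont Hu))
                  (rcont_mult (rcont_const b) (ucont_rcont Hv)).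
Qed.

Lemma LintR_0 d : LintR (fun _ : Rd d => 0) = 0.
Proof.
elim: d => [//|d IH] /=; rewrite IH (@RInt_gen_compact _ 0) //; try lra.
  by rewrite Ropp_0 RInt_point.
by move=> t; exact: continuous_const.
Qed.

(** Linearity and boundedness are proved in one induction on the dimension: in dimension [d.+1] both
    need the slice integrals to be integrable, hence continuous, and that continuity follows from
    linearity and boundedness in dimension [d]. *)
Definition LintR_lin_at d := forall M (u v : Rd d -> R) a b, Rc M u -> Rc M v ->
  LintR (fun x => a * u x + b * v x) = a * LintR u + b * LintR v.

Definition LintR_bound_at d := forall M (u : Rd d -> R) B, Rc M u ->
  (forall x, Rabs (u x) <= B) -> Rabs (LintR u) <= (2 * M) ^ d * B.

Lemma slice_continuous d M (u : Rd d.+1 -> R) : LintR_lin_at d -> LintR_bound_at d ->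
  Rc M u -> forall t, continuous (fun t => LintR (fun y => u (vcons t y))) t.
Proof.
move=> Hlin Hbnd Hu t; apply/filterlim_locally => -[eps Heps].
have HM : 0 <= M by case: Hu.
have Hp : 0 < (2 * M) ^ d + 1 by have := pow_le (2 * M) d ltac:(lra); lra.
have He : 0 < eps / ((2 * M) ^ d + 1) by apply: Rdiv_lt_0_compat.
have [_ [Huc _]] := Hu; have [r [Hr Hd]] := Huc _ He.
exists (mkposreal r Hr) => s Hs.
rewrite /ball /= /AbsRing_ball /abs /minus /plus /opp /=.
have -> : LintR (fun y => u (vcons s y)) + - LintR (fun y => u (vcons t y)) =
    LintR (fun y => 1 * u (vcons s y) + (-1) * u (vcons t y)).
  rewrite (Hlin M); [lra|exact: Rc_slice|exact: Rc_slice].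
apply: Rle_lt_trans (Hbnd M _ _ (Rc_lin _ _ (Rc_slice _ Hu) (Rc_slice _ Hu)) _) _.
  move=> y; apply: Rlt_le; rewrite (_ : _ + _ = u (vcons s y) - u (vcons t y)); last by ring.
  apply: Hd; rewrite vsub_vcons vsub_diag supn_vcons supn_vzero.
  apply: Rmax_lub_lt => //; exact: Hs.
have E : ((2 * M) ^ d + 1) * (eps / ((2 * M) ^ d + 1)) = eps by field; lra.
by apply: Rlt_le_trans (Req_le _ _ E); apply: Rmult_lt_compat_r => //; lra.
Qed.

Lemma LintR_lin_bound d : LintR_lin_at d /\ LintR_bound_at d.
Proof.
elim: d => [|d [Hlin Hbnd]].
  by split=> [//|M u B _ /(_ vzero) /=]; rewrite Rmult_1_l.
have cont M (u : Rd d.+1 -> R) : Rc M u ->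
    forall t, continuous (fun t => LintR (fun y => u (vcons t y))) t.
  exact: (@slice_continuous d M u Hlin Hbnd).
have eqn M (u : Rd d.+1 -> R) : Rc M u -> LintR u = RInt (fun t => LintR (fun y => u (vcons t y))) (- M) M.
  move=> Hu /=; apply: RInt_gen_compact; [by case: Hu|exact: (cont M)|].
  by move=> t Ht; rewrite (Rc_slice0 Hu Ht) LintR_0.
have ex M (u : Rd d.+1 -> R) : Rc M u -> ex_RInt (fun t => LintR (fun y => u (vcons t y))) (- M) M.
  by move=> Hu; apply: ex_RInt_continuous => t _; exact: (cont M).
split=> [M u v a b Hu Hv|M u B Hu HB].
  rewrite (eqn M) ?(eqn M u) ?(eqn M v) //; last exact: Rc_lin.
  rewrite (RInt_ext _ (fun t => plus (scal a (LintR (fun y => u (vcons t y))))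
     (scal b (LintR (fun y => v (vcons t y)))))); last first.
    move=> t _; exact: Hlin (Rc_slice t Hu) (Rc_slice t Hv).
  rewrite RInt_plus; [|exact/ex_RInt_scal/ex|exact/ex_RInt_scal/ex].
  by rewrite !RInt_scal //; exact: ex.
have HM : 0 <= M by case: Hu.
rewrite (eqn M) //.
have := @abs_RInt_le_const (fun t => LintR (fun y => u (vcons t y))) (- M) M ((2 * M) ^ d * B).
move/(_ ltac:(lra) (ex _ _ Hu)) => H.
apply: Rle_trans (H _) _ => [t _|]; last by apply: Req_le => /=; ring.
by apply: Hbnd => //; exact: Rc_slice.
Qed.

Lemma LintR_lin d M (u v : Rd d -> R) a b : Rc M u -> Rc M v ->
  LintR (fun x => a * u x + b * v x) = a * LintR u + b * LintR v.
Proof. exact: (proj1 (LintR_lin_bound d)). Qed.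

Lemma LintR_bound d M (u : Rd d -> R) B : Rc M u ->
  (forall x, Rabs (u x) <= B) -> Rabs (LintR u) <= (2 * M) ^ d * B.
Proof. exact: (proj2 (LintR_lin_bound d)). Qed.

Lemma LintR_slice_continuous d M (u : Rd d.+1 -> R) : Rc M u ->
  forall t, continuous (fun t => LintR (fun y => u (vcons t y))) t.
Proof. by apply: slice_continuous; case: (LintR_lin_bound d). Qed.

Lemma LintR_vcons d M (u : Rd d.+1 -> R) : Rc M u ->
  LintR u = RInt (fun t => LintR (fun y => u (vcons t y))) (- M) M.
Proof.
move=> Hu /=; apply: RInt_gen_compact; [by case: Hu|exact: LintR_slice_continuous Hu|].
by move=> t Ht; rewrite (Rc_slice0 Hu Ht) LintR_0.
Qed.

Lemma LintR_ex_slice d M (u : Rd d.+1 -> R) a b : Rc M u ->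
  ex_RInt (fun t => LintR (fun y => u (vcons t y))) a b.
Proof. by move=> Hu; apply: ex_RInt_continuous => t _; exact: LintR_slice_continuous Hu t. Qed.

Lemma LintR_ge0 d M (u : Rd d -> R) : Rc M u -> (forall x, 0 <= u x) -> 0 <= LintR u.
Proof.
elim: d u => [u _ H|d IH u Hu H]; first exact: (H vzero).
rewrite (LintR_vcons Hu); apply: RInt_ge_0 => [| |t _]; first by case: Hu; lra.
  exact: LintR_ex_slice Hu.
by apply: IH => [|y]; [exact: Rc_slice|].
Qed.

Lemma Rc_weaken d M N (u : Rd d -> R) : M <= N -> Rc M u -> Rc N u.
Proof.
move=> HMN [HM [Hu Hz]]; split; first lra.
by split=> // x Hx; apply: Hz; lra.
Qed.

Lemma Rc_translate d M (u : Rd d -> R) a :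
  Rc M u -> Rc (M + supn a) (fun x => u (vsub x a)).
Proof.
move=> [HM [Hu Hz]]; split; first by have := supn_ge0 a; lra.
split=> [eps /Hu[r [Hr Hd]]|x Hx].
  exists r; split=> // x y Hxy; apply: Hd.
  rewrite (_ : vsub (vsub y a) (vsub x a) = vsub y x) //.
  by apply: functional_extensionality => i; rewrite /vsub; lra.
apply: Hz; have := supn_le_add x (vsub x a).
rewrite (_ : vsub x (vsub x a) = a); first lra.
by apply: functional_extensionality => i; rewrite /vsub; lra.
Qed.

Lemma RInt_shift (F : R -> R) a b c : (forall t, continuous F t) ->
  RInt (fun t => F (t - c)) a b = RInt F (a - c) (b - c).
Proof.
move=> HF; have := RInt_comp_lin F 1 (- c) a b.
rewrite !Rmult_1_l => H; rewrite /Rminus -H; last first.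
  by apply: ex_RInt_continuous => t _; exact: HF.
by apply: RInt_ext => t _; rewrite /scal /= /mult /= !Rmult_1_l.
Qed.

(** The tail coordinates are shifted inside each slice by induction and the first one by
    substitution. The shifted interval still contains [[-M, M]], and the excess at both ends
    contributes 0. *)
Lemma LintR_translate d M (u : Rd d -> R) a :
  Rc M u -> LintR (fun x => u (vsub x a)) = LintR u.
Proof.
elim: d M u a => [|d IH] M u a Hu; first by rewrite /= (Rd0_eq (vsub _ _) vzero).
have Hua := Rc_translate a Hu.
have HF := LintR_slice_continuous Hu.
set F := fun t => LintR (fun y => u (vcons t y)).
rewrite (LintR_vcons Hua) (RInt_ext _ (fun t => F (t - a ord0))); last first.
  move=> t _; rewrite /F -(IH M (fun y => u (vcons (t - a ord0) y)) (vtail a)); last exact: (Rc_slice _ Hu).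
  congr LintR; apply: functional_extensionality => y.
  by rewrite -{1}(vcons_eta a) vsub_vcons.
rewrite RInt_shift // (LintR_vcons Hu) -/F.
have [HM _] := Hu.
have Hz p q : (forall t, Rmin p q < t < Rmax p q -> M < Rabs t) -> RInt F p q = 0.
  move=> H; rewrite (RInt_ext _ (fun _ => 0)) ?RInt_const ?/scal /= ?/mult /= ?Rmult_0_r //.
  by move=> t /H Ht; rewrite /F (Rc_slice0 Hu Ht) LintR_0.
have ex p q : ex_RInt F p q by exact: LintR_ex_slice Hu.
have Ha := Rabs_le_supn a ord0.
have /Rabs_le_between Ha' := Ha.
have E1 : RInt F (- (M + supn a) - a ord0) (- M) = 0.
  apply: Hz => t; rewrite Rmin_left ?Rmax_right; try lra.
  by move=> Ht; rewrite Rabs_left; lra.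
have E2 : RInt F M (M + supn a - a ord0) = 0.
  apply: Hz => t; rewrite Rmin_left ?Rmax_right; try lra.
  by move=> Ht; rewrite Rabs_right; lra.
rewrite -(RInt_Chasles F _ (- M)) // E1 plus_zero_l.
by rewrite -(RInt_Chasles F _ M) // E2 plus_zero_r.
Qed.

(** * The integral of complex functions *)

(** These structures make the generic big operator lemmas (splitting, distributivity, exchange)
    available for real and complex sums and products. *)
HB.instance Definition _ := Monoid.isComLaw.Build R 0 Rplus
  (fun a b c => esym (Rplus_assoc a b c)) Rplus_comm Rplus_0_l.
HB.instance Definition _ := Monoid.isComLaw.Build R 1 Rmult
  (fun a b c => esym (Rmult_assoc a b c)) Rmult_comm Rmult_1_l.
HB.instance Definition _ := Monoid.isMulLaw.Build R 0 Rmult Rmult_0_l Rmult_0_r.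
HB.instance Definition _ := Monoid.isAddLaw.Build R Rmult Rplus
  (fun a b c => Rmult_plus_distr_r a b c) (fun a b c => Rmult_plus_distr_l a b c).
HB.instance Definition _ := Monoid.isComLaw.Build C (RtoC 0) Cplus
  Cplus_assoc Cplus_comm Cplus_0_l.
HB.instance Definition _ := Monoid.isComLaw.Build C (RtoC 1) Cmult
  Cmult_assoc Cmult_comm Cmult_1_l.
HB.instance Definition _ := Monoid.isMulLaw.Build C (RtoC 0) Cmult Cmult_0_l Cmult_0_r.
HB.instance Definition _ := Monoid.isAddLaw.Build C Cmult Cplus
  (fun a b c => Cmult_plus_distr_r a b c) (fun a b c => Cmult_plus_distr_l a b c).

(** The origin is joined to [x] by steps of sup length at most [r / 2], each of which changes [u] by
    less than 1; the number of steps is bounded on the cube of radius [M]. *)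
Lemma ucont_bounded d (u : Rd d -> R) M : ucont u -> (forall x, M < supn x -> u x = 0) ->
  exists B, 0 <= B /\ forall x, Rabs (u x) <= B.
Proof.
move=> Hu Hz; have [r [Hr Hd]] := Hu 1 Rlt_0_1.
have walk n (x : Rd d) : supn x <= INR n * (r / 2) -> Rabs (u x - u vzero) <= INR n.
  elim: n x => [|n IH] x; rewrite ?S_INR => Hx.
    rewrite (_ : x = vzero) ?Rminus_eq_0 ?Rabs_R0 /=; first lra.
    apply: functional_extensionality => i; rewrite /vzero.
    have := Rabs_le_supn x i; have := Rabs_pos (x i); rewrite /= Rmult_0_l in Hx.
    by move=> H1 H2; apply: Rabs_eq_0; lra.
  have Hn := pos_INR n.
  (* The previous point of the walk on the segment from the origin to [x]: the remaining step is
     [x / (n + 1)], of length at most [r / 2]. *)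
  pose x' : Rd d := vscale (INR n / (INR n + 1)) x.
  have Hsc c : 0 <= c -> supn (vscale c x) <= c * supn x.
    move=> Hc; apply: supn_lub => [|i]; first by apply: Rmult_le_pos => //; exact: supn_ge0.
    rewrite /vscale Rabs_mult (Rabs_pos_eq c) //.
    by apply: Rmult_le_compat_l => //; exact: Rabs_le_supn.
  have Hq : 0 <= / (INR n + 1) by apply/Rlt_le/Rinv_0_lt_compat; lra.
  have Hqx : / (INR n + 1) * supn x <= r / 2.
    have := Rmult_le_compat_l _ _ _ Hq Hx.
    by rewrite (_ : / (INR n + 1) * ((INR n + 1) * (r / 2)) = r / 2); [|field; lra].
  have Hx' : supn x' <= INR n * (r / 2).
    apply: Rle_trans (Hsc _ _) _; first by apply: Rmult_le_pos.
    rewrite /Rdiv Rmult_assoc; exact: Rmult_le_compat_l.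
  have Hxx' : supn (vsub x x') < r.
    have -> : vsub x x' = vscale (/ (INR n + 1)) x.
      by apply: functional_extensionality => i; rewrite /vsub /x' /vscale; field; lra.
    by have := Hsc _ Hq; lra.
  have := Hd _ _ Hxx'; have := IH _ Hx'.
  have := Rabs_triang (u x - u x') (u x' - u vzero).
  by rewrite (_ : u x - u x' + _ = u x - u vzero); [lra|ring].
have [n Hn] := INR_unbounded (M * (2 / r)).
exists (INR n + Rabs (u vzero)); split=> [|x].
  by have := pos_INR n; have := Rabs_pos (u vzero); lra.
case: (Rle_lt_dec (supn x) M) => Hx; last first.
  by rewrite Hz // Rabs_R0; have := pos_INR n; have := Rabs_pos (u vzero); lra.
have Hxn : supn x <= INR n * (r / 2).
  apply: Rle_trans Hx _; rewrite (_ : M = M * (2 / r) * (r / 2)); last by field; lra.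
  by apply: Rmult_le_compat_r; lra.
have := walk _ _ Hxn; have := Rabs_triang (u x - u vzero) (u vzero).
by rewrite (_ : u x - u vzero + _ = u x); [lra|ring].
Qed.

Lemma Rc_of_Cc d (g : Rd d -> C) M : 0 <= M -> cont_fun g ->
  (forall x, M < supn x -> g x = RtoC 0) ->
  Rc M (fun x => fst (g x)) /\ Rc M (fun x => snd (g x)).
Proof.
move=> HM /cont_funP[H1 H2] Hz.
have z1 x : M < supn x -> fst (g x) = 0 by move=> /Hz ->.
have z2 x : M < supn x -> snd (g x) = 0 by move=> /Hz ->.
split; split=> //; split=> //; [exact: rcont_ucont H1 z1|exact: rcont_ucont H2 z2].
Qed.

Lemma Cc_Rc d (g : Rd d -> C) : Cc g ->
  exists M, Rc M (fun x => fst (g x)) /\ Rc M (fun x => snd (g x)).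
Proof. by move=> /CcP[Hg [M [HM Hz]]]; exists M; exact: Rc_of_Cc. Qed.

Lemma Cc_bounded d (g : Rd d -> C) : Cc g -> exists B, 0 <= B /\ forall x, Cmod (g x) <= B.
Proof.
move=> /Cc_Rc[M [[_ [H1 z1]] [_ [H2 z2]]]].
have [B1 [P1 Q1]] := ucont_bounded H1 z1; have [B2 [P2 Q2]] := ucont_bounded H2 z2.
exists (B1 + B2); split=> [|x]; first lra.
by apply: Rle_trans (Cmod_le_abs _) _; have := Q1 x; have := Q2 x; lra.
Qed.

Lemma Cc_ucont d (g : Rd d -> C) : Cc g -> forall eps, 0 < eps -> exists delta, 0 < delta /\
  forall x y, supn (vsub y x) < delta -> Cmod (Cminus (g y) (g x)) < eps.
Proof.
move=> /Cc_Rc[M [[_ [H1 z1]] [_ [H2 z2]]]] eps Heps.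
have [r1 [P1 Q1]] := H1 (eps / 2) ltac:(lra); have [r2 [P2 Q2]] := H2 (eps / 2) ltac:(lra).
exists (Rmin r1 r2); split=> [|x y Hy]; first exact: Rmin_pos.
have := Cmod_le_abs (Cminus (g y) (g x)).
have := Q1 x y (Rlt_le_trans _ _ _ Hy (Rmin_l _ _)).
have := Q2 x y (Rlt_le_trans _ _ _ Hy (Rmin_r _ _)).
by rewrite /Cminus /Cplus /Copp /= /Rminus; lra.
Qed.

Lemma Lint_plus d (f g : Rd d -> C) : Cc f -> Cc g ->
  Lint (fun x => Cplus (f x) (g x)) = Cplus (Lint f) (Lint g).
Proof.
move=> /Cc_Rc[M [f1 f2]] /Cc_Rc[N [g1 g2]].
have L := Rmax_l M N; have L' := Rmax_r M N.
have E (u v : Rd d -> R) : Rc M u -> Rc N v ->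
    LintR (fun x => u x + v x) = LintR u + LintR v.
  move=> /(Rc_weaken L) Hu /(Rc_weaken L') Hv.
  have := LintR_lin 1 1 Hu Hv; rewrite !Rmult_1_l => <-.
  by congr LintR; apply: functional_extensionality => x; ring.
by rewrite /Lint /Cplus /= !E.
Qed.

Lemma Lint_scal d (c : C) (f : Rd d -> C) : Cc f ->
  Lint (fun x => Cmult c (f x)) = Cmult c (Lint f).
Proof.
move=> /Cc_Rc[M [f1 f2]]; rewrite /Lint /Cmult /=.
congr pair; last first.
  by rewrite (LintR_lin _ _ f2 f1).
rewrite -[RHS](_ : fst c * LintR (fun x => fst (f x)) +
  - snd c * LintR (fun x => snd (f x)) = _); last by ring.
rewrite -(LintR_lin _ _ f1 f2); congr LintR.
by apply: functional_extensionality => x; ring.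
Qed.

Lemma Lint_0 d : Lint (fun _ : Rd d => RtoC 0) = RtoC 0.
Proof. by rewrite /Lint /= LintR_0. Qed.

Lemma Lint_sum d (I : Type) (s : seq I) (F : I -> Rd d -> C) : (forall i, Cc (F i)) ->
  Lint (fun x => \big[Cplus/RtoC 0]_(i <- s) F i x) = \big[Cplus/RtoC 0]_(i <- s) Lint (F i).
Proof.
move=> HF; elim: s => [|i s IH].
  rewrite big_nil -[RHS](Lint_0 d); congr Lint.
  by apply: functional_extensionality => x; rewrite big_nil.
rewrite big_cons -IH -Lint_plus //; last exact: Cc_sum.
by congr Lint; apply: functional_extensionality => x; rewrite big_cons.
Qed.

(** The factor 2 comes from estimating the real and imaginary parts separately. *)
Lemma Lint_bound d (f : Rd d -> C) M B : 0 <= M -> cont_fun f ->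
  (forall x, M < supn x -> f x = RtoC 0) -> (forall x, Cmod (f x) <= B) ->
  Cmod (Lint f) <= 2 * (2 * M) ^ d * B.
Proof.
move=> HM Hf Hz HB; have [f1 f2] := Rc_of_Cc HM Hf Hz.
have B1 := LintR_bound f1 (fun x => Rle_trans _ _ _ (abs_fst_le _) (HB x)).
have B2 := LintR_bound f2 (fun x => Rle_trans _ _ _ (abs_snd_le _) (HB x)).
by apply: Rle_trans (Cmod_le_abs _) _; rewrite /Lint /=; lra.
Qed.

Lemma Lint_translate d (f : Rd d -> C) a : Cc f -> Lint (fun x => f (vsub x a)) = Lint f.
Proof.
move=> /Cc_Rc[M [f1 f2]]; rewrite /Lint.
by rewrite (LintR_translate a f1) (LintR_translate a f2).
Qed.

Lemma Cprod_vcons d a (x : Rd d) (w : 'I_d.+1 -> R -> C) :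
  \big[Cmult/RtoC 1]_i w i (vcons a x i) =
  Cmult (w ord0 a) (\big[Cmult/RtoC 1]_i w (lift ord0 i) (x i)).
Proof.
rewrite big_ord_recl vcons0; congr Cmult.
by apply: eq_bigr => i _; rewrite vconsS.
Qed.

Lemma Cc_tensor d M (w : 'I_d -> R -> C) : 0 <= M ->
  (forall i t, continuous (fun s => fst (w i s)) t) ->
  (forall i t, continuous (fun s => snd (w i s)) t) ->
  (forall i t, M < Rabs t -> w i t = RtoC 0) ->
  cont_fun (fun x : Rd d => \big[Cmult/RtoC 1]_i w i (x i)) /\
  forall x, M < supn x -> \big[Cmult/RtoC 1]_i w i (x i) = RtoC 0.
Proof.
move=> HM H1 H2 Hz; split.
  elim: (index_enum _) => [|i s IH].
    move: (cont_fun_const (d := d) (RtoC 1)); congr cont_fun.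
    by apply: functional_extensionality => x; rewrite big_nil.
  have Hw : cont_fun (fun x : Rd d => w i (x i)).
    apply/cont_funP; split.
      exact: (rcont_comp (H1 i) (rcont_proj i)).
    exact: (rcont_comp (H2 i) (rcont_proj i)).
  move: (cont_fun_mult Hw IH); congr cont_fun.
  by apply: functional_extensionality => x; rewrite big_cons.
move=> x Hx; have [i Hi] : exists i, M < Rabs (x i).
  apply: NNPP => H; apply: (Rlt_not_le _ _ Hx); apply: supn_lub => // i.
  by apply: Rnot_lt_le => Hi; apply: H; exists i.
by rewrite (bigD1 i) //= Hz // Cmult_0_l.
Qed.

Definition CInt M (w : R -> C) : C :=
  (RInt (fun t => fst (w t)) (- M) M, RInt (fun t => snd (w t)) (- M) M).

Lemma Lint_tensor d M (w : 'I_d -> R -> C) : 0 <= M ->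
  (forall i t, continuous (fun s => fst (w i s)) t) ->
  (forall i t, continuous (fun s => snd (w i s)) t) ->
  (forall i t, M < Rabs t -> w i t = RtoC 0) ->
  Lint (fun x : Rd d => \big[Cmult/RtoC 1]_i w i (x i)) =
  \big[Cmult/RtoC 1]_i CInt M (w i).
Proof.
elim: d w => [|d IH] w HM H1 H2 Hz.
  by rewrite /Lint /= !big_ord0.
pose F (x : Rd d.+1) : C := \big[Cmult/RtoC 1]_i w i (x i).
pose G (x : Rd d) : C := \big[Cmult/RtoC 1]_i w (lift ord0 i) (x i).
have EF t y : F (vcons t y) = Cmult (w ord0 t) (G y) by exact: Cprod_vcons.
have [R1 R2] : Rc M (fun x => fst (F x)) /\ Rc M (fun x => snd (F x)).
  by have [Hc Hv] := Cc_tensor HM H1 H2 Hz; exact: Rc_of_Cc.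
have [R1' R2'] : Rc M (fun x => fst (G x)) /\ Rc M (fun x => snd (G x)).
  have [Hc Hv] := @Cc_tensor d M (fun i => w (lift ord0 i)) HM
    (fun i => H1 _) (fun i => H2 _) (fun i => Hz _).
  exact: Rc_of_Cc.
rewrite big_ord_recl -(IH (fun i => w (lift ord0 i)) HM (fun i => H1 _) (fun i => H2 _)
  (fun i => Hz _)).
change (Lint F = Cmult (CInt M (w ord0)) (Lint G)).
have ex1 a b : ex_RInt (fun t => fst (w ord0 t)) a b.
  by apply: ex_RInt_continuous => t _; exact: H1.
have ex2 a b : ex_RInt (fun t => snd (w ord0 t)) a b.
  by apply: ex_RInt_continuous => t _; exact: H2.
have lin (p q : R) : RInt (fun t => p * fst (w ord0 t) + q * snd (w ord0 t)) (- M) M =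
    p * fst (CInt M (w ord0)) + q * snd (CInt M (w ord0)).
  have e1 := ex_RInt_scal _ _ _ p (ex1 (- M) M).
  have e2 := ex_RInt_scal _ _ _ q (ex2 (- M) M).
  by have := RInt_plus _ _ _ _ e1 e2; rewrite !RInt_scal.
have slice (u v : R -> R) (H : Rd d.+1 -> R) :
    (forall t y, H (vcons t y) = u t * fst (G y) + v t * snd (G y)) ->
    (fun t => LintR (fun y => H (vcons t y))) =
    (fun t => u t * fst (Lint G) + v t * snd (Lint G)).
  move=> EH; apply: functional_extensionality => t; rewrite -(LintR_lin _ _ R1' R2').
  by congr LintR; apply: functional_extensionality => y.
rewrite {1}/Lint (LintR_vcons R1) (LintR_vcons R2).
rewrite (slice (fun t => fst (w ord0 t)) (fun t => - snd (w ord0 t)) (fun x => fst (F x))); last first.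
  by move=> t y; rewrite EF /Cmult /fst /snd; ring.
rewrite (slice (fun t => snd (w ord0 t)) (fun t => fst (w ord0 t)) (fun x => snd (F x))); last first.
  by move=> t y; rewrite EF /Cmult /fst /snd; ring.
rewrite /Cmult; congr pair.
  rewrite (RInt_ext _ (fun t => fst (Lint G) * fst (w ord0 t) + - snd (Lint G) * snd (w ord0 t))).
    by rewrite lin; ring.
  by move=> t _; rewrite /=; ring.
rewrite (RInt_ext _ (fun t => snd (Lint G) * fst (w ord0 t) + fst (Lint G) * snd (w ord0 t))).
  by rewrite lin; ring.
by move=> t _; rewrite /=; ring.
Qed.

(** * Fourier transforms and convolutions *)

Lemma cexp_i_plus a b : cexp_i (a + b) = Cmult (cexp_i a) (cexp_i b).
Proof. by rewrite /cexp_i /Cmult /= cos_plus sin_plus; congr pair; ring. Qed.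

Lemma cexp_i_0 : cexp_i 0 = RtoC 1.
Proof. by rewrite /cexp_i cos_0 sin_0. Qed.

Lemma cexp_i_opp a : cexp_i (- a) = Cconj (cexp_i a).
Proof. by rewrite /cexp_i /Cconj /= cos_neg sin_neg. Qed.

Lemma Cmod_cexp_i a : Cmod (cexp_i a) = 1.
Proof.
rewrite /Cmod /cexp_i /= (_ : _ + _ = 1) ?sqrt_1 //.
by have := sin2_cos2 a; rewrite /Rsqr; lra.
Qed.

Lemma Rabs_cos_sub a b : Rabs (cos b - cos a) <= Rabs (b - a).
Proof.
have [||c [_ ->]] := MVT_gen cos a b (fun x => - sin x).
- by move=> x _; auto_derive => //; ring.
- by move=> x _; apply: continuity_cos.
rewrite Rabs_mult Rabs_Ropp -{2}(Rmult_1_l (Rabs (b - a))).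
apply: Rmult_le_compat_r; first exact: Rabs_pos.
by apply/Rabs_le; have := SIN_bound c; lra.
Qed.

Lemma Rabs_sin_sub a b : Rabs (sin b - sin a) <= Rabs (b - a).
Proof.
rewrite -!cos_shift; apply: Rle_trans (Rabs_cos_sub _ _) _.
by rewrite Rabs_minus_sym; apply: Req_le; congr Rabs; lra.
Qed.

Lemma Cmod_cexp_i_sub a b : Cmod (Cminus (cexp_i b) (cexp_i a)) <= 2 * Rabs (b - a).
Proof.
apply: Rle_trans (Cmod_le_abs _) _; rewrite /cexp_i /=.
by have := Rabs_cos_sub a b; have := Rabs_sin_sub a b; rewrite /Rminus; lra.
Qed.

Lemma dotC d (x y : Rd d) : dot x y = dot y x.
Proof. by apply: eq_bigr => i _; rewrite Rmult_comm. Qed.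

Lemma dot_vadd d (x z y : Rd d) : dot (vadd x z) y = dot x y + dot z y.
Proof.
by rewrite /dot -big_split /=; apply: eq_bigr => i _; rewrite /vadd Rmult_plus_distr_r.
Qed.

Lemma dot_vscale d c (x y : Rd d) : dot (vscale c x) y = c * dot x y.
Proof.
rewrite /dot (big_distrr _ _ _) /=.
by apply: eq_bigr => i _; rewrite /vscale Rmult_assoc.
Qed.

Lemma vsubE d (x y : Rd d) : vsub x y = vadd x (vscale (-1) y).
Proof. by apply: functional_extensionality => i; rewrite /vsub /vadd /vscale; ring. Qed.

Lemma dot_vsub d (x z y : Rd d) : dot (vsub x z) y = dot x y - dot z y.
Proof. by rewrite vsubE dot_vadd dot_vscale; ring. Qed.

Lemma Rsum_const n c : \big[Rplus/0]_(i < n) c = INR n * c.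
Proof.
rewrite big_const_ord; elim: n => [|n IH]; first by rewrite /=; ring.
by rewrite iterS IH S_INR; ring.
Qed.

Lemma Rabs_dot d (x y : Rd d) : Rabs (dot x y) <= INR d * supn x * supn y.
Proof.
rewrite /dot Rmult_assoc -Rsum_const.
elim/big_rec2: _ => [|i a b _ H]; first by rewrite Rabs_R0; lra.
apply: Rle_trans (Rabs_triang _ _) _; rewrite Rabs_mult.
apply: Rplus_le_compat => //.
by apply: Rmult_le_compat; (exact: Rabs_pos || exact: Rabs_le_supn).
Qed.

Lemma cont_fun_cexp_i d (u : Rd d -> R) : rcont u -> cont_fun (fun x => cexp_i (u x)).
Proof.
move=> Hu; apply/cont_funP; split; apply: rcont_comp Hu => t.
  exact: continuous_cos.
exact: continuous_sin.
Qed.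

Lemma rcont_dot d (y : Rd d) : rcont (fun x => dot x y).
Proof. by apply: rcont_sum => i; exact: rcont_mult (rcont_proj i) (rcont_const (y i)). Qed.
Arguments rcont_dot {d} y.

Lemma cont_fun_character d (y : Rd d) : cont_fun (fun x => cexp_i (2 * PI * dot x y)).
Proof. exact/cont_fun_cexp_i/(rcont_mult (rcont_const _) (rcont_dot y)). Qed.
Arguments cont_fun_character {d} y.

Lemma Cc_character d (f : Rd d -> C) y :
  Cc f -> Cc (fun x => Cmult (f x) (cexp_i (2 * PI * dot x y))).
Proof. exact/Cc_multr/cont_fun_character. Qed.

Lemma fcheck_plus d (f g : Rd d -> C) y : Cc f -> Cc g ->
  fcheck (fun x => Cplus (f x) (g x)) y = Cplus (fcheck f y) (fcheck g y).
Proof.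
move=> Hf Hg; rewrite /fcheck -Lint_plus; [|exact: Cc_character|exact: Cc_character].
by congr Lint; apply: functional_extensionality => x; rewrite Cmult_plus_distr_r.
Qed.

Lemma fcheck_scal d (c : C) (f : Rd d -> C) y : Cc f ->
  fcheck (fun x => Cmult c (f x)) y = Cmult c (fcheck f y).
Proof.
move=> Hf; rewrite /fcheck -Lint_scal; last exact: Cc_character.
by congr Lint; apply: functional_extensionality => x; rewrite Cmult_assoc.
Qed.

Lemma Cc_translate d (f : Rd d -> C) a : Cc f -> Cc (fun x => f (vsub x a)).
Proof.
move=> /CcP[Hf [M [HM Hz]]]; apply: (@Cc_bounded_Cmod _ _ (M + supn a)).
  apply: (cont_fun_comp Hf) => x y.
  rewrite (_ : vsub (vsub y a) (vsub x a) = vsub y x); first lra.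
  by apply: functional_extensionality => i; rewrite /vsub; ring.
move=> x Hx; apply: Hz; have := supn_le_add x (vsub x a).
rewrite (_ : vsub x (vsub x a) = a); first lra.
by apply: functional_extensionality => i; rewrite /vsub; ring.
Qed.

Lemma fcheck_translate d (f : Rd d -> C) a y : Cc f ->
  fcheck (fun x => f (vsub x a)) y = Cmult (cexp_i (2 * PI * dot a y)) (fcheck f y).
Proof.
move=> Hf; have Hc := Cc_character y Hf.
rewrite /fcheck -Lint_scal // -[RHS](Lint_translate a); last exact: Cc_scal.
congr Lint; apply: functional_extensionality => x.
rewrite Cmult_assoc (Cmult_comm (cexp_i _) (f _)) -Cmult_assoc; congr Cmult.
by rewrite -cexp_i_plus dot_vsub; congr cexp_i; ring.
Qed.

Lemma cont_fun_fcheck d (f : Rd d -> C) : Cc f -> cont_fun (fcheck f).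
Proof.
move=> Hf y eps Heps; have [Hfc [M [HM Hz]]] := proj1 (CcP f) Hf.
have [B [HB0 HB]] := Cc_bounded Hf.
(* A Lipschitz constant of [fcheck f]: the volume factor of the support, times the bound of [f],
   times the rate at which the phase varies on the support. *)
pose K := 2 * (2 * M) ^ d * (B * (2 * (2 * PI * (INR d * M)))).
have PI0 := PI_RGT_0.
have pw : 0 <= (2 * M) ^ d by apply: pow_le; lra.
have dM : 0 <= INR d * M by apply: Rmult_le_pos => //; exact: pos_INR.
have c0 : 0 <= B * (2 * (2 * PI * (INR d * M))).
  apply: Rmult_le_pos => //; apply: Rmult_le_pos; first lra.
  by apply: Rmult_le_pos => //; lra.
have K0 : 0 <= K by apply: Rmult_le_pos => //; lra.
exists (eps / (K + 1)); split=> [|z Hyz]; first by apply: Rdiv_lt_0_compat; lra.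
have -> : Cminus (fcheck f z) (fcheck f y) = Lint (fun x => Cplus
    (Cmult (f x) (cexp_i (2 * PI * dot x z)))
    (Cmult (RtoC (-1)) (Cmult (f x) (cexp_i (2 * PI * dot x y))))).
  rewrite Lint_plus; [|exact: Cc_character|exact/Cc_scal/Cc_character].
  rewrite Lint_scal; last exact: Cc_character.
  by rewrite /fcheck /Cminus; congr Cplus; rewrite /Copp /Cmult /RtoC /=; congr pair; ring.
set g := fun x => _.
have Hg x : g x = Cmult (f x) (Cminus (cexp_i (2 * PI * dot x z)) (cexp_i (2 * PI * dot x y))).
  by rewrite /g /Cminus /Cplus /Cmult /Copp /RtoC /=; congr pair; ring.
have gc : cont_fun g.
  apply: cont_fun_plus; first exact: cont_fun_mult Hfc (cont_fun_character z).
  apply: cont_fun_mult; first exact: cont_fun_const.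
  exact: cont_fun_mult Hfc (cont_fun_character y).
have s0 := supn_ge0 (vsub z y).
have HgB x : Cmod (g x) <= B * (2 * (2 * PI * (INR d * M))) * supn (vsub z y).
  rewrite Hg Cmod_mult.
  case: (Rle_lt_dec (supn x) M) => Hx; last first.
    by rewrite Hz // Cmod_0 Rmult_0_l; apply: Rmult_le_pos.
  rewrite (Rmult_assoc B); apply: Rmult_le_compat => //; try exact: Cmod_ge_0.
  apply: Rle_trans (Cmod_cexp_i_sub _ _) _.
  rewrite (_ : 2 * PI * dot x z - 2 * PI * dot x y = 2 * PI * dot (vsub z y) x); last first.
    by rewrite dot_vsub (dotC z) (dotC y); ring.
  rewrite Rabs_mult (Rabs_pos_eq (2 * PI)); last lra.
  have D1 : Rabs (dot (vsub z y) x) <= INR d * M * supn (vsub z y).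
    apply: Rle_trans (Rabs_dot _ _) _; rewrite !Rmult_assoc (Rmult_comm M).
    apply: Rmult_le_compat_l; first exact: pos_INR.
    exact: Rmult_le_compat_l.
  rewrite [X in _ <= X](_ : _ = 2 * (2 * PI * (INR d * M * supn (vsub z y)))); last by ring.
  by apply: Rmult_le_compat_l; [lra|apply: Rmult_le_compat_l; lra].
have gz x : M < supn x -> g x = RtoC 0 by move=> Hx; rewrite Hg Hz // Cmult_0_l.
apply: Rle_lt_trans (Lint_bound HM gc gz HgB) _.
have -> : 2 * (2 * M) ^ d * (B * (2 * (2 * PI * (INR d * M))) * supn (vsub z y)) =
    K * supn (vsub z y) by rewrite /K; ring.
have E : (K + 1) * (eps / (K + 1)) = eps by field; lra.
have : K * supn (vsub z y) <= K * (eps / (K + 1)) by apply: Rmult_le_compat_l; lra.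
have : 0 < eps / (K + 1) by apply: Rdiv_lt_0_compat; lra.
lra.
Qed.

Lemma Cc_ftilde d (f : Rd d -> C) : Cc f -> Cc (ftilde f).
Proof.
move=> /CcP[Hf [M [HM Hz]]]; apply: (@Cc_bounded_Cmod _ _ M).
  apply/cont_fun_conj/(cont_fun_comp Hf) => x y.
  rewrite (_ : vsub (vopp y) (vopp x) = vopp (vsub y x)) ?supn_vopp; first lra.
  by apply: functional_extensionality => i; rewrite /vsub /vopp; ring.
move=> x Hx; rewrite /ftilde Hz ?supn_vopp //.
by rewrite /Cconj /RtoC /=; congr pair; ring.
Qed.

(** Supports add up, and uniform continuity of [g] makes the integrand vary little with [x],
    uniformly over the cube that carries [f]. *)
Lemma Cc_conv d (f g : Rd d -> C) : Cc f -> Cc g -> Cc (conv f g).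
Proof.
move=> Hf Hg; have [Hfc [M [HM Hz]]] := proj1 (CcP f) Hf.
have [Hgc [N [HN Hgz]]] := proj1 (CcP g) Hg.
have [B [HB0 HB]] := Cc_bounded Hf.
have Hgx x : cont_fun (fun y => g (vsub x y)).
  apply: (cont_fun_comp Hgc) => y z; rewrite (_ : vsub _ _ = vsub y z).
    by rewrite supn_vsubC; lra.
  by apply: functional_extensionality => i; rewrite /vsub; ring.
have Hfg x : Cc (fun y => Cmult (f y) (g (vsub x y))) by exact: Cc_multr.
apply: (@Cc_bounded_Cmod _ _ (M + N)); last first.
  move=> x Hx; rewrite /conv -(Lint_0 d); congr Lint; apply: functional_extensionality => y.
  case: (Rle_lt_dec (supn y) M) => Hy; last by rewrite Hz // Cmult_0_l.
  by rewrite (Hgz (vsub x y)) ?Cmult_0_r //; have := supn_le_add x y; lra.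
move=> x eps Heps.
have pw : 0 <= 2 * (2 * M) ^ d by apply: Rmult_le_pos; [lra|apply: pow_le; lra].
pose K := 2 * (2 * M) ^ d * B.
have K0 : 0 <= K by apply: Rmult_le_pos.
have He : 0 < eps / (K + 1) by apply: Rdiv_lt_0_compat; lra.
have [r [Hr Hd]] := Cc_ucont Hg He.
exists r; split=> // z Hzx.
have -> : Cminus (conv f g z) (conv f g x) = Lint (fun y => Cplus
    (Cmult (f y) (g (vsub z y))) (Cmult (RtoC (-1)) (Cmult (f y) (g (vsub x y))))).
  rewrite Lint_plus //; last exact: Cc_scal.
  rewrite Lint_scal //.
  by rewrite /conv /Cminus; congr Cplus; rewrite /Copp /Cmult /RtoC /=; congr pair; ring.
set h := fun x => _.
have Hh y : h y = Cmult (f y) (Cminus (g (vsub z y)) (g (vsub x y))).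
  by rewrite /h /Cminus /Cplus /Cmult /Copp /RtoC /=; congr pair; ring.
have hc : cont_fun h.
  apply: cont_fun_plus; first exact: cont_fun_mult.
  by apply: cont_fun_mult; [exact: cont_fun_const|exact: cont_fun_mult].
have HhB y : Cmod (h y) <= B * (eps / (K + 1)).
  rewrite Hh Cmod_mult; apply: Rmult_le_compat => //; try exact: Cmod_ge_0.
  apply/Rlt_le/Hd; rewrite (_ : vsub (vsub z y) (vsub x y) = vsub z x) //.
  by apply: functional_extensionality => i; rewrite /vsub; ring.
have hz y : M < supn y -> h y = RtoC 0 by move=> Hy; rewrite Hh Hz // Cmult_0_l.
apply: Rle_lt_trans (Lint_bound HM hc hz HhB) _.
have E : (K + 1) * (eps / (K + 1)) = eps by field; lra.
rewrite -Rmult_assoc -/K; lra.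
Qed.

(** * Tent functions and the Fejér kernel *)

Definition tent (a u : R) : R := Rmax 0 (a - Rabs u).

Lemma tent_bounds a u : 0 <= a -> 0 <= tent a u <= a.
Proof.
move=> Ha; rewrite /tent; split; first exact: Rmax_l.
by apply: Rmax_lub => //; have := Rabs_pos u; lra.
Qed.

Lemma tent_zero a u : a <= Rabs u -> tent a u = 0.
Proof. by move=> H; rewrite /tent Rmax_left //; lra. Qed.

Lemma continuous_tent a t : continuous (tent a) t.
Proof.
rewrite (_ : tent a = fun u => (0 + (a - Rabs u) + Rabs (0 - (a - Rabs u))) / 2); last first.
  by apply: functional_extensionality => u; rewrite /tent Rmax_alt.
have H : continuous (fun u => a - Rabs u) t.
  apply: (continuous_minus (fun _ => a) Rabs); first exact: continuous_const.
  exact: continuous_Rabs.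
apply: (continuous_mult (fun u => 0 + (a - Rabs u) + Rabs (0 - (a - Rabs u))) (fun _ => / 2)).
  apply: (continuous_plus (fun u => 0 + (a - Rabs u))).
    by apply: (continuous_plus (fun _ => 0)) => //; exact: continuous_const.
  apply: (continuous_comp (fun u => 0 - (a - Rabs u)) Rabs); last exact: continuous_Rabs.
  by apply: (continuous_minus (fun _ => 0)) => //; exact: continuous_const.
exact: continuous_const.
Qed.

(** For [y <> 0] and [a >= 0] this is the Fejér kernel [(sin (PI a y) / (PI y))^2]. Its quadratic
    decay makes the Gram matrix of the large sieve summable, and its lack of zeros for [|y| < 1 / a]
    gives a function whose transform does not vanish on a prescribed cube. *)
Definition tenthat (a y : R) : R := RInt (fun t => tent a t * cos (2 * PI * (t * y))) (- a) a.

Lemma continuous_scaled (phi : R -> R) c t :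
  (forall s, continuous phi s) -> continuous (fun s => phi (2 * PI * (s * c))) t.
Proof.
move=> H; apply: (continuous_comp (fun s => 2 * PI * (s * c)) phi) => //.
by apply: ex_derive_continuous; auto_derive.
Qed.

Lemma continuous_tent_cos a y t : continuous (fun t => tent a t * cos (2 * PI * (t * y))) t.
Proof.
apply: (continuous_mult (tent a) (fun t => cos (2 * PI * (t * y)))).
  exact: continuous_tent.
by apply: continuous_scaled => s; exact: continuous_cos.
Qed.

Lemma continuous_tent_sin a y t : continuous (fun t => tent a t * sin (2 * PI * (t * y))) t.
Proof.
apply: (continuous_mult (tent a) (fun t => sin (2 * PI * (t * y)))).
  exact: continuous_tent.
by apply: continuous_scaled => s; exact: continuous_sin.
Qed.

Lemma CInt_tent a y :
  CInt a (fun t => Cmult (RtoC (tent a t)) (cexp_i (2 * PI * (t * y)))) = RtoC (tenthat a y).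
Proof.
rewrite /CInt /RtoC; congr pair.
  by apply: RInt_ext => t _; rewrite /cexp_i /=; ring.
rewrite (RInt_ext _ (fun t => tent a t * sin (2 * PI * (t * y)))); last first.
  by move=> t _; rewrite /cexp_i /=; ring.
set g := fun t => _.
have ex p q : ex_RInt g p q.
  by apply: ex_RInt_continuous => t _; exact: continuous_tent_sin.
(* The sine integrand is odd: reflecting the variable equates its integral with its opposite. *)
have := RInt_comp_lin g (-1) 0 (- a) a (ex _ _).
rewrite (RInt_ext _ g); last first.
  move=> t _; rewrite /g /scal /= /mult /= (_ : -1 * t + 0 = - t); last by ring.
  rewrite /tent Rabs_Ropp (_ : 2 * PI * (- t * y) = - (2 * PI * (t * y))); last by ring.
  by rewrite sin_neg; ring.
rewrite (_ : -1 * - a + 0 = a); last by ring.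
rewrite (_ : -1 * a + 0 = - a); last by ring.
rewrite -(opp_RInt_swap g a (- a)) ?/opp /=; last exact: ex.
lra.
Qed.

Lemma tenthat_bound_const a y : 0 <= a -> Rabs (tenthat a y) <= 2 * a ^ 2.
Proof.
move=> Ha; rewrite (_ : 2 * a ^ 2 = (a - - a) * a); last by ring.
apply: abs_RInt_le_const => [| |t _]; first lra.
  by apply: ex_RInt_continuous => t _; exact: continuous_tent_cos.
rewrite Rabs_mult -{2}(Rmult_1_r a); have [H1 H2] := tent_bounds t Ha.
rewrite (Rabs_pos_eq (tent a t)) //.
apply: Rmult_le_compat => //; first exact: Rabs_pos.
by apply/Rabs_le; have := COS_bound (2 * PI * (t * y)); lra.
Qed.

Lemma tenthat_split a y l1 l2 : 0 <= a ->
  is_RInt (fun t => (a + t) * cos (2 * PI * (t * y))) (- a) 0 l1 ->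
  is_RInt (fun t => (a - t) * cos (2 * PI * (t * y))) 0 a l2 ->
  tenthat a y = l1 + l2.
Proof.
move=> Ha H1 H2; apply: is_RInt_unique; apply: is_RInt_Chasles.
  apply: is_RInt_ext H1 => t; rewrite Rmin_left ?Rmax_right; try lra.
  by move=> Ht; rewrite /tent Rabs_left ?Rmax_right; try lra; congr Rmult; ring.
apply: is_RInt_ext H2 => t; rewrite Rmin_left ?Rmax_right; try lra.
by move=> Ht; rewrite /tent Rabs_right ?Rmax_right; try lra.
Qed.

Lemma tenthat_0 a : 0 <= a -> tenthat a 0 = a ^ 2.
Proof.
move=> Ha.
have E t : cos (2 * PI * (t * 0)) = 1 by rewrite !Rmult_0_r cos_0.
rewrite (@tenthat_split a 0 (a ^ 2 / 2) (a ^ 2 / 2)) //; first by field.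
  apply: (is_RInt_ext (fun t => a + t)) => [t _|]; first by rewrite E Rmult_1_r.
  have -> : a ^ 2 / 2 = minus (a * 0 + 0 ^ 2 / 2) (a * - a + (- a) ^ 2 / 2).
    by rewrite /minus /plus /opp /=; field.
  apply: (is_RInt_derive (fun t => a * t + t ^ 2 / 2)) => t _.
    by auto_derive => //; field.
  by apply: ex_derive_continuous; auto_derive.
apply: (is_RInt_ext (fun t => a - t)) => [t _|]; first by rewrite E Rmult_1_r.
have -> : a ^ 2 / 2 = minus (a * a - a ^ 2 / 2) (a * 0 - 0 ^ 2 / 2).
  by rewrite /minus /plus /opp /=; field.
apply: (is_RInt_derive (fun t => a * t - t ^ 2 / 2)) => t _.
  by auto_derive => //; field.
by apply: ex_derive_continuous; auto_derive.
Qed.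

(** Integration by parts on each side of the kink at the origin, carried out through explicit
    antiderivatives. *)
Lemma tenthat_neq0 a y : 0 <= a -> y <> 0 ->
  tenthat a y = 2 * (1 - cos (2 * PI * (a * y))) / (2 * PI * y) ^ 2.
Proof.
move=> Ha Hy; have PI0 := PI_RGT_0.
have Hw : 2 * PI * y <> 0 by apply: Rmult_integral_contrapositive_currified => //; lra.
set w := 2 * PI * y in Hw *.
have Ew t : 2 * PI * (t * y) = w * t by rewrite /w; ring.
rewrite (@tenthat_split a y ((1 - cos (w * a)) / w ^ 2) ((1 - cos (w * a)) / w ^ 2)) //.
- by rewrite Ew; field.
- have -> : (1 - cos (w * a)) / w ^ 2 =
      minus ((a + 0) * sin (w * 0) / w + cos (w * 0) / w ^ 2)
            ((a + - a) * sin (w * - a) / w + cos (w * - a) / w ^ 2).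
    rewrite /minus /plus /opp /= Rmult_0_r sin_0 cos_0.
    rewrite (_ : w * - a = - (w * a)); last by ring.
    by rewrite cos_neg; field.
  apply: (is_RInt_derive (fun t => (a + t) * sin (w * t) / w + cos (w * t) / w ^ 2)) => t _.
    by auto_derive => //; rewrite Ew; field.
  by apply: ex_derive_continuous; auto_derive.
have -> : (1 - cos (w * a)) / w ^ 2 =
    minus ((a - a) * sin (w * a) / w - cos (w * a) / w ^ 2)
          ((a - 0) * sin (w * 0) / w - cos (w * 0) / w ^ 2).
  by rewrite /minus /plus /opp /= Rmult_0_r sin_0 cos_0; field.
apply: (is_RInt_derive (fun t => (a - t) * sin (w * t) / w - cos (w * t) / w ^ 2)) => t _.
  by auto_derive => //; rewrite Ew; field.
by apply: ex_derive_continuous; auto_derive.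
Qed.

(** The sum of two estimates: [2 * a ^ 2] for the kernel itself, and 1 for the kernel times
    [y ^ 2]. *)
Lemma tenthat_decay a y : 0 <= a -> Rabs (tenthat a y) <= (2 * a ^ 2 + 1) / (1 + y ^ 2).
Proof.
move=> Ha; have := tenthat_bound_const y Ha.
have y2 : 0 <= y ^ 2 by exact: pow2_ge_0.
have Hy : Rabs (tenthat a y) * y ^ 2 <= 1.
  case: (Req_dec y 0) => [->|Hy]; first by rewrite /= Rmult_0_l Rmult_0_r; lra.
  have PI2 := PI2_1.
  rewrite tenthat_neq0 // Rabs_div; last by apply: pow_nonzero; nra.
  rewrite (Rabs_pos_eq ((_) ^ 2)); last exact: pow2_ge_0.
  rewrite Rabs_pos_eq; last by have := COS_bound (2 * PI * (a * y)); lra.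
  rewrite (_ : _ * y ^ 2 = 2 * (1 - cos (2 * PI * (a * y))) / (4 * PI ^ 2)); last first.
    by field; lra.
  apply/Rle_div_l; first nra.
  by have := COS_bound (2 * PI * (a * y)); nra.
by move=> H; apply/Rle_div_r; lra.
Qed.

(** By the half-angle formula the zeros are those of [sin (PI a y)] away from the origin, the first
    of them at [|y| = 1 / a]. *)
Lemma tenthat_nonzero a y : 0 < a -> Rabs y * a < 1 -> tenthat a y <> 0.
Proof.
move=> Ha Hya; have PI0 := PI_RGT_0.
case: (Req_dec y 0) => [->|Hy].
  by rewrite tenthat_0; [apply: pow_nonzero; lra|lra].
rewrite tenthat_neq0 //; last lra.
have Hs : sin (PI * (a * Rabs y)) <> 0.
  apply/Rgt_not_eq/sin_gt_0.
    by do 2 apply: Rmult_lt_0_compat => //; exact: Rabs_pos_lt.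
  by rewrite -{2}(Rmult_1_r PI); apply: Rmult_lt_compat_l; lra.
have -> : cos (2 * PI * (a * y)) = cos (2 * (PI * (a * Rabs y))).
  rewrite /Rabs; destruct (Rcase_abs y) as [H|H]; last by congr cos; ring.
  by rewrite -cos_neg; congr cos; ring.
rewrite cos_2a_sin => H.
have Hw : 2 * PI * y <> 0 by apply: Rmult_integral_contrapositive_currified => //; lra.
have Hw2 : (2 * PI * y) ^ 2 <> 0 by exact: pow_nonzero.
case: (Rmult_integral _ _ H) => [|/Rinv_neq_0_compat //]; first by nra.
Qed.

Definition tents {d} (a : R) (x : Rd d) : R := \big[Rmult/1]_i tent a (x i).

Lemma RtoC_prod (I : Type) (s : seq I) (u : I -> R) :
  RtoC (\big[Rmult/1]_(i <- s) u i) = \big[Cmult/RtoC 1]_(i <- s) RtoC (u i).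
Proof. by apply: (big_morph RtoC) => [x y|]; rewrite ?RtoC_mult. Qed.

Lemma cexp_i_dot d (x y : Rd d) :
  cexp_i (2 * PI * dot x y) = \big[Cmult/RtoC 1]_i cexp_i (2 * PI * (x i * y i)).
Proof.
rewrite /dot big_distrr /=; apply: (big_morph cexp_i); [exact: cexp_i_plus|exact: cexp_i_0].
Qed.

Lemma fcheck_tents d a (y : Rd d) : 0 <= a ->
  fcheck (fun x => RtoC (tents a x)) y = RtoC (\big[Rmult/1]_i tenthat a (y i)).
Proof.
move=> Ha; pose w (i : 'I_d) (t : R) := Cmult (RtoC (tent a t)) (cexp_i (2 * PI * (t * y i))).
rewrite RtoC_prod; transitivity (\big[Cmult/RtoC 1]_i CInt a (w i)); last first.
  by apply: eq_bigr => i _; exact: CInt_tent.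
rewrite -Lint_tensor //.
- congr Lint; apply: functional_extensionality => x.
  by rewrite /tents RtoC_prod cexp_i_dot -big_split.
- move=> i t; rewrite (_ : (fun s => _) = fun t => tent a t * cos (2 * PI * (t * y i))).
    exact: continuous_tent_cos.
  by apply: functional_extensionality => s; rewrite /w /cexp_i /=; ring.
- move=> i t; rewrite (_ : (fun s => _) = fun t => tent a t * sin (2 * PI * (t * y i))).
    exact: continuous_tent_sin.
  by apply: functional_extensionality => s; rewrite /w /cexp_i /=; ring.
by move=> i t Ht; rewrite /w tent_zero ?Cmult_0_l //; lra.
Qed.

Lemma rcont_tents d a : rcont (@tents d a).
Proof.
apply: rcont_prod => i; apply: rcont_comp (rcont_proj i); exact: continuous_tent.
Qed.

Lemma tents_ge0 d a (x : Rd d) : 0 <= tents a x.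
Proof.
rewrite /tents; elim/big_ind: _ => [|p q|i _]; [lra|exact: Rmult_le_pos|exact: Rmax_l].
Qed.

Lemma tents_zero d a (x : Rd d) : 0 <= a -> a < supn x -> tents a x = 0.
Proof.
move=> Ha Hx; have [i Hi] : exists i, a < Rabs (x i).
  apply: NNPP => H; apply: (Rlt_not_le _ _ Hx); apply: supn_lub => // i.
  by apply: Rnot_lt_le => Hi; apply: H; exists i.
by rewrite /tents (bigD1 i) //= tent_zero ?Rmult_0_l //; lra.
Qed.

Lemma tents_ge1 d a (x : Rd d) : supn x + 1 <= a -> 1 <= tents a x.
Proof.
move=> Ha; rewrite /tents; elim/big_ind: _ => [|p q|i _]; [lra|nra|].
apply: Rle_trans (Rmax_r _ _); have := Rabs_le_supn x i; lra.
Qed.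

Lemma Cc_tents d a : 0 <= a -> Cc (fun x : Rd d => RtoC (tents a x)).
Proof.
move=> Ha; apply: (@Cc_bounded_Cmod _ _ a); first exact/cont_fun_RtoC/rcont_tents.
by move=> x Hx; rewrite tents_zero.
Qed.

(** * The large sieve *)

Lemma Rsum_le (I : Type) (s : seq I) (F G : I -> R) : (forall i, F i <= G i) ->
  \big[Rplus/0]_(i <- s) F i <= \big[Rplus/0]_(i <- s) G i.
Proof.
by move=> H; elim/big_rec2: _ => [|i a b _]; [lra|have := H i; lra].
Qed.

Lemma Rsum_ge0 (I : Type) (s : seq I) (P : pred I) (F : I -> R) : (forall i, 0 <= F i) ->
  0 <= \big[Rplus/0]_(i <- s | P i) F i.
Proof.
by move=> H; elim/big_rec: _ => [|i a _]; [lra|have := H i; lra].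
Qed.

Lemma Cmod_sum (I : Type) (s : seq I) (F : I -> C) :
  Cmod (\big[Cplus/RtoC 0]_(i <- s) F i) <= \big[Rplus/0]_(i <- s) Cmod (F i).
Proof.
elim/big_rec2: _ => [|i a b _ H]; first by rewrite Cmod_0; lra.
by have := Cmod_triangle (F i) b; lra.
Qed.

Lemma Rsum_subset (T : eqType) (s t : seq T) (F : T -> R) : uniq s -> uniq t ->
  {subset s <= t} -> (forall x, 0 <= F x) ->
  \big[Rplus/0]_(x <- s) F x <= \big[Rplus/0]_(x <- t) F x.
Proof.
move=> us ut st HF; rewrite [X in _ <= X](bigID (mem s)) /=.
rewrite -[X in _ <= X + _]big_filter (perm_big s (r1 := filter _ t)) /=.
  by rewrite -[X in X <= _]Rplus_0_r; apply: Rplus_le_compat_l; exact: Rsum_ge0.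
apply: uniq_perm => //; first exact: filter_uniq.
by move=> x; rewrite mem_filter; case: (boolP (x \in s)) => [/st|].
Qed.

(** From [c_i c_j <= (c_i^2 + c_j^2) / 2]; symmetry of [E] makes the two halves equal, and each is
    bounded by row sums. *)
Lemma schur_test (I : Type) (s : seq I) (c : I -> R) (E : I -> I -> R) B :
  (forall i j, 0 <= E i j) -> (forall i j, E i j = E j i) ->
  (forall i, \big[Rplus/0]_(j <- s) E i j <= B) ->
  \big[Rplus/0]_(i <- s) \big[Rplus/0]_(j <- s) (c i * c j * E i j) <=
  B * \big[Rplus/0]_(i <- s) c i ^ 2.
Proof.
move=> E0 Esym HB.
pose S1 := \big[Rplus/0]_(i <- s) \big[Rplus/0]_(j <- s) (c i ^ 2 / 2 * E i j).
have HS1 : S1 <= B / 2 * \big[Rplus/0]_(i <- s) c i ^ 2.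
  rewrite big_distrr; apply: Rsum_le => i /=; rewrite -big_distrr /=.
  have ci : 0 <= c i ^ 2 / 2 by have := pow2_ge_0 (c i); lra.
  by have := Rmult_le_compat_l _ _ _ ci (HB i); lra.
have S2 : S1 = \big[Rplus/0]_(i <- s) \big[Rplus/0]_(j <- s) (c j ^ 2 / 2 * E i j).
  rewrite /S1 exchange_big; apply: eq_bigr => i _; apply: eq_bigr => j _.
  by rewrite Esym.
apply: (Rle_trans _ (S1 + S1)); last lra.
rewrite {2}S2 /S1 -big_split; apply: Rsum_le => i; rewrite -big_split; apply: Rsum_le => j.
by have := Rmult_le_pos _ _ (pow2_ge_0 (c i - c j)) (E0 i j); rewrite /=; lra.
Qed.

(** * Sums over the integer lattice *)

HB.instance Definition _ := hasDecEq.Build Z Z.eqb_spec.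

Definition lattice d := {ffun 'I_d -> Z}.
Definition latp {d} (j : lattice d) : Rd d := fun i => IZR (j i).

(** The lattice points of [[-N, N]^d], enumerated through finite functions so that a sum of products
    over them factors by distributivity. *)
Definition box d (N : nat) : seq (lattice d) :=
  [seq [ffun i => (Z.of_nat (J i) - Z.of_nat N)%Z] |
    J : {ffun 'I_d -> 'I_(2 * N).+1} <- index_enum {ffun 'I_d -> 'I_(2 * N).+1}].

Lemma box_uniq d N : uniq (box d N).
Proof.
rewrite map_inj_uniq; first exact: index_enum_uniq.
move=> J J' /ffunP H; apply/ffunP => i; apply: val_inj => /=.
by have := H i; rewrite !ffunE; lia.
Qed.

Lemma box_sub d (s : seq (lattice d)) : exists N, {subset s <= box d N}.
Proof.
have one (j : lattice d) : exists N, forall N', (N <= N')%N -> j \in box d N'.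
  have [N HN] : exists N, forall i, (Z.abs (j i) <= Z.of_nat N)%Z.
    exists (\max_i Z.to_nat (Z.abs (j i)))%N => i.
    by have /leP := @leq_bigmax _ (fun i => Z.to_nat (Z.abs (j i))) i; lia.
  exists N => N' /leP HN'; apply/mapP.
  have lt i : (Z.to_nat (j i + Z.of_nat N') < (2 * N').+1)%N.
    by apply/leP; rewrite mul2n -addnn -plusE; have := HN i; lia.
  exists [ffun i => Ordinal (lt i)]; first exact: mem_index_enum.
  by apply/ffunP => i; rewrite !ffunE /=; have := HN i; lia.
suff [N HN] : exists N, forall N', (N <= N')%N -> {subset s <= box d N'}.
  by exists N; exact: HN.
elim: s => [|j s [N HN]]; first by exists 0%N.
have [N1 H1] := one j; exists (maxn N N1) => N'; rewrite geq_max => /andP[h h1] x.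
by rewrite inE => /orP[/eqP ->|]; [exact: H1|exact: HN].
Qed.

Lemma box_prod d N (F : 'I_d -> R -> R) :
  \big[Rplus/0]_(j <- box d N) \big[Rmult/1]_i F i (latp j i) =
  \big[Rmult/1]_i \big[Rplus/0]_(m < (2 * N).+1) F i (INR m - INR N).
Proof.
rewrite /box big_map bigA_distr_bigA /=; apply: eq_bigr => J _; apply: eq_bigr => i _.
by rewrite /latp ffunE minus_IZR -!INR_IZR_INZ.
Qed.

(** The function [x / (1 + Rabs x)] increases and stays in [(-1, 1)]. Its unit increments are of
    order [1 / x^2], so they majorise the summand up to a constant while their sum telescopes to at
    most 2. *)
Lemma telescoping_majorant x : / (1 + x ^ 2) <=
  4 * ((x + 1) / (1 + Rabs (x + 1)) - x / (1 + Rabs x)).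
Proof.
have x2 := pow2_ge_0 x.
case: (Rle_lt_dec 0 x) => H0.
  rewrite !Rabs_pos_eq; try lra.
  rewrite (_ : 4 * _ = 4 / ((x + 1) * (x + 2))); last by field; lra.
  apply/Rle_div_r; first nra.
  by rewrite Rmult_comm; apply/Rle_div_l; nra.
case: (Rle_lt_dec 0 (x + 1)) => H1.
  rewrite Rabs_pos_eq // Rabs_left //.
  rewrite (_ : 4 * _ = 4 * (1 - 2 * x - 2 * x ^ 2) / ((x + 2) * (1 - x))); last by field; lra.
  apply/Rle_div_r; first nra.
  by rewrite Rmult_comm; apply/Rle_div_l; nra.
rewrite !Rabs_left //.
rewrite (_ : 4 * _ = 4 / (x * (x - 1))); last by field; lra.
apply/Rle_div_r; first nra.
by rewrite Rmult_comm; apply/Rle_div_l; nra.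
Qed.

Lemma sum_inv_square n c : \big[Rplus/0]_(m < n) / (1 + (INR m + c) ^ 2) <= 8.
Proof.
pose A x := x / (1 + Rabs x).
have HA x : Rabs (A x) <= 1.
  have := Rabs_pos x => H; rewrite /A Rabs_div; last lra.
  by rewrite (Rabs_pos_eq (1 + _)); [apply/Rle_div_l|]; lra.
suff H : \big[Rplus/0]_(m < n) / (1 + (INR m + c) ^ 2) <= 4 * (A (INR n + c) - A c).
  have /Rabs_le_between := HA (INR n + c); have /Rabs_le_between := HA c; lra.
elim: n => [|n IH]; first by rewrite big_ord0 /= Rplus_0_l; lra.
rewrite big_ord_recr /=; apply: Rle_trans (Rplus_le_compat _ _ _ _ IH (telescoping_majorant _)) _.
rewrite -/(INR n.+1) S_INR (_ : INR n + 1 + c = INR n + c + 1); last by ring.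
by rewrite /A; lra.
Qed.

(** The terms are nonnegative, so [s] may be enlarged to a box. There the sum factors over the
    coordinates, each contributing at most [8 * K]. *)
Lemma gram_sum d (K : R) (s : seq (lattice d)) k : 0 <= K -> uniq s ->
  \big[Rplus/0]_(j <- s) \big[Rmult/1]_i (K / (1 + (latp k i - latp j i) ^ 2)) <= (8 * K) ^ d.
Proof.
move=> HK us; have [N HN] := box_sub s.
have pos t : 0 <= K / (1 + t ^ 2).
  by apply: Rmult_le_pos => //; apply/Rlt_le/Rinv_0_lt_compat; have := pow2_ge_0 t; lra.
have ppos (j : lattice d) : 0 <= \big[Rmult/1]_i (K / (1 + (latp k i - latp j i) ^ 2)).
  by elim/big_ind: _ => [|a b|i _]; [lra|exact: Rmult_le_pos|exact: pos].
apply: Rle_trans (Rsum_subset us (box_uniq d N) HN ppos) _.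
rewrite (box_prod _ (fun i t => K / (1 + (latp k i - t) ^ 2))).
have -> : (8 * K) ^ d = \big[Rmult/1]_(i < d) (8 * K).
  rewrite big_const_ord; elim: {1 2}d => [//|n IH] /=.
  by rewrite IH.
suff [] : 0 <= \big[Rmult/1]_(i < d) \big[Rplus/0]_(m < (2 * N).+1)
    (K / (1 + (latp k i - (INR m - INR N)) ^ 2)) <= \big[Rmult/1]_(i < d) (8 * K) by [].
elim/big_ind2: _ => [|a b a' b' [h1 h2] [h3 h4]|i _]; first lra.
  by split; [exact: Rmult_le_pos|exact: Rmult_le_compat].
split; first by apply: Rsum_ge0 => m; exact: pos.
have := Rmult_le_compat_l K _ _ HK (sum_inv_square (2 * N).+1 (- INR N - latp k i)).
rewrite big_distrr /= (Rmult_comm 8); apply: Rle_trans; apply: Req_le.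
apply: eq_bigr => m _; rewrite /Rdiv; congr (_ * / (1 + _)); ring.
Qed.

Lemma fst_Lint_ge0 d (F : Rd d -> C) : Cc F -> (forall x, 0 <= fst (F x)) -> 0 <= fst (Lint F).
Proof. by move=> /Cc_Rc[M [H _]]; exact: LintR_ge0 H. Qed.

(** Selberg's form of the large sieve: expand [0 <= int chi |g - t sum_j c_j e_(-y_j)|^2], where
    [chi g = f] and [c_j = fcheck f (y_j)], and apply Schur's test to the Gram matrix
    [fcheck chi (y_k - y_j)]. *)
Lemma large_sieve d (f : Rd d -> C) : Cc f -> exists B, forall (s : seq (lattice d)) y,
  uniq s -> (forall j i, Rabs (y j i - latp j i) <= 1) ->
  \big[Rplus/0]_(j <- s) Cmod (fcheck f (y j)) ^ 2 <= B.
Proof.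
move=> Hf; have [Hfc [M [HM Hz]]] := proj1 (CcP f) Hf.
pose a := M + 1; have Ha : 0 <= a by rewrite /a; lra.
pose chi (x : Rd d) := RtoC (tents a x).
have Hchi : Cc chi by exact: Cc_tents.
(* The choice [a = M + 1] makes [tents a] at least 1 where [f] lives, so the maximum with 1 changes
   nothing there and keeps the divisor positive elsewhere. *)
pose g x := Cmult (RtoC (/ Rmax 1 (tents a x))) (f x).
have m1 (x : Rd d) : 1 <= Rmax 1 (tents a x) by exact: Rmax_l.
have Hg : Cc g.
  apply: Cc_multl => //; apply: cont_fun_RtoC; apply: rcont_inv => [|x].
    exact: rcont_max (rcont_const 1) (@rcont_tents d a).
  by have := m1 x; lra.
have Hgf x : f x = Cmult (RtoC (tents a x)) (g x).
  case: (Rle_lt_dec (supn x) M) => Hx; last by rewrite /g Hz // !Cmult_0_r.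
  have t1 : 1 <= tents a x by apply: tents_ge1; rewrite /a; lra.
  by rewrite /g Rmax_right // Cmult_assoc -RtoC_mult Rinv_r ?Cmult_1_l //; lra.
(* The factor 9 is the price of replacing differences of sample points by differences of lattice
   points: they differ by at most 2, and then [1 + n ^ 2 <= 9 * (1 + t ^ 2)]. *)
pose K := 9 * (2 * a ^ 2 + 1).
have K0 : 0 <= K by rewrite /K; have := pow2_ge_0 a; lra.
pose B := (8 * K) ^ d + 1.
have B1 : 1 <= B by rewrite /B; have := pow_le (8 * K) d ltac:(lra); lra.
pose G := Lint (fun x => Cmult (Cconj (g x)) (Cmult (chi x) (g x))).
exists (B * fst G) => s y us Hy.
pose c j := fcheck f (y j).
pose S := \big[Rplus/0]_(j <- s) Cmod (c j) ^ 2.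
have S0 : 0 <= S by apply: Rsum_ge0 => j; exact: pow2_ge_0.
pose e (z : Rd d) x := cexp_i (2 * PI * dot x z).
have ec z : cont_fun (e z) by exact: cont_fun_character.
(* The polynomial compared with [g] is [W]; its conjugate [Wb] is the one whose pairing with a test
   function produces values of [fcheck]. *)
pose Wb x := \big[Cplus/RtoC 0]_(j <- s) Cmult (Cconj (c j)) (e (y j) x).
pose W x := Cconj (Wb x).
have Wbc : cont_fun Wb.
  rewrite /Wb; elim: (s) => [|j s' IH].
    move: (cont_fun_const (d := d) (RtoC 0)); congr cont_fun.
    by apply: functional_extensionality => x; rewrite big_nil.
  move: (cont_fun_plus (cont_fun_mult (cont_fun_const (d := d) (Cconj (c j))) (ec (y j))) IH).
  by congr cont_fun; apply: functional_extensionality => x; rewrite big_cons.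
have Wc : cont_fun W by exact: cont_fun_conj.
have LW (h : Rd d -> C) : Cc h -> Lint (fun x => Cmult (Wb x) (h x)) =
    \big[Cplus/RtoC 0]_(j <- s) Cmult (Cconj (c j)) (fcheck h (y j)).
  move=> Hh; transitivity (Lint (fun x => \big[Cplus/RtoC 0]_(j <- s)
      Cmult (Cconj (c j)) (Cmult (h x) (e (y j) x)))).
    congr Lint; apply: functional_extensionality => x; rewrite /Wb big_distrl /=.
    by apply: eq_bigr => j _; rewrite -Cmult_assoc (Cmult_comm (h x)).
  rewrite Lint_sum => [|j]; last exact/Cc_scal/Cc_character.
  by apply: eq_bigr => j _; rewrite Lint_scal //; exact: Cc_character.
have LS : Lint (fun x => Cmult (Wb x) (f x)) = RtoC S.
  rewrite LW // /S (big_morph RtoC RtoC_plus (erefl _)); apply: eq_bigr => j _.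
  by rewrite Cmult_comm Cmod2_conj.
pose V := Lint (fun x => Cmult (Wb x) (Cmult (chi x) (W x))).
have HWchi : Cc (fun x => Cmult (chi x) (W x)) by exact: Cc_multr.
have fcW z : fcheck (fun x => Cmult (chi x) (W x)) z =
    \big[Cplus/RtoC 0]_(j <- s) Cmult (c j) (fcheck chi (vsub z (y j))).
  transitivity (Lint (fun x => \big[Cplus/RtoC 0]_(j <- s)
      Cmult (c j) (Cmult (chi x) (e (vsub z (y j)) x)))).
    congr Lint; apply: functional_extensionality => x.
    have -> : W x = \big[Cplus/RtoC 0]_(j <- s) Cmult (c j) (Cconj (e (y j) x)).
      rewrite /W /Wb (big_morph Cconj (op1 := Cplus) (id1 := RtoC 0)).
      - by apply: eq_bigr => j _; rewrite Cmult_conj Cconj_conj.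
      - exact: Cplus_conj.
      by rewrite /Cconj /RtoC /=; congr pair; ring.
    rewrite big_distrr big_distrl /=; apply: eq_bigr => j _.
    have -> : e (vsub z (y j)) x = Cmult (Cconj (e (y j) x)) (e z x).
      rewrite /e -cexp_i_opp -cexp_i_plus; congr cexp_i.
      by rewrite dotC dot_vsub (dotC z) (dotC (y j)); ring.
    by rewrite !Cmult_assoc (Cmult_comm (chi x)).
  rewrite Lint_sum => [|j]; last exact/Cc_scal/Cc_character.
  by apply: eq_bigr => j _; rewrite Lint_scal //; exact: Cc_character.
pose E (k j : lattice d) := \big[Rmult/1]_i (K / (1 + (latp k i - latp j i) ^ 2)).
have Epos t : 0 <= K / (1 + t ^ 2).
  by apply: Rmult_le_pos => //; apply/Rlt_le/Rinv_0_lt_compat; have := pow2_ge_0 t; lra.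
have HD k j : Cmod (fcheck chi (vsub (y k) (y j))) <= E k j.
  rewrite fcheck_tents // Cmod_R /E.
  elim/big_rec2: _ => [|i p q _ H]; first by rewrite Rabs_R1; lra.
  rewrite Rabs_mult; apply: Rmult_le_compat => //; try exact: Rabs_pos.
  apply: Rle_trans (tenthat_decay _ Ha) _; rewrite /vsub /K.
  set t := y k i - y j i; set n := latp k i - latp j i.
  have Hn : Rabs (n - t) <= 2.
    apply/Rabs_le; rewrite /n /t.
    by have /Rabs_le_between := Hy k i; have /Rabs_le_between := Hy j i; lra.
  have nt : 1 + n ^ 2 <= 9 * (1 + t ^ 2).
    have u2 : (n - t) ^ 2 <= 4 by move/Rabs_le_between: Hn => Hn; nra.
    by have := pow2_ge_0 (2 * t - n); have := pow2_ge_0 t; nra.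
  have := pow2_ge_0 a; have := pow2_ge_0 t; have := pow2_ge_0 n => n0 t0 a0.
  apply/Rle_div_l; first lra.
  rewrite (_ : _ / _ * _ = (2 * a ^ 2 + 1) * (9 * (1 + t ^ 2) / (1 + n ^ 2))); last by field; lra.
  rewrite -{1}(Rmult_1_r (2 * a ^ 2 + 1)); apply: Rmult_le_compat_l; first lra.
  by apply/Rle_div_r; lra.
have HV : fst V <= B * S.
  apply: Rle_trans (Rle_trans _ _ _ (Rle_abs _) (abs_fst_le _)) _.
  rewrite /V LW //; apply: Rle_trans (Cmod_sum _ _) _.
  apply: (Rle_trans _ (\big[Rplus/0]_(k <- s) \big[Rplus/0]_(j <- s)
      (Cmod (c k) * Cmod (c j) * E k j))).
    apply: Rsum_le => k; rewrite Cmod_mult Cmod_conj fcW.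
    rewrite (eq_bigr (fun j => Cmod (c k) * (Cmod (c j) * E k j))) => [|j _]; last by ring.
    rewrite -big_distrr /=; apply: Rmult_le_compat_l; first exact: Cmod_ge_0.
    apply: Rle_trans (Cmod_sum _ _) _; apply: Rsum_le => j; rewrite Cmod_mult.
    by apply: Rmult_le_compat_l; [exact: Cmod_ge_0|exact: HD].
  apply: schur_test => [k j|k j|k].
  - by rewrite /E; elim/big_ind: _ => [|p q|i _]; [lra|exact: Rmult_le_pos|exact: Epos].
  - by apply: eq_bigr => i _; congr (_ / (1 + _)); ring.
  by have := gram_sum k K0 us; rewrite /B /E; lra.
(* The choice minimises [fst G - 2 t S + t^2 B S], whose nonnegativity then reads
   [S <= B * fst G]. *)
pose t := / B.
(* Only the real part of [F] equals [chi |g - t W|^2]: the two cross terms are conjugate, so one of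
   them, doubled, has the right real part. *)
pose F x := Cplus (Cmult (Cconj (g x)) (Cmult (chi x) (g x)))
  (Cplus (Cmult (RtoC (-2 * t)) (Cmult (Wb x) (f x)))
         (Cmult (RtoC (t ^ 2)) (Cmult (Wb x) (Cmult (chi x) (W x))))).
have C1 : Cc (fun x => Cmult (Cconj (g x)) (Cmult (chi x) (g x))).
  by apply: Cc_multl; [exact/cont_fun_conj/Cc_cont|apply: Cc_multl => //; exact: Cc_cont].
have C2 : Cc (fun x => Cmult (Wb x) (f x)) by exact: Cc_multl.
have C3 : Cc (fun x => Cmult (Wb x) (Cmult (chi x) (W x))) by exact: Cc_multl.
have HF : Cc F by apply: Cc_plus => //; apply: Cc_plus; exact: Cc_scal.
have := fst_Lint_ge0 HF.
rewrite /F Lint_plus ?Lint_plus ?Lint_scal //; try exact: Cc_scal; last first.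
  by apply: Cc_plus; exact: Cc_scal.
rewrite LS -/G -/V => /(_ _) H.
have {}H : 0 <= fst G - 2 * t * S + t ^ 2 * fst V.
  have -> : fst G - 2 * t * S + t ^ 2 * fst V =
    fst (Cplus G (Cplus (Cmult (RtoC (-2 * t)) (RtoC S)) (Cmult (RtoC (t ^ 2)) V))).
    by rewrite /Cplus /Cmult /RtoC /fst /snd; ring.
  apply: H => x; rewrite (Hgf x) /chi /W.
  have := tents_ge0 a x; move: (tents a x) (g x) (Wb x) => h [g1 g2] [w1 w2] h0.
  rewrite /Cplus /Cmult /Cconj /RtoC /fst /snd.
  apply: (Rle_trans _ (h * ((g1 - t * w1) ^ 2 + (g2 + t * w2) ^ 2))); last by apply: Req_le; ring.
  apply: Rmult_le_pos => //.
  by have := pow2_ge_0 (g1 - t * w1); have := pow2_ge_0 (g2 + t * w2); lra.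
have t0 : 0 < t by apply: Rinv_0_lt_compat; lra.
have tB : t * B = 1 by rewrite /t Rinv_l //; lra.
have H2 : t ^ 2 * fst V <= t * S.
  have := Rmult_le_compat_l (t ^ 2) _ _ (pow2_ge_0 t) HV.
  have E2 : t ^ 2 * (B * S) = (t * B) * (t * S) by ring.
  by rewrite E2 tB Rmult_1_l.
change (S <= B * fst G).
have : B * (t * S) <= B * fst G by apply: Rmult_le_compat_l; lra.
by rewrite -Rmult_assoc (Rmult_comm B) tB; lra.
Qed.

(** * Uniform integrability *)

(** As a difference of two ramps, the tent has integer translates whose sum telescopes; this gives
    the partition of unity. *)
Lemma tent1_clip u : tent 1 u = clip (u + 1) - clip u.
Proof.
rewrite /tent; case: (Rle_lt_dec 1 u) => H1.
  by rewrite !clip_ge1 ?Rabs_pos_eq ?Rmax_left; lra.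
case: (Rle_lt_dec u (-1)) => H2.
  by rewrite !clip_le0 ?Rabs_left ?Rmax_left; lra.
have clipE t : 0 <= t <= 1 -> clip t = t.
  by move=> Ht; rewrite /clip Rmin_right ?Rmax_right; lra.
case: (Rle_lt_dec 0 u) => H3.
  by rewrite (clip_ge1 (t := u + 1)) ?clipE ?Rabs_pos_eq ?Rmax_right; lra.
by rewrite (clip_le0 (t := u)) ?clipE ?Rabs_left ?Rmax_right; lra.
Qed.

Lemma tents_partition d N (x : Rd d) : supn x <= INR N ->
  \big[Rplus/0]_(j <- box d N) tents 1 (vsub x (latp j)) = 1.
Proof.
move=> Hx; rewrite /tents /vsub (box_prod N (fun i t => tent 1 (x i - t))).
rewrite big1 // => i _.
suff H n : \big[Rplus/0]_(m < n) tent 1 (x i - (INR m - INR N)) =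
    clip (x i + INR N + 1) - clip (x i + INR N + 1 - INR n).
  have := Rabs_le_supn x i => /Rabs_le_between h.
  rewrite H S_INR mult_INR (clip_ge1 (t := _ + _)) ?clip_le0 /=; lra.
elim: n => [|n IH]; first by rewrite big_ord0 /= Rminus_0_r; ring.
rewrite big_ord_recr /= IH tent1_clip -/(INR n.+1) S_INR.
rewrite (_ : x i - (INR n - INR N) + 1 = x i + INR N + 1 - INR n); last by ring.
rewrite (_ : x i - (INR n - INR N) = x i + INR N + 1 - (INR n + 1)); last by ring.
ring.
Qed.

(** * Measures: linearity and local bounds *)

Lemma measure_plus d (sigma : measure_fun d) f g : is_measure sigma -> Cc f -> Cc g ->
  sigma (fun x => Cplus (f x) (g x)) = Cplus (sigma f) (sigma g).
Proof. by case=> H _; exact: H. Qed.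

Lemma measure_scal d (sigma : measure_fun d) (c : C) f : is_measure sigma -> Cc f ->
  sigma (fun x => Cmult c (f x)) = Cmult c (sigma f).
Proof. by case=> _ [H _]; exact: H. Qed.

Lemma measure_0 d (sigma : measure_fun d) : is_measure sigma ->
  sigma (fun _ => RtoC 0) = RtoC 0.
Proof.
move=> Hs; rewrite (_ : (fun _ => _) = fun x : Rd d => Cmult (RtoC 0) (RtoC 0)).
  by rewrite measure_scal ?Cmult_0_l //; exact: Cc_0.
by apply: functional_extensionality => x; rewrite Cmult_0_l.
Qed.

Lemma measure_sum d (sigma : measure_fun d) (I : Type) (s : seq I) (F : I -> Rd d -> C) :
  is_measure sigma -> (forall i, Cc (F i)) ->
  sigma (fun x => \big[Cplus/RtoC 0]_(i <- s) F i x) = \big[Cplus/RtoC 0]_(i <- s) sigma (F i).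
Proof.
move=> Hs HF; elim: s => [|i s IH].
  rewrite big_nil -[RHS](measure_0 Hs); congr sigma.
  by apply: functional_extensionality => x; rewrite big_nil.
rewrite big_cons -IH -measure_plus //; last exact: Cc_sum.
by congr sigma; apply: functional_extensionality => x; rewrite big_cons.
Qed.

Lemma measure_sub d (sigma : measure_fun d) f g : is_measure sigma -> Cc f -> Cc g ->
  sigma (fun x => Cminus (f x) (g x)) = Cminus (sigma f) (sigma g).
Proof.
move=> Hs Hf Hg; have E (z : C) : Copp z = Cmult (RtoC (-1)) z.
  by rewrite /Copp /Cmult /RtoC /=; congr pair; ring.
rewrite /Cminus (E (sigma g)) -measure_scal // -measure_plus //; last exact: Cc_scal.
by congr sigma; apply: functional_extensionality => x; rewrite E.
Qed.

(** The function [phi] given by [tv_set_le] with slack 1, whence [c + 1], is at least 1 on [S] and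
    so dominates [h / m]. When [m = 0], [h] vanishes. *)
Lemma tv_bound d (sigma : measure_fun d) S c h m : is_measure sigma -> tv_set_le sigma S c -> Cc h ->
  (forall x, ~ S x -> h x = RtoC 0) -> (forall x, Cmod (h x) <= m) ->
  Cmod (sigma h) <= (c + 1) * m.
Proof.
move=> Hs Htv Hh Hz Hm; have [phi [_ [phi0 [phi1 Hphi]]]] := Htv 1 Rlt_0_1.
have m0 : 0 <= m by apply: Rle_trans (Cmod_ge_0 _) (Hm vzero).
case: (Rle_lt_or_eq_dec _ _ m0) => {}m0; last first.
  rewrite (_ : h = fun _ => RtoC 0) ?(measure_0 Hs) ?Cmod_0; first by rewrite -m0; lra.
  apply: functional_extensionality => x; apply: Cmod_eq_0; apply: Rle_antisym.
    by rewrite m0.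
  exact: Cmod_ge_0.
have inv0 : 0 < / m by exact: Rinv_0_lt_compat.
have := Hphi (fun x => Cmult (RtoC (/ m)) (h x)) (Cc_scal _ Hh).
rewrite measure_scal // Cmod_mult Cmod_R (Rabs_pos_eq (/ m)); last lra.
move=> H; have {}H : / m * Cmod (sigma h) <= c + 1.
  apply: H => x; rewrite Cmod_mult Cmod_R (Rabs_pos_eq (/ m)); last lra.
  case: (classic (S x)) => Sx; last by rewrite Hz // Cmod_0 Rmult_0_r.
  apply: Rle_trans (phi1 x Sx); have := Rmult_le_compat_l (/ m) _ _ (Rlt_le _ _ inv0) (Hm x).
  by rewrite Rinv_l; lra.
have := Rmult_le_compat_r m _ _ (Rlt_le _ _ m0) H.
by rewrite (_ : / m * _ * m = Cmod (sigma h)); [lra|field; lra].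
Qed.

Definition unit_cube d : Rd d -> Prop := fun x => supn x <= 1.

(** The partition of unity cuts [k] into pieces, each supported in a unit cube where it is at most
    [b j] and [sigma] costs at most [c + 1]. The pieces on the cubes of [s0], where [k] vanishes,
    are dropped; this serves the tail estimate. *)
Lemma sampled_bound d (sigma : measure_fun d) (c : R) (p : Rd d -> R) (b : lattice d -> R)
  (s0 : seq (lattice d)) k :
  is_measure sigma ->
  (forall t, tv_set_le sigma (translate t (@unit_cube d)) c) -> 0 <= c + 1 ->
  (forall j, 0 <= b j) ->
  (forall j x, supn (vsub x (latp j)) <= 1 -> p x <= b j) ->
  Cc k -> (forall x, Cmod (k x) <= p x) ->
  (forall j x, j \in s0 -> supn (vsub x (latp j)) <= 1 -> k x = RtoC 0) ->
  exists s, uniq s /\ (forall j, j \in s -> j \notin s0) /\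
    Cmod (sigma k) <= (c + 1) * \big[Rplus/0]_(j <- s) b j.
Proof.
move=> Hs Htv c0 b0 Hb Hk Hkp Hks.
have [_ [M [HM Hz]]] := proj1 (CcP k) Hk.
have [N HN] := INR_unbounded M.
pose kj (j : lattice d) x := Cmult (RtoC (tents 1 (vsub x (latp j)))) (k x).
have Hkj j : Cc (kj j).
  apply: Cc_multl => //; apply/cont_fun_RtoC.
  apply/rcontP => x eps Heps; have /rcontP/(_ (vsub x (latp j)) _ Heps)[r [Hr Hd]] := @rcont_tents d 1.
  exists r; split=> // y Hy; apply: Hd; rewrite (_ : vsub _ _ = vsub y x) //.
  by apply: functional_extensionality => i; rewrite /vsub; ring.
have Ek : k = fun x => \big[Cplus/RtoC 0]_(j <- box d N) kj j x.
  apply: functional_extensionality => x; rewrite -big_distrl /=.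
  case: (Rle_lt_dec (supn x) M) => Hx; last by rewrite Hz // Cmult_0_r.
  rewrite -(big_morph RtoC RtoC_plus (erefl _)) tents_partition ?Cmult_1_l //; lra.
exists [seq j <- box d N | j \notin s0]; split; first exact/filter_uniq/box_uniq.
split; first by move=> j; rewrite mem_filter => /andP[].
rewrite {1}Ek measure_sum //; apply: Rle_trans (Cmod_sum _ _) _.
rewrite big_distrr big_filter [X in X <= _](bigID (mem s0)) /= big1 ?Rplus_0_l => [|j js]; last first.
  rewrite (_ : kj j = fun _ => RtoC 0) ?(measure_0 Hs) ?Cmod_0 //.
  apply: functional_extensionality => x; rewrite /kj.
  case: (Rle_lt_dec (supn (vsub x (latp j))) 1) => Hx; first by rewrite (Hks j) // Cmult_0_r.
  by rewrite tents_zero ?Cmult_0_l //; lra.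
rewrite -[X in X <= _]big_filter -[X in _ <= X]big_filter; apply: Rsum_le => j.
apply: (tv_bound Hs (Htv (latp j))) => // x.
  by rewrite /translate /unit_cube /kj => Hx; rewrite tents_zero ?Cmult_0_l //; lra.
rewrite /kj Cmod_mult Cmod_R Rabs_pos_eq; last exact: tents_ge0.
case: (Rle_lt_dec (supn (vsub x (latp j))) 1) => Hx; last first.
  by rewrite tents_zero ?Rmult_0_l //; lra.
apply: Rle_trans (Hb j x Hx); apply: Rle_trans (Hkp x).
rewrite -[X in _ <= X]Rmult_1_l; apply: Rmult_le_compat_r; first exact: Cmod_ge_0.
rewrite /tents; suff [] : 0 <= \big[Rmult/1]_i tent 1 (vsub x (latp j) i) <= 1 by [].
elim/big_ind: _ => [|a a' h h'|i _]; [lra| |by apply: tent_bounds; lra].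
by split; [apply: Rmult_le_pos; lra|rewrite -(Rmult_1_l 1); apply: Rmult_le_compat; lra].
Qed.

(** If the supremum is positive, some value exceeds half of it; otherwise [p] vanishes on [S] and
    any point will do. *)
Lemma near_maximum d (p : Rd d -> R) B (S : Rd d -> Prop) x0 :
  S x0 -> (forall x, 0 <= p x <= B) -> exists y, S y /\ forall x, S x -> p x <= 2 * p y.
Proof.
move=> Sx0 Hp; pose E r := exists x, S x /\ r = p x.
have [m [Hm1 Hm2]] : { m | is_lub E m }.
  apply: completeness; last by exists (p x0), x0.
  by exists B => r [x [_ ->]]; have := Hp x; lra.
have m0 : p x0 <= m by apply: Hm1; exists x0.
case: (Rle_lt_dec m 0) => Hm.
  exists x0; split=> // x Sx; have : p x <= m by apply: Hm1; exists x.
  by have := Hp x0; lra.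
have [y [Sy Hy]] : exists y, S y /\ m / 2 < p y.
  apply: NNPP => H; have : m <= m / 2; last lra.
  apply: Hm2 => r [x [Sx ->]]; apply: Rnot_lt_le => Hx; apply: H; by exists x.
by exists y; split=> // x Sx; have : p x <= m by [apply: Hm1; exists x]; lra.
Qed.

(** Take [s0] with sum within [eps] of the supremum of all finite sums: a disjoint list can add no
    more than the remaining gap. *)
Lemma summable_tail (T : eqType) (b : T -> R) B : (forall j, 0 <= b j) ->
  (forall s, uniq s -> \big[Rplus/0]_(j <- s) b j <= B) ->
  forall eps, 0 < eps -> exists s0 : seq T, forall s, uniq s ->
    (forall j, j \in s -> j \notin s0) -> \big[Rplus/0]_(j <- s) b j <= eps.
Proof.
move=> b0 HB eps Heps; pose E r := exists s, uniq s /\ r = \big[Rplus/0]_(j <- s) b j.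
have [m [Hm1 Hm2]] : { m | is_lub E m }.
  apply: completeness; last by exists 0, [::]; rewrite big_nil.
  by exists B => r [s [us ->]]; exact: HB.
have [s0 [us0 Hs0]] : exists s0, uniq s0 /\ m - eps < \big[Rplus/0]_(j <- s0) b j.
  apply: NNPP => H; have : m <= m - eps; last lra.
  apply: Hm2 => r [s [us ->]]; apply: Rnot_lt_le => Hx; apply: H; by exists s.
exists s0 => s us Hs; have : \big[Rplus/0]_(j <- s0 ++ s) b j <= m.
  apply: Hm1; exists (s0 ++ s); split=> //; rewrite cat_uniq us0 us andbT /=.
  by apply/hasPn => j /Hs.
by rewrite big_cat /=; lra.
Qed.

(** The numbers [b j] bounding [|fcheck f|^2] on the unit cubes are summable and depend on [f]
    alone; the measures enter only through the common constant [c]. Hence both the bound and the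
    radius are uniform in [n]. *)
Lemma equi_tail d (sigmas : nat -> measure_fun d) (f : Rd d -> C) :
  (forall n, is_measure (sigmas n)) -> equi_translation_bounded sigmas -> Cc f ->
  (exists B, forall n k, Cc k -> (forall x, Cmod (k x) <= Cmod (fcheck f x) ^ 2) ->
     Cmod (sigmas n k) <= B) /\
  forall eps, 0 < eps -> exists M, forall n k, Cc k ->
     (forall x, Cmod (k x) <= Cmod (fcheck f x) ^ 2) ->
     (forall x, supn x <= M -> k x = RtoC 0) -> Cmod (sigmas n k) <= eps.
Proof.
move=> Hs Htb Hf; have [c Hc] := Htb _ (cube_compact d 1).
have c1 : 0 <= c + 1.
  have [phi [_ [phi0 [_ Hphi]]]] := Hc 0%N vzero 1 Rlt_0_1.
  apply: Rle_trans (Hphi (fun _ => RtoC 0) (Cc_0 d) _); first exact: Cmod_ge_0.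
  by move=> x; rewrite Cmod_0.
pose p x := Cmod (fcheck f x) ^ 2.
have [P HP] : exists P, forall x, 0 <= p x <= P.
  have [Hfc [M [HM Hz]]] := proj1 (CcP f) Hf; have [B [HB0 HB]] := Cc_bounded Hf.
  exists ((2 * (2 * M) ^ d * B) ^ 2) => x; split; first exact: pow2_ge_0.
  apply: pow_incr; split; first exact: Cmod_ge_0.
  apply: Lint_bound => //; first exact: cont_fun_mult Hfc (cont_fun_character x).
    by move=> z Hzz; rewrite Hz // Cmult_0_l.
  by move=> z; rewrite Cmod_mult Cmod_cexp_i Rmult_1_r.
have Hmax (j : lattice d) : { y | supn (vsub y (latp j)) <= 1 /\
    forall x, supn (vsub x (latp j)) <= 1 -> p x <= 2 * p y }.
  apply: constructive_indefinite_description.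
  apply: (@near_maximum _ p P (fun y => supn (vsub y (latp j)) <= 1) (latp j)) => //.
  by rewrite vsub_diag supn_vzero; lra.
pose y j := proj1_sig (Hmax j).
have Hy j : supn (vsub (y j) (latp j)) <= 1 by rewrite /y; case: (Hmax j) => z [].
pose b j := 2 * p (y j).
have Hb j x : supn (vsub x (latp j)) <= 1 -> p x <= b j.
  by rewrite /b /y; case: (Hmax j) => z /= [_]; exact.
have b0 j : 0 <= b j by rewrite /b; have := HP (y j); lra.
have [B HB] := large_sieve Hf.
have Hbs s : uniq s -> \big[Rplus/0]_(j <- s) b j <= 2 * B.
  move=> us; rewrite /b -big_distrr /=; apply: Rmult_le_compat_l; first lra.
  apply: HB => // j i; exact: Rle_trans (Rabs_le_supn _ i) (Hy j).
split.
  exists ((c + 1) * (2 * B)) => n k Hk Hkp.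
  have [s [us [_ H]]] := @sampled_bound d _ c p b [::] k (Hs n) (Hc n) c1 b0 Hb Hk Hkp
    (fun j x H => False_ind _ (notF H)).
  by apply: Rle_trans H _; apply: Rmult_le_compat_l => //; exact: Hbs.
move=> eps Heps.
have He : 0 < eps / (c + 1 + 1) by apply: Rdiv_lt_0_compat; lra.
have [s0 Hs0] := summable_tail b0 Hbs He.
(* A cube containing all unit cubes centred at points of [s0]; the sum is a crude bound for the
   largest norm. *)
exists (1 + \big[Rplus/0]_(j <- s0) supn (latp j)) => n k Hk Hkp Hkz.
have [|s [us [Hss H]]] := @sampled_bound d _ c p b s0 k (Hs n) (Hc n) c1 b0 Hb Hk Hkp.
  move=> j x js Hx; apply: Hkz; have := supn_le_add x (latp j).
  have : supn (latp j) <= \big[Rplus/0]_(j <- s0) supn (latp j).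
    rewrite (big_rem j js) /=; rewrite -{1}(Rplus_0_r (supn (latp j))).
    by apply: Rplus_le_compat_l; apply: Rsum_ge0 => i; exact: supn_ge0.
  lra.
apply: Rle_trans H _; apply: (Rle_trans _ ((c + 1) * (eps / (c + 1 + 1)))).
  by apply: Rmult_le_compat_l => //; exact: Hs0.
rewrite (_ : (c + 1) * _ = eps - eps / (c + 1 + 1)); [lra|field; lra].
Qed.

(** * Trigonometric approximation *)

Definition multiplier {d} (P : Rd d -> C) : Prop :=
  forall f, Cc f -> exists g, Cc g /\ forall y, fcheck g y = Cmult (P y) (fcheck f y).

Lemma multiplier_plus d (P Q : Rd d -> C) :
  multiplier P -> multiplier Q -> multiplier (fun y => Cplus (P y) (Q y)).
Proof.
move=> HP HQ f Hf; have [g [Hg Eg]] := HP f Hf; have [h [Hh Eh]] := HQ f Hf.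
exists (fun x => Cplus (g x) (h x)); split=> [|y]; first exact: Cc_plus.
by rewrite fcheck_plus // Eg Eh Cmult_plus_distr_r.
Qed.

Lemma multiplier_scal d (c : C) (P : Rd d -> C) :
  multiplier P -> multiplier (fun y => Cmult c (P y)).
Proof.
move=> HP f Hf; have [g [Hg Eg]] := HP f Hf.
exists (fun x => Cmult c (g x)); split=> [|y]; first exact: Cc_scal.
by rewrite fcheck_scal // Eg Cmult_assoc.
Qed.

Lemma multiplier_character d (a : Rd d) : multiplier (fun y => cexp_i (2 * PI * dot a y)).
Proof.
move=> f Hf; exists (fun x => f (vsub x a)); split=> [|y]; first exact: Cc_translate.
exact: fcheck_translate.
Qed.

Lemma dot_dir d (i : 'I_d) c y : dot (vscale c (dir i)) y = c * y i.
Proof.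
rewrite dot_vscale /dot (bigD1 i) //= big1 => [|j /negbTE ji]; last by rewrite /dir ji Rmult_0_l.
by rewrite /dir eqxx; ring.
Qed.

Lemma multiplier_cexp_i d (i : 'I_d) a b : multiplier (fun y => cexp_i (a * y i + b)).
Proof.
have := multiplier_scal (cexp_i b) (multiplier_character (vscale (a / (2 * PI)) (dir i))).
congr multiplier; apply: functional_extensionality => y.
rewrite -cexp_i_plus dot_dir; congr cexp_i; field.
by have := PI_RGT_0; lra.
Qed.

Lemma multiplier_cos d (i : 'I_d) a b : multiplier (fun y => RtoC (cos (a * y i + b))).
Proof.
have H := multiplier_plus (multiplier_cexp_i i a b) (multiplier_cexp_i i (- a) (- b)).
have := multiplier_scal (RtoC (/ 2)) H; congr multiplier.
apply: functional_extensionality => y.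
rewrite (_ : - a * y i + - b = - (a * y i + b)); last by ring.
by rewrite cexp_i_opp /cexp_i /Cconj /Cplus /Cmult /RtoC /=; congr pair; field.
Qed.

Lemma multiplier_sin d (i : 'I_d) a b : multiplier (fun y => RtoC (sin (a * y i + b))).
Proof.
have := multiplier_cos i (- a) (PI / 2 - b); congr multiplier.
by apply: functional_extensionality => y; rewrite -cos_shift; congr (RtoC (cos _)); ring.
Qed.

Lemma ext_int_plus d (sigma : measure_fun d) h1 h2 v1 v2 : is_measure sigma ->
  cont_fun h1 -> cont_fun h2 -> ext_int sigma h1 v1 -> ext_int sigma h2 v2 ->
  ext_int sigma (fun x => Cplus (h1 x) (h2 x)) (Cplus v1 v2).
Proof.
move=> Hs c1 c2 H1 H2 eps Heps.
have [M1 {}H1] := H1 (eps / 2) ltac:(lra); have [M2 {}H2] := H2 (eps / 2) ltac:(lra).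
exists (Rmax M1 M2) => phi Hphi Hb Hone.
rewrite (_ : (fun x => _) = fun x => Cplus (Cmult (h1 x) (RtoC (phi x)))
  (Cmult (h2 x) (RtoC (phi x)))); last first.
  by apply: functional_extensionality => x; rewrite Cmult_plus_distr_r.
rewrite measure_plus //; try exact: Cc_multl.
set s1 := sigma _; set s2 := sigma _.
rewrite (_ : Cminus _ _ = Cplus (Cminus s1 v1) (Cminus s2 v2)); last first.
  by rewrite /Cminus /Cplus /Copp /=; congr pair; ring.
apply: Rle_lt_trans (Cmod_triangle _ _) _.
have : Cmod (Cminus s1 v1) < eps / 2.
  by apply: H1 => // x Hx; apply: Hone; exact: Rle_trans Hx (Rmax_l _ _).
have : Cmod (Cminus s2 v2) < eps / 2.
  by apply: H2 => // x Hx; apply: Hone; exact: Rle_trans Hx (Rmax_r _ _).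
lra.
Qed.

Lemma ext_int_scal d (sigma : measure_fun d) (c : C) h v : is_measure sigma ->
  cont_fun h -> ext_int sigma h v -> ext_int sigma (fun x => Cmult c (h x)) (Cmult c v).
Proof.
move=> Hs ch H eps Heps; have c0 := Cmod_ge_0 c.
have [M {}H] := H (eps / (Cmod c + 1)) ltac:(apply: Rdiv_lt_0_compat; lra).
exists M => phi Hphi Hb Hone.
rewrite (_ : (fun x => _) = fun x => Cmult c (Cmult (h x) (RtoC (phi x)))); last first.
  by apply: functional_extensionality => x; rewrite Cmult_assoc.
rewrite measure_scal //; last exact: Cc_multl.
rewrite (_ : Cminus _ _ = Cmult c (Cminus (sigma (fun x => Cmult (h x) (RtoC (phi x)))) v)); last first.
  by rewrite /Cminus /Cplus /Copp /Cmult /=; congr pair; ring.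
rewrite Cmod_mult; have := H phi Hphi Hb Hone; set t := Cmod (Cminus _ _) => Ht.
have : Cmod c * t <= Cmod c * (eps / (Cmod c + 1)) by apply: Rmult_le_compat_l; lra.
rewrite (_ : Cmod c * (eps / (Cmod c + 1)) = eps - eps / (Cmod c + 1)); last by field; lra.
by have : 0 < eps / (Cmod c + 1); [apply: Rdiv_lt_0_compat; lra|lra].
Qed.

Lemma cont_fun_sqmod d (f : Rd d -> C) : cont_fun f -> cont_fun (sqmod f).
Proof.
move=> /rcont_Cmod H; apply: cont_fun_RtoC.
exact: (rcont_mult H (rcont_mult H (rcont_const 1))).
Qed.

(** The functions [a] for which [m] determines the integrals of [a |fcheck f|^2] against any Fourier
    transform [sigma] of [m], through a test function independent of [m] and [sigma]. *)
Definition representable {d} (a : Rd d -> C) : Prop :=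
  cont_fun a /\ forall f, Cc f -> exists F, Cc F /\ forall m sigma,
    is_measure m -> is_FT m sigma ->
    ext_int sigma (fun x => Cmult (a x) (sqmod (fcheck f) x)) (m F).

Lemma representable_1 d : representable (fun _ : Rd d => RtoC 1).
Proof.
split=> [|f Hf]; first exact: cont_fun_const.
exists (conv f (ftilde f)); split=> [|m sigma _ [_ /(_ f Hf) [_ H]]].
  exact/Cc_conv/Cc_ftilde.
move: H; congr ext_int; apply: functional_extensionality => x.
by rewrite Cmult_1_l.
Qed.

Lemma representable_plus d (a b : Rd d -> C) :
  representable a -> representable b -> representable (fun x => Cplus (a x) (b x)).
Proof.
move=> [ca Ha] [cb Hb]; split=> [|f Hf]; first exact: cont_fun_plus.
have [F [HF EF]] := Ha f Hf; have [G [HG EG]] := Hb f Hf.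
exists (fun x => Cplus (F x) (G x)); split=> [|m sigma Hm Hs]; first exact: Cc_plus.
have cf := cont_fun_sqmod (cont_fun_fcheck Hf).
rewrite measure_plus //; have [s _] := Hs.
have := ext_int_plus s (cont_fun_mult ca cf) (cont_fun_mult cb cf) (EF _ _ Hm Hs) (EG _ _ Hm Hs).
by congr ext_int; apply: functional_extensionality => x; rewrite Cmult_plus_distr_r.
Qed.

Lemma representable_scal d (c : C) (a : Rd d -> C) :
  representable a -> representable (fun x => Cmult c (a x)).
Proof.
move=> [ca Ha]; split=> [|f Hf]; first exact: cont_fun_mult (cont_fun_const c) ca.
have [F [HF EF]] := Ha f Hf.
exists (fun x => Cmult c (F x)); split=> [|m sigma Hm Hs]; first exact: Cc_scal.
have cf := cont_fun_sqmod (cont_fun_fcheck Hf).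
rewrite measure_scal //; have [s _] := Hs.
have := ext_int_scal c s (cont_fun_mult ca cf) (EF _ _ Hm Hs).
by congr ext_int; apply: functional_extensionality => x; rewrite Cmult_assoc.
Qed.

(** If [fcheck g = p * fcheck f], then [p^2 |fcheck f|^2 = |fcheck g|^2], so the test function of
    [a] at [g] serves [p^2 a] at [f]. This is why [representable] quantifies over every [f] in
    [C_c]. *)
Lemma representable_sqr d (p : Rd d -> R) (a : Rd d -> C) :
  rcont p -> multiplier (fun y => RtoC (p y)) -> representable a ->
  representable (fun x => Cmult (RtoC (p x ^ 2)) (a x)).
Proof.
move=> cp Hp [ca Ha]; split=> [|f Hf].
  apply: cont_fun_mult => //; apply: cont_fun_RtoC.
  exact: (rcont_mult cp (rcont_mult cp (rcont_const 1))).
have [g [Hg Eg]] := Hp f Hf; have [F [HF EF]] := Ha g Hg.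
exists F; split=> // m sigma Hm Hs; move: (EF m sigma Hm Hs); congr ext_int.
apply: functional_extensionality => x; rewrite /sqmod Eg Cmod_mult Cmod_R.
rewrite Rpow_mult_distr pow2_abs RtoC_mult.
by rewrite Cmult_assoc (Cmult_comm (a x)).
Qed.

(** * Bernstein approximation as an expectation over independent trials *)

Definition incr {d} (k : 'I_d -> nat) (i : 'I_d) : 'I_d -> nat :=
  fun j => if j == i then (k j).+1 else k j.

(** Expectation of [G] at the numbers of successes after the independent trials listed in [L], a
    trial [i] having probability of success [s i]; started from the counts [k]. *)
Fixpoint flips {d} (s : 'I_d -> R) (L : seq 'I_d) (G : ('I_d -> nat) -> C) (k : 'I_d -> nat) : C :=
  match L with
  | [::] => G k
  | i :: L' => Cplus (Cmult (RtoC (s i)) (flips s L' G (incr k i)))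
                     (Cmult (RtoC (1 - s i)) (flips s L' G k))
  end.

Fixpoint flipsR {d} (s : 'I_d -> R) (L : seq 'I_d) (G : ('I_d -> nat) -> R) (k : 'I_d -> nat) : R :=
  match L with
  | [::] => G k
  | i :: L' => s i * flipsR s L' G (incr k i) + (1 - s i) * flipsR s L' G k
  end.

Lemma Cmod_flips_sub d (s : 'I_d -> R) L G (c : C) k : (forall i, 0 <= s i <= 1) ->
  Cmod (Cminus (flips s L G k) c) <= flipsR s L (fun k => Cmod (Cminus (G k) c)) k.
Proof.
move=> Hs; elim: L k => [|i L IH] k /=; first lra.
set u := flips s L G (incr k i); set v := flips s L G k.
rewrite (_ : Cminus _ c = Cplus (Cmult (RtoC (s i)) (Cminus u c))
  (Cmult (RtoC (1 - s i)) (Cminus v c))); last first.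
  by rewrite /Cminus /Cplus /Copp /Cmult /RtoC /=; congr pair; ring.
have := Hs i => si.
apply: Rle_trans (Cmod_triangle _ _) _; rewrite !Cmod_mult !Cmod_R !Rabs_pos_eq; try lra.
by apply: Rplus_le_compat; (apply: Rmult_le_compat_l; [lra|exact: IH]).
Qed.

Lemma flipsR_le d (s : 'I_d -> R) L F G k : (forall i, 0 <= s i <= 1) ->
  (forall k, F k <= G k) -> flipsR s L F k <= flipsR s L G k.
Proof.
move=> Hs H; elim: L k => [|i L IH] k //=; have := Hs i => si.
by apply: Rplus_le_compat; (apply: Rmult_le_compat_l; [lra|exact: IH]).
Qed.

Lemma flipsR_const d (s : 'I_d -> R) L c k : flipsR s L (fun _ => c) k = c.
Proof. by elim: L k => [|i L IH] k //=; rewrite !IH; ring. Qed.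

(** In each coordinate the second moment about [c i] is the variance of a binomial variable plus the
    squared distance from its mean to [c i]; by linearity the affine form in [a] and [K] is
    preserved. *)
Lemma flipsR_variance d (s : 'I_d -> R) L a K (c : 'I_d -> R) k :
  flipsR s L (fun k => a + K * \big[Rplus/0]_i (INR (k i) - c i) ^ 2) k =
  a + K * \big[Rplus/0]_i (INR (count_mem i L) * (s i * (1 - s i)) +
                           (INR (k i) + INR (count_mem i L) * s i - c i) ^ 2).
Proof.
elim: L k => [|i0 L IH] k.
  by rewrite /=; congr (_ + K * _); apply: eq_bigr => i _ /=; ring.
rewrite [LHS]/= !IH.
set A := \big[Rplus/0]_i _; set B := \big[Rplus/0]_i _.
have -> : \big[Rplus/0]_i (INR (count_mem i (i0 :: L)) * (s i * (1 - s i)) +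
    (INR (k i) + INR (count_mem i (i0 :: L)) * s i - c i) ^ 2) =
    s i0 * A + (1 - s i0) * B.
  rewrite /A /B !big_distrr -big_split; apply: eq_bigr => i _.
  rewrite /incr [count_mem i (i0 :: L)]/= eq_sym.
  case: eqP => [->|_]; last by rewrite add0n /=; ring.
  by rewrite add1n !S_INR /=; ring.
ring.
Qed.

(** Success has probability [p i ^ 2] and failure [q i ^ 2], so each branching only multiplies
    representable functions by squares of multipliers and adds them. *)
Lemma representable_flips d (p q : 'I_d -> Rd d -> R) L G k :
  (forall i, rcont (p i)) -> (forall i, rcont (q i)) ->
  (forall i, multiplier (fun y => RtoC (p i y))) ->
  (forall i, multiplier (fun y => RtoC (q i y))) ->
  (forall i y, p i y ^ 2 + q i y ^ 2 = 1) ->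
  representable (fun y => flips (fun i => p i y ^ 2) L G k).
Proof.
move=> cp cq mp mq pq; elim: L k => [|i L IH] k /=.
  have := representable_scal (G k) (representable_1 d).
  by congr representable; apply: functional_extensionality => y; rewrite Cmult_1_r.
have := representable_plus (representable_sqr (cp i) (mp i) (IH (incr k i)))
  (representable_sqr (cq i) (mq i) (IH k)).
congr representable; apply: functional_extensionality => y.
by rewrite (_ : 1 - _ = q i y ^ 2) //; have := pq i y; rewrite /=; lra.
Qed.

(** For [b <= a], [sin^2 a - sin^2 b = sin (a - b) * sin (a + b)], and the second factor is at least
    the first on the quarter period. It turns a separation of angles into a separation of the
    variables [sin^2]. *)
Lemma sin_sqr_sub a b : 0 <= a <= PI / 2 -> 0 <= b <= PI / 2 ->
  sin (a - b) ^ 2 <= Rabs (sin a ^ 2 - sin b ^ 2).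
Proof.
wlog ab : a b / b <= a => [H Ha Hb|Ha Hb].
  case: (Rle_lt_dec b a) => ab; first exact: H.
  rewrite Rabs_minus_sym (_ : a - b = - (b - a)); last by ring.
  by rewrite sin_neg -Rsqr_pow2 -Rsqr_neg Rsqr_pow2; apply: H => //; lra.
have E : sin a ^ 2 - sin b ^ 2 = sin (a - b) * sin (a + b).
  rewrite sin_minus sin_plus; have := sin2_cos2 a; have := sin2_cos2 b; rewrite /Rsqr => h1 h2.
  have -> : (sin a * cos b - cos a * sin b) * (sin a * cos b + cos a * sin b) =
    sin a ^ 2 * (cos b * cos b) - (cos a * cos a) * sin b ^ 2 by ring.
  have -> : cos b * cos b = 1 - sin b * sin b by lra.
  have -> : cos a * cos a = 1 - sin a * sin a by lra.
  ring.
have s0 : 0 <= sin (a - b) by apply: sin_ge_0; lra.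
have s1 : sin (a - b) <= sin (a + b).
  have c0 : 0 <= cos a by apply: cos_ge_0; lra.
  have sb : 0 <= sin b by apply: sin_ge_0; lra.
  by rewrite sin_minus sin_plus; nra.
by rewrite E Rabs_pos_eq; nra.
Qed.

(** The minimum with 1 provides an angle for every count, including those above the number of
    trials, since the averages are compared over all counts. *)
Lemma angle_of (q : R) : 0 <= q -> exists t, 0 <= t <= PI / 2 /\ sin t ^ 2 = Rmin 1 q.
Proof.
move=> Hq; have m0 : 0 <= Rmin 1 q by apply: Rmin_glb; lra.
have m1 : sqrt (Rmin 1 q) <= 1 by rewrite -[X in _ <= X]sqrt_1; apply/sqrt_le_1_alt/Rmin_l.
have sm := sqrt_pos (Rmin 1 q).
have E : sin (asin (sqrt (Rmin 1 q))) = sqrt (Rmin 1 q) by apply: sin_asin; lra.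
exists (Rabs (asin (sqrt (Rmin 1 q)))); split.
  split; first exact: Rabs_pos.
  by apply/Rabs_le; have := asin_bound (sqrt (Rmin 1 q)); lra.
rewrite /Rabs; destruct (Rcase_abs _); rewrite ?sin_neg E.
  by rewrite -Rsqr_pow2 -Rsqr_neg Rsqr_pow2 pow2_sqrt.
by rewrite pow2_sqrt.
Qed.

Lemma count_trials d n (i : 'I_d) : count_mem i (flatten (nseq n (enum 'I_d))) = n.
Proof.
elim: n => [//|n IH] /=; rewrite count_cat IH count_uniq_mem ?enum_uniq //.
by rewrite mem_enum.
Qed.

(** Bernstein polynomials in the variables [sin^2 (PI (y_i + rho) / (4 rho))], which parametrise
    [[-rho, rho]] by [[0, 1]]. *)
Lemma representable_dense d (h : Rd d -> C) H rho eps : Cc h -> (forall x, Cmod (h x) <= H) ->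
  0 < rho -> 0 < eps -> exists T, representable T /\ (forall y, Cmod (T y) <= H) /\
    forall y, supn y <= rho -> Cmod (Cminus (T y) (h y)) <= eps.
Proof.
move=> Hh HH Hr Heps; have PI0 := PI_RGT_0.
have H0 : 0 <= H by apply: Rle_trans (Cmod_ge_0 _) (HH vzero).
have [del [Hdel Hd]] := Cc_ucont Hh (ltac:(lra) : 0 < eps / 2).
(* The modulus of continuity [del] on the scale of angles, capped so that the sine increases on
   [[0, del0]]. *)
pose del0 := Rmin (PI / 2) (PI / (4 * rho) * del).
have r4 : 0 < PI / (4 * rho) by apply: Rdiv_lt_0_compat; lra.
have del0_pos : 0 < del0 by apply: Rmin_pos; [lra|exact: Rmult_lt_0_compat].
have del0_le : del0 <= PI / 2 by exact: Rmin_l.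
pose eta := sin del0 ^ 2.
have sd0 : 0 < sin del0 by apply: sin_gt_0; lra.
have eta0 : 0 < eta by exact: pow_lt.
have eta2 : 0 < eta ^ 2 by exact: pow_lt.
(* Chebyshev's bound below leaves the error [H d / (2 eta^2 n)], which this [n] makes at most
   [eps / 2]; the summand 1 keeps [n] positive. *)
have [n Hn] := INR_unbounded (1 + H * INR d / (eta ^ 2 * eps)).
have n1 : 1 < INR n.
  have : 0 <= H * INR d / (eta ^ 2 * eps); last lra.
  apply: Rmult_le_pos; first by apply: Rmult_le_pos => //; exact: pos_INR.
  by apply/Rlt_le/Rinv_0_lt_compat/Rmult_lt_0_compat.
have Hang (m : nat) : { t | 0 <= t <= PI / 2 /\ sin t ^ 2 = Rmin 1 (INR m / INR n) }.
  apply: constructive_indefinite_description; apply: angle_of.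
  by apply: Rmult_le_pos; [exact: pos_INR|apply/Rlt_le/Rinv_0_lt_compat; lra].
pose ang m := proj1_sig (Hang m).
have ang_b m : 0 <= ang m <= PI / 2 by rewrite /ang; case: (Hang m) => t [].
have ang_s m : sin (ang m) ^ 2 = Rmin 1 (INR m / INR n) by rewrite /ang; case: (Hang m) => t [].
(* The point whose angles are [ang (k i)]: the inverse of the parametrisation [th] introduced
   below. *)
pose node (k : 'I_d -> nat) : Rd d := fun i => 4 * rho / PI * ang (k i) - rho.
pose L := flatten (nseq n (enum 'I_d)).
pose th (i : 'I_d) (y : Rd d) := PI / (4 * rho) * y i + PI / 4.
pose s (y : Rd d) (i : 'I_d) := sin (th i y) ^ 2.
have s01 y i : 0 <= s y i <= 1.
  by rewrite /s; have := SIN_bound (th i y); split; [exact: pow2_ge_0|nra].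
pose T y := flips (s y) L (fun k => h (node k)) (fun _ => 0%N).
have cth i : rcont (th i).
  exact: rcont_plus (rcont_mult (rcont_const _) (rcont_proj i)) (rcont_const _).
exists T; split; [|split=> [y|y Hy]].
- apply: (@representable_flips d (fun i y => sin (th i y)) (fun i y => cos (th i y))) => i.
  + exact: rcont_comp continuous_sin (cth i).
  + exact: rcont_comp continuous_cos (cth i).
  + exact: multiplier_sin.
  + exact: multiplier_cos.
  by move=> y; have := sin2_cos2 (th i y); rewrite -!Rsqr_pow2.
- have := Cmod_flips_sub L (fun k => h (node k)) (RtoC 0) (fun _ => 0%N) (s01 y).
  have E (z : C) : Cminus z (RtoC 0) = z.
    by rewrite /Cminus /Cplus /Copp /RtoC; case: z => z1 z2 /=; congr pair; ring.
  rewrite E -/(T y) => /Rle_trans; apply; rewrite -[X in _ <= X](flipsR_const (s y) L H (fun _ => 0%N)).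
  by apply: flipsR_le => // k; rewrite E.
(* Chebyshev's weight: when the node is at least [del] away from [y], some coordinate has
   [(k i - n s)^2 >= eta^2 n^2], so the penalty reaches [2 * H], the trivial bound on the difference
   of two values of [h]. *)
pose K := 2 * H / (eta ^ 2 * INR n ^ 2).
have K0 : 0 <= K.
  apply: Rmult_le_pos; first lra.
  by apply/Rlt_le/Rinv_0_lt_compat/Rmult_lt_0_compat => //; apply: pow_lt; lra.
have Hk k : Cmod (Cminus (h (node k)) (h y)) <=
    eps / 2 + K * \big[Rplus/0]_i (INR (k i) - INR n * s y i) ^ 2.
  have sum0 : 0 <= \big[Rplus/0]_i (INR (k i) - INR n * s y i) ^ 2.
    by apply: Rsum_ge0 => i; exact: pow2_ge_0.
  have Ksum0 := Rmult_le_pos _ _ K0 sum0.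
  case: (Rlt_le_dec (supn (vsub (node k) y)) del) => Hnk.
    by have := Hd _ _ Hnk; lra.
  have [i Hi] : exists i, del <= Rabs (node k i - y i).
    apply: NNPP => Hno; have : supn (vsub (node k) y) < del; last lra.
    by apply: supn_lt => // i; apply: Rnot_le_lt => Hi; apply: Hno; exists i.
  have yi : - rho <= y i <= rho by apply/Rabs_le_between/(Rle_trans _ _ _ (Rabs_le_supn y i)).
  have th_b : 0 <= th i y <= PI / 2.
    have -> : th i y = PI / (4 * rho) * (y i + rho) by rewrite /th; field; lra.
    split; first by apply: Rmult_le_pos; lra.
    rewrite (_ : PI / 2 = PI / (4 * rho) * (rho + rho)); last by field; lra.
    by apply: Rmult_le_compat_l; lra.
  have Hth : del0 <= Rabs (ang (k i) - th i y).
    apply: Rle_trans (Rmin_r _ _) _.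
    have -> : ang (k i) - th i y = PI / (4 * rho) * (node k i - y i).
      by rewrite /th /node; field; lra.
    by rewrite Rabs_mult (Rabs_pos_eq (PI / _)); [apply: Rmult_le_compat_l; lra|lra].
  have Hsq : eta <= Rabs (Rmin 1 (INR (k i) / INR n) - s y i).
    rewrite -ang_s; apply: Rle_trans (sin_sqr_sub (ang_b _) th_b).
    rewrite /eta; have -> : sin (ang (k i) - th i y) ^ 2 = sin (Rabs (ang (k i) - th i y)) ^ 2.
      by rewrite /Rabs; destruct (Rcase_abs _) => //; rewrite sin_neg -!Rsqr_pow2 -Rsqr_neg.
    apply: pow_incr; split; first lra.
    have := ang_b (k i) => ab; have := Rabs_pos (ang (k i) - th i y).
    have : Rabs (ang (k i) - th i y) <= PI / 2 by apply/Rabs_le; lra.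
    by move=> h1 h2; apply: sin_incr_1; lra.
  (* Removing the cap can only increase the distance, because [s y i <= 1]. *)
  have Hsq2 : eta <= Rabs (INR (k i) / INR n - s y i).
    apply: Rle_trans Hsq _; have := s01 y i => si.
    rewrite /Rmin; destruct (Rle_dec _ _) => //; last lra.
    by rewrite !Rabs_pos_eq; lra.
  have : 2 * H <= K * (INR (k i) - INR n * s y i) ^ 2.
    have -> : K * (INR (k i) - INR n * s y i) ^ 2 =
        2 * H * ((INR (k i) / INR n - s y i) ^ 2 / eta ^ 2) by rewrite /K; field; lra.
    rewrite -{1}(Rmult_1_r (2 * H)); apply: Rmult_le_compat_l; first lra.
    apply/Rle_div_r => //; rewrite Rmult_1_l -(pow2_abs (_ - _)).
    by apply: pow_incr; lra.
  have : (INR (k i) - INR n * s y i) ^ 2 <= \big[Rplus/0]_i (INR (k i) - INR n * s y i) ^ 2.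
    rewrite (bigD1 i) //= -{1}(Rplus_0_r (_ * _)).
    by apply: Rplus_le_compat_l; apply: Rsum_ge0 => j; exact: pow2_ge_0.
  move=> /(Rmult_le_compat_l _ _ _ K0).
  have := Cmod_triangle (h (node k)) (Copp (h y)); rewrite Cmod_opp -/(Cminus _ _).
  by have := HH (node k); have := HH y; lra.
apply: Rle_trans (Cmod_flips_sub _ _ _ _ (s01 y)) _.
apply: Rle_trans (flipsR_le _ _ (s01 y) Hk) _.
rewrite flipsR_variance.
(* With [n] trials per coordinate the mean is exactly [n * s y i], so only the variance remains, and
   [s (1 - s) <= 1 / 4]. *)
apply: (Rle_trans _ (eps / 2 + K * \big[Rplus/0]_(i < d) (INR n * / 4))).
  apply: Rplus_le_compat_l; apply: Rmult_le_compat_l => //; apply: Rsum_le => i.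
  rewrite count_trials /= Rplus_0_l Rminus_eq_0 Rmult_0_l Rplus_0_r.
  apply: Rmult_le_compat_l; first lra.
  by have := pow2_ge_0 (s y i - / 2); nra.
rewrite Rsum_const.
have -> : K * (INR d * (INR n * / 4)) = eps / 2 * (H * INR d / (eta ^ 2 * eps) / INR n).
  by rewrite /K; field; lra.
have : H * INR d / (eta ^ 2 * eps) / INR n <= 1 by apply/Rle_div_l; lra.
by move/(Rmult_le_compat_l (eps / 2) _ _ (ltac:(lra))); lra.
Qed.

(** * Limits of Fourier transformable measures *)

Definition cutoff {d} (M : R) (x : Rd d) : R := clip (M + 1 - supn x).

Lemma cutoff_bounds d M (x : Rd d) : 0 <= cutoff M x <= 1.
Proof. exact: clip_bounds. Qed.

Lemma cutoff_one d M (x : Rd d) : supn x <= M -> cutoff M x = 1.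
Proof. by move=> H; apply: clip_ge1; lra. Qed.

Lemma cutoff_zero d M (x : Rd d) : M + 1 <= supn x -> cutoff M x = 0.
Proof. by move=> H; apply: clip_le0; lra. Qed.

Lemma rcont_cutoff d M : rcont (@cutoff d M).
Proof. exact: rcont_clip (rcont_minus (rcont_const (M + 1)) (@rcont_supn d)). Qed.

Lemma Cc_cutoff d M : Cc (fun x : Rd d => RtoC (cutoff M x)).
Proof.
apply: (@Cc_bounded_Cmod _ _ (M + 1)); first exact/cont_fun_RtoC/rcont_cutoff.
by move=> x Hx; rewrite cutoff_zero //; lra.
Qed.

(** This expresses that the integral of [|fcheck f|^2] against the total variation of [sigma] is at
    most [B], through minorants in [C_c]; [tail_le] does the same for the part outside the cube of
    radius [M]. *)
Definition dominated {d} (f : Rd d -> C) (sigma : measure_fun d) (B : R) : Prop :=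
  forall k, Cc k -> (forall x, Cmod (k x) <= Cmod (fcheck f x) ^ 2) -> Cmod (sigma k) <= B.

Definition tail_le {d} (f : Rd d -> C) (sigma : measure_fun d) (M tau : R) : Prop :=
  forall k, Cc k -> (forall x, Cmod (k x) <= Cmod (fcheck f x) ^ 2) ->
    (forall x, supn x <= M -> k x = RtoC 0) -> Cmod (sigma k) <= tau.

(** The predicate [Z] lets one rescaling argument serve both [dominated], with [Z] empty, and
    [tail_le], with [Z] a cube. *)
Lemma dominated_scale d f (sigma : measure_fun d) (Z : Rd d -> Prop) B c k : is_measure sigma ->
  (forall k, Cc k -> (forall x, Cmod (k x) <= Cmod (fcheck f x) ^ 2) ->
    (forall x, Z x -> k x = RtoC 0) -> Cmod (sigma k) <= B) ->
  0 < c -> Cc k -> (forall x, Cmod (k x) <= c * Cmod (fcheck f x) ^ 2) ->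
  (forall x, Z x -> k x = RtoC 0) -> Cmod (sigma k) <= c * B.
Proof.
move=> Hs HB c0 Hk Hkf Hz; have ci : 0 < / c by exact: Rinv_0_lt_compat.
have := HB (fun x => Cmult (RtoC (/ c)) (k x)) (Cc_scal _ Hk).
rewrite measure_scal // Cmod_mult Cmod_R Rabs_pos_eq; last lra.
move=> H; have {}H : / c * Cmod (sigma k) <= B.
  apply: H => x; last by move=> /Hz ->; rewrite Cmult_0_r.
  rewrite Cmod_mult Cmod_R Rabs_pos_eq; last lra.
  have := Rmult_le_compat_l (/ c) _ _ (Rlt_le _ _ ci) (Hkf x).
  by rewrite -Rmult_assoc Rinv_l ?Rmult_1_l //; lra.
have := Rmult_le_compat_l c _ _ (Rlt_le _ _ c0) H.
by rewrite -Rmult_assoc Rinv_r ?Rmult_1_l //; lra.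
Qed.

Lemma unit_factor (z : C) : exists u, Cmod u = 1 /\ z = Cmult u (RtoC (Cmod z)).
Proof.
case: (classic (z = RtoC 0)) => [->|Hz].
  by exists (RtoC 1); rewrite Cmod_1 Cmod_0 Cmult_0_r.
have m0 : Cmod z <> 0 by move=> /Cmod_eq_0.
have mC : RtoC (Cmod z) <> RtoC 0 by move=> [].
exists (Cdiv z (RtoC (Cmod z))); split; last by rewrite /Cdiv -Cmult_assoc Cinv_l ?Cmult_1_r.
by rewrite Cmod_div // Cmod_R Rabs_pos_eq; [field|exact: Cmod_ge_0].
Qed.

(** Rotating one function by a constant phase makes its integral add in modulus to that of another,
    with no cancellation. *)
Lemma align_phase (z w : C) :
  exists u, Cmod u = 1 /\ Cmod (Cplus z (Cmult u w)) = Cmod z + Cmod w.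
Proof.
have [a [Ha Ea]] := unit_factor z; have [b [Hb Eb]] := unit_factor w.
exists (Cmult a (Cconj b)); split; first by rewrite Cmod_mult Cmod_conj Ha Hb; ring.
have bb : Cmult b (Cconj b) = RtoC 1 by rewrite -Cmod2_conj Hb; congr RtoC; ring.
have -> : Cplus z (Cmult (Cmult a (Cconj b)) w) = Cmult a (RtoC (Cmod z + Cmod w)).
  rewrite {1}Ea {1}Eb RtoC_plus Cmult_plus_distr_l; congr Cplus.
  rewrite -Cmult_assoc; congr Cmult.
  by rewrite Cmult_assoc (Cmult_comm (Cconj b)) bb Cmult_1_l.
rewrite Cmod_mult Ha Cmod_R Rabs_pos_eq; first ring.
by have := Cmod_ge_0 z; have := Cmod_ge_0 w; lra.
Qed.

(** Some compactly supported [k0] almost attains the supremum of [Cmod (sigma k)]. A [k] vanishing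
    on the cube that carries [k0] can be added to it, with aligned phase, without leaving the
    majorant [|fcheck f|^2]; so its integral is at most the gap [tau]. *)
Lemma dominated_tail d f (sigma : measure_fun d) B : is_measure sigma -> dominated f sigma B ->
  forall tau, 0 < tau -> exists M, tail_le f sigma M tau.
Proof.
move=> Hs HB tau Htau.
pose E r := exists k, Cc k /\ (forall x, Cmod (k x) <= Cmod (fcheck f x) ^ 2) /\
  r = Cmod (sigma k).
have [m [Hm1 Hm2]] : { m | is_lub E m }.
  apply: completeness; first by exists B => r [k [Hk [Hkf ->]]]; exact: HB.
  exists (Cmod (sigma (fun _ => RtoC 0))), (fun _ => RtoC 0); split; first exact: Cc_0.
  by split=> // x; rewrite Cmod_0; exact: pow2_ge_0.
have [k0 [Hk0 [Hk0f Hk0s]]] : exists k, Cc k /\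
    (forall x, Cmod (k x) <= Cmod (fcheck f x) ^ 2) /\ m - tau < Cmod (sigma k).
  apply: NNPP => H; have : m <= m - tau; last lra.
  apply: Hm2 => r [k [Hk [Hkf ->]]]; apply: Rnot_lt_le => Hlt.
  by apply: H; exists k.
have [_ [M [_ HM]]] := proj1 (CcP k0) Hk0.
exists M => k Hk Hkf Hkz.
have [u [Hu Hsum]] := align_phase (sigma k0) (sigma k).
have : Cmod (sigma k0) + Cmod (sigma k) <= m; last lra.
apply: Hm1; exists (fun x => Cplus (k0 x) (Cmult u (k x))).
split; first by apply: Cc_plus => //; exact: Cc_scal.
split=> [x|]; last by rewrite measure_plus ?measure_scal //; exact: Cc_scal.
case: (Rle_lt_dec (supn x) M) => Hx; first by rewrite Hkz // Cmult_0_r Cplus_0_r.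
by rewrite HM // Cplus_0_l Cmod_mult Hu Rmult_1_l.
Qed.

(** The test function [F] comes from writing [g = |fcheck f|^2 h] and replacing [h] by a representable
    function [T]. *)
Lemma test_approx d (g : Rd d -> C) : Cc g -> exists f, Cc f /\ exists H, 0 <= H /\
  forall M eps, 0 < eps -> exists F, Cc F /\ forall m sigma B tau,
    is_measure m -> is_FT m sigma -> dominated f sigma B -> tail_le f sigma M tau ->
    Cmod (Cminus (sigma g) (m F)) <= eps * (B + 1) + (2 * H + 1) * tau.
Proof.
move=> Hg; have [Hgc [M0 [HM0 Hgz]]] := proj1 (CcP g) Hg.
(* A narrow tent has a wide transform: [tenthat a] has no zero for [|y| < 1 / a = M0 + 2], so [w] is
   positive on the cube of radius [M0 + 1]. *)
pose a := / (M0 + 2); have a0 : 0 < a by apply: Rinv_0_lt_compat; lra.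
pose f (x : Rd d) := RtoC (tents a x).
have Hf : Cc f by apply: Cc_tents; lra.
pose w (x : Rd d) := Cmod (fcheck f x) ^ 2.
have wc : rcont w.
  have c1 := rcont_Cmod (cont_fun_fcheck Hf).
  exact: (rcont_mult c1 (rcont_mult c1 (rcont_const 1))).
have w0 x : 0 <= w x by exact: pow2_ge_0.
have wpos x : supn x <= M0 + 1 -> 0 < w x.
  move=> Hx; apply/pow_lt/Cmod_gt_0; rewrite /f fcheck_tents; last lra.
  move=> [] ; elim/big_ind: _ => [|p q hp hq|i _]; [lra|exact: Rmult_integral_contrapositive_currified|].
  apply: tenthat_nonzero => //; apply/Rlt_div_r; first by apply/Rlt_gt.
  rewrite /a /Rdiv Rinv_inv Rmult_1_l.
  by have := Rabs_le_supn x i; lra.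
(* A positive continuous divisor that agrees with [w] where [g] lives; the added term is 1 outside
   the cube of radius [M0 + 1], where [w] may vanish. *)
pose D x := w x + (1 - cutoff M0 x).
have D0 x : 0 < D x.
  rewrite /D; have := cutoff_bounds M0 x; have := w0 x.
  case: (Rle_lt_dec (supn x) (M0 + 1)) => Hx; first by have := wpos x Hx; lra.
  by rewrite cutoff_zero; lra.
have Dc : rcont D by exact: rcont_plus wc (rcont_minus (rcont_const 1) (@rcont_cutoff d M0)).
pose h x := Cmult (RtoC (/ D x)) (g x).
have Hh : Cc h.
  by apply/Cc_multl/Hg/cont_fun_RtoC/rcont_inv => // x; have := D0 x; lra.
have Egh x : g x = Cmult (h x) (RtoC (w x)).
  case: (Rle_lt_dec (supn x) M0) => Hx; last by rewrite /h Hgz // Cmult_0_r Cmult_0_l.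
  have ED : D x = w x by rewrite /D cutoff_one //; ring.
  rewrite Cmult_comm /h ED Cmult_assoc -RtoC_mult Rinv_r ?Cmult_1_l //.
  by have := D0 x; lra.
have [H [H0 HH]] := Cc_bounded Hh.
exists f; split=> //; exists H; split=> // M eps Heps.
(* The extra unit leaves room for a cutoff that is 1 on the cube of radius [M] and vanishes where
   the approximation of [h] by [T] is no longer controlled. *)
pose rho := Rmax M M0 + 1.
have rM : M <= rho - 1 by have := Rmax_l M M0; rewrite /rho; lra.
have rM0 : M0 <= rho - 1 by have := Rmax_r M M0; rewrite /rho; lra.
have [T [[Tc /(_ f Hf) [F [HF HT]]] [TH Th]]] :=
  representable_dense Hh HH (ltac:(lra) : 0 < rho) Heps.
exists F; split=> // m sigma B tau Hm Hs HB Htau.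
have [Hsig _] := Hs.
have [M1 HM1] := HT m sigma Hm Hs eps Heps.
(* This truncation radius depends on [sigma], whereas [F] was fixed before [m] and [sigma]. The
   error of truncating [T w] is the single summand [eps] in the final bound. *)
pose M2 := Rmax M1 M0.
have Hphi := HM1 (cutoff M2) (Cc_cutoff d M2) (cutoff_bounds M2)
  (fun x Hx => cutoff_one (Rle_trans _ _ _ Hx (Rmax_l M1 M0))).
set Tw := fun x => Cmult _ (RtoC (cutoff M2 x)) in Hphi.
have HTw : Cc Tw.
  apply: Cc_multl; last exact: Cc_cutoff.
  exact: cont_fun_mult Tc (cont_fun_sqmod (cont_fun_fcheck Hf)).
pose k x := Cmult (Cmult (Cminus (h x) (T x)) (RtoC (w x))) (RtoC (cutoff M2 x)).
have Hk x : k x = Cminus (g x) (Tw x).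
  rewrite /k /Tw /sqmod -/(w x).
  have -> : g x = Cmult (g x) (RtoC (cutoff M2 x)).
    case: (Rle_lt_dec (supn x) M0) => Hx; last by rewrite Hgz // Cmult_0_l.
    by rewrite cutoff_one ?Cmult_1_r //; apply: Rle_trans Hx (Rmax_r _ _).
  by rewrite Egh; ring.
have kw x : Cmod (k x) <= Cmod (Cminus (h x) (T x)) * w x.
  rewrite /k !Cmod_mult !Cmod_R (Rabs_pos_eq _ (w0 x)) Rabs_pos_eq; last by case: (cutoff_bounds M2 x).
  rewrite -[X in _ <= X]Rmult_1_r; apply: Rmult_le_compat_l; last by case: (cutoff_bounds M2 x).
  by apply: Rmult_le_pos => //; exact: Cmod_ge_0.
have kc : Cc k.
  have E : k = fun x => Cminus (g x) (Tw x) by exact: functional_extensionality.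
  have := Cc_plus Hg (Cc_scal (RtoC (-1)) HTw); rewrite E; congr Cc.
  apply: functional_extensionality => x; rewrite /Cminus; congr Cplus.
  by rewrite /Cmult /Copp /RtoC; case: (Tw x) => p q /=; congr pair; ring.
pose chi (x : Rd d) := cutoff (rho - 1) x.
have chic : rcont chi by exact: rcont_cutoff.
(* The error [k] is split: [k1] lives where [T] is within [eps] of [h], while [k2] vanishes on the
   cube of radius [M], so the tail bound applies to it. *)
pose k1 x := Cmult (RtoC (chi x)) (k x).
pose k2 x := Cmult (RtoC (1 - chi x)) (k x).
have Hk1 : Cc k1 by apply: Cc_multl => //; exact: cont_fun_RtoC.
have Hk2 : Cc k2.
  by apply: Cc_multl => //; apply/cont_fun_RtoC/rcont_minus => //; exact: rcont_const.
have B1 : Cmod (sigma k1) <= eps * B.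
  apply: (@dominated_scale d f sigma (fun _ => False)) => //; first by move=> k' h1 h2 _; exact: HB.
  move=> x; have cb := cutoff_bounds (rho - 1) x.
  rewrite /k1 Cmod_mult Cmod_R (Rabs_pos_eq (chi x)); last by case: cb.
  case: (Rle_lt_dec (supn x) rho) => Hx; last first.
    by rewrite /chi cutoff_zero ?Rmult_0_l; [apply: Rmult_le_pos; [lra|exact: w0]|lra].
  rewrite -[X in _ <= X]Rmult_1_l; apply: Rmult_le_compat; [by case: cb|exact: Cmod_ge_0|by case: cb|].
  apply: Rle_trans (kw x) _; apply: Rmult_le_compat_r; first exact: w0.
  have := Th x Hx; rewrite -(Cmod_opp (Cminus (h x) _)).
  by rewrite (_ : Copp _ = Cminus (T x) (h x)) // /Cminus /Cplus /Copp /=; congr pair; ring.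
(* Here only [Cmod (h x) + Cmod (T x) <= 2 * H] is available; the [+ 1] keeps the scaling constant
   positive when [H = 0]. *)
have B2 : Cmod (sigma k2) <= (2 * H + 1) * tau.
  apply: (@dominated_scale d f sigma (fun x => supn x <= M)) => //; first lra.
    move=> x; have cb := cutoff_bounds (rho - 1) x; rewrite -/(chi x) in cb.
    rewrite /k2 Cmod_mult Cmod_R Rabs_pos_eq; last lra.
    rewrite -[X in _ <= X]Rmult_1_l; apply: Rmult_le_compat; [lra|exact: Cmod_ge_0|lra|].
    apply: Rle_trans (kw x) _; apply: Rmult_le_compat_r; first exact: w0.
    apply: Rle_trans (Cmod_triangle _ _) _; rewrite Cmod_opp.
    by have := HH x; have := TH x; lra.
  by move=> x Hx; rewrite /k2 /chi cutoff_one ?Rminus_eq_0 ?Cmult_0_l //; lra.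
have E : Cminus (sigma g) (m F) =
    Cplus (Cplus (sigma k1) (sigma k2)) (Cminus (sigma Tw) (m F)).
  rewrite -measure_plus // (_ : (fun x => Cplus (k1 x) (k2 x)) = fun x => Cminus (g x) (Tw x)).
    by rewrite measure_sub // /Cminus /Cplus /Copp /=; congr pair; ring.
  apply: functional_extensionality => x; rewrite -Hk /k1 /k2 -Cmult_plus_distr_r -RtoC_plus.
  by rewrite (_ : chi x + (1 - chi x) = 1) ?Cmult_1_l //; ring.
rewrite E; apply: Rle_trans (Cmod_triangle _ _) _.
have := Cmod_triangle (sigma k1) (sigma k2); lra.
Qed.

(** * Convergence of complex sequences *)

Definition cvC (u : nat -> C) (l : C) : Prop :=
  forall eps, 0 < eps -> exists N, forall n, (N <= n)%coq_nat -> Cmod (Cminus (u n) l) < eps.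

Lemma cvC_filterlim u l : cvC u l <-> filterlim u eventually (locally l).
Proof.
split=> [H|H eps Heps].
  apply/filterlim_locally => eps; have [N HN] := H eps (cond_pos eps).
  exists N => n Hn; apply: C_NormedModule_mixin_compat1; exact: HN.
have e2 : 0 < eps / 2 by lra.
have /filterlim_locally/(_ (mkposreal _ e2))[N HN] := H.
exists N => n Hn; have [b1 b2] := HN n Hn.
apply: Rle_lt_trans (Cmod_le_abs _) _.
by move: b1 b2; rewrite /ball /= /AbsRing_ball /abs /minus /plus /opp /=; lra.
Qed.

Lemma cvC_plus u v a b : cvC u a -> cvC v b -> cvC (fun n => Cplus (u n) (v n)) (Cplus a b).
Proof.
move=> Hu Hv eps Heps; have [N HN] := Hu (eps / 2) ltac:(lra).
have [N' HN'] := Hv (eps / 2) ltac:(lra).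
exists (Nat.max N N') => n Hn.
rewrite (_ : Cminus _ _ = Cplus (Cminus (u n) a) (Cminus (v n) b)); last first.
  by rewrite /Cminus /Cplus /Copp /=; congr pair; ring.
apply: Rle_lt_trans (Cmod_triangle _ _) _.
by have := HN n ltac:(lia); have := HN' n ltac:(lia); lra.
Qed.

Lemma cvC_scal c u a : cvC u a -> cvC (fun n => Cmult c (u n)) (Cmult c a).
Proof.
move=> Hu eps Heps; have c0 := Cmod_ge_0 c.
have e0 : 0 < eps / (Cmod c + 1) by apply: Rdiv_lt_0_compat; lra.
have [N HN] := Hu _ e0; exists N => n Hn.
rewrite (_ : Cminus _ _ = Cmult c (Cminus (u n) a)); last first.
  by rewrite /Cminus /Cplus /Cmult /Copp /=; congr pair; ring.
rewrite Cmod_mult.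
have : Cmod c * Cmod (Cminus (u n) a) <= Cmod c * (eps / (Cmod c + 1)).
  by apply: Rmult_le_compat_l => //; apply/Rlt_le/HN.
by rewrite (_ : Cmod c * (eps / (Cmod c + 1)) = eps - eps / (Cmod c + 1)); [lra|field; lra].
Qed.

Lemma cvC_le u l b : cvC u l -> (forall n, Cmod (u n) <= b) -> Cmod l <= b.
Proof.
move=> Hu Hb; apply: Rnot_lt_le => Hlt.
have [N HN] := Hu (Cmod l - b) ltac:(lra).
have := HN N (Nat.le_refl N); have := Hb N.
have := Cmod_triangle (u N) (Copp (Cminus (u N) l)); rewrite Cmod_opp.
rewrite (_ : Cplus _ _ = l); first lra.
by rewrite /Cminus /Cplus /Copp; case: l {Hu Hlt HN} => l1 l2 /=; congr pair; ring.
Qed.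

Lemma cvC_unique u a b : cvC u a -> cvC u b -> a = b.
Proof.
move=> Ha Hb; have H := cvC_plus Ha (cvC_scal (RtoC (-1)) Hb).
have E (z : C) : Cplus z (Cmult (RtoC (-1)) z) = RtoC 0.
  by rewrite /Cplus /Cmult /RtoC; case: z => p q /=; congr pair; ring.
have : Cmod (Cplus a (Cmult (RtoC (-1)) b)) <= 0.
  by apply: (cvC_le H) => n; rewrite E Cmod_0; lra.
move=> h; have /Cmod_eq_0 : Cmod (Cplus a (Cmult (RtoC (-1)) b)) = 0.
  by apply: Rle_antisym h (Cmod_ge_0 _).
case: a b {Ha Hb H h} => a1 a2 [b1 b2]; rewrite /Cplus /Cmult /RtoC /= => -[h1 h2].
by congr pair; lra.
Qed.

(** [Lim_seq] is total, so the candidate for the vague limit can be written down on all functions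
    before convergence is known; the value means nothing for divergent sequences. *)
Definition Clim (u : nat -> C) : C :=
  (real (Lim_seq (fun n => fst (u n))), real (Lim_seq (fun n => snd (u n)))).

Lemma cvC_cauchy u : (forall eps, 0 < eps -> exists N, forall n p, (N <= n)%coq_nat ->
  (N <= p)%coq_nat -> Cmod (Cminus (u n) (u p)) < eps) -> cvC u (Clim u).
Proof.
move=> H.
have part (pr : C -> R) : (forall a b, Rabs (pr a - pr b) <= Cmod (Cminus a b)) ->
    is_lim_seq (fun n => pr (u n)) (real (Lim_seq (fun n => pr (u n)))).
  move=> Hpr; apply: Lim_seq_correct'; apply/ex_lim_seq_cauchy_corr => eps.
  have [N HN] := H eps (cond_pos eps); exists N => n p Hn Hp.
  exact: Rle_lt_trans (Hpr _ _) (HN n p Hn Hp).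
have /is_lim_seq_spec H1 := part fst (fun a b => abs_fst_le (Cminus a b)).
have /is_lim_seq_spec H2 := part snd (fun a b => abs_snd_le (Cminus a b)).
move=> eps Heps; have e2 : 0 < eps / 2 by lra.
have [N1 {}H1] := H1 (mkposreal _ e2); have [N2 {}H2] := H2 (mkposreal _ e2).
exists (Nat.max N1 N2) => n Hn; apply: Rle_lt_trans (Cmod_le_abs _) _.
have := H1 n ltac:(lia); have := H2 n ltac:(lia).
by rewrite /Clim /Cminus /Cplus /Copp /= /Rminus; lra.
Qed.

Lemma FT_dominated d (m sigma : measure_fun d) f : is_FT m sigma -> Cc f ->
  exists B, dominated f sigma B.
Proof.
move=> [_ H] Hf; have [[B HB] _] := H f Hf; exists B => k Hk Hkf.
by apply: HB => // x; rewrite /sqmod Cmod_R Rabs_pos_eq //; exact: pow2_ge_0.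
Qed.

(** One [F] serves every [n], so convergence of [ms n F] controls [sigmas n g]. The parameters in
    the proof make each of the two error terms of [test_approx] equal to [eps / 2]. *)
Lemma uniform_approx d (ms sigmas : nat -> measure_fun d) g eps :
  (forall n, is_measure (ms n)) -> (forall n, is_FT (ms n) (sigmas n)) ->
  (forall f, Cc f -> exists B, forall n, dominated f (sigmas n) B) ->
  (forall f, Cc f -> forall tau, 0 < tau -> exists M, forall n, tail_le f (sigmas n) M tau) ->
  Cc g -> 0 < eps ->
  exists F, Cc F /\ forall n, Cmod (Cminus (sigmas n g) (ms n F)) <= eps.
Proof.
move=> Hm Hs HB Ht Hg Heps.
have [f [Hf [H [H0 HF]]]] := test_approx Hg.
have [B {}HB] := HB f Hf.
have B0 : 0 <= B.
  apply: Rle_trans (HB 0%N (fun _ => RtoC 0) (Cc_0 d) _); first exact: Cmod_ge_0.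
  by move=> x; rewrite Cmod_0; exact: pow2_ge_0.
have [M {}Ht] := Ht f Hf (eps / 2 / (2 * H + 1)) ltac:(apply: Rdiv_lt_0_compat; lra).
have [F [HcF HFn]] := HF M (eps / 2 / (B + 1)) ltac:(apply: Rdiv_lt_0_compat; lra).
exists F; split=> // n; apply: Rle_trans (HFn _ _ B _ (Hm n) (Hs n) (HB n) (Ht n)) _.
by apply: Req_le; field; lra.
Qed.

Theorem theorem4p13 (d : nat) (mus : nat -> measure_fun d)
  (muhats : nat -> measure_fun d) (mu : measure_fun d) :
  (forall n, is_measure (mus n)) ->
  (forall n, is_FT (mus n) (muhats n)) ->
  is_measure mu ->
  vague_conv mus mu ->
  tempered mu ->
  equi_translation_bounded muhats ->
  fourier_transformable mu /\
  (forall muhat, is_FT mu muhat -> vague_conv muhats muhat).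
Proof.
move=> Hmus Hft Hmu Hv _ Htb.
have Hhats n : is_measure (muhats n) by case: (Hft n).
have Hcv F : Cc F -> cvC (fun n => mus n F) (mu F) by move=> /Hv /cvC_filterlim.
have Hdom f : Cc f -> exists B, forall n, dominated f (muhats n) B.
  by move=> Hf; have [[B HB] _] := equi_tail Hhats Htb Hf; exists B => n k; exact: HB.
have Htail f : Cc f -> forall tau, 0 < tau -> exists M, forall n, tail_le f (muhats n) M tau.
  move=> Hf tau Htau; have [_ /(_ tau Htau) [M HM]] := equi_tail Hhats Htb Hf.
  by exists M => n k; exact: HM.
split; last first.
  move=> muhat Hmuhat g Hg; apply/cvC_filterlim => eps Heps.
  have Hh : is_measure muhat by case: Hmuhat.
  (* The limit pair [(mu, muhat)] is placed at index 0, in front of the sequence, so that a single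
     test function approximates all the measures at once. *)
  pose ms n := if n is n'.+1 then mus n' else mu.
  pose sigmas n := if n is n'.+1 then muhats n' else muhat.
  have [||||F [HF Hclose]] := @uniform_approx d ms sigmas g (eps / 4) _ _ _ _ Hg ltac:(lra).
  - by case.
  - by case.
  - move=> f Hf; have [B HB] := Hdom f Hf; have [B' HB'] := FT_dominated Hmuhat Hf.
    exists (Rmax B B') => -[|n] k Hk Hkf.
      exact: Rle_trans (HB' k Hk Hkf) (Rmax_r _ _).
    exact: Rle_trans (HB n k Hk Hkf) (Rmax_l _ _).
  - move=> f Hf tau Htau; have [M HM] := Htail f Hf tau Htau.
    have [B HB] := FT_dominated Hmuhat Hf.
    have [M' HM'] := dominated_tail Hh HB Htau.
    exists (Rmax M M') => -[|n] k Hk Hkf Hz.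
      by apply: HM' => // x Hx; apply: Hz; exact: Rle_trans Hx (Rmax_r _ _).
    by apply: (HM n) => // x Hx; apply: Hz; exact: Rle_trans Hx (Rmax_l _ _).
  have [N HN] := Hcv F HF (eps / 4) ltac:(lra).
  exists N => n Hn; have := Hclose n.+1; have := Hclose 0%N; rewrite /sigmas /ms => h0 h1.
  rewrite (_ : Cminus _ _ = Cplus (Cminus (muhats n g) (mus n F))
    (Cplus (Cminus (mus n F) (mu F)) (Copp (Cminus (muhat g) (mu F))))); last first.
    by rewrite /Cminus /Cplus /Copp /=; congr pair; ring.
  apply: Rle_lt_trans (Cmod_triangle _ _) _.
  have := Cmod_triangle (Cminus (mus n F) (mu F)) (Copp (Cminus (muhat g) (mu F))).
  by rewrite Cmod_opp; have := HN n Hn; lra.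
(* The transform of [mu] is constructed as the vague limit: [muhats n g] is within [eps / 8] of the
   convergent sequence [mus n F] for one [F], hence Cauchy. *)
pose nu : measure_fun d := fun g => Clim (fun n => muhats n g).
have Hnu g : Cc g -> cvC (fun n => muhats n g) (nu g).
  move=> Hg; apply: cvC_cauchy => eps Heps.
  have [F [HF Hclose]] := uniform_approx Hmus Hft Hdom Htail Hg (ltac:(lra) : 0 < eps / 8).
  have [N HN] := Hcv F HF (eps / 8) ltac:(lra).
  exists N => n p Hn Hp.
  rewrite (_ : Cminus _ _ = Cplus
    (Cplus (Cminus (muhats n g) (mus n F)) (Copp (Cminus (muhats p g) (mus p F))))
    (Cplus (Cminus (mus n F) (mu F)) (Copp (Cminus (mus p F) (mu F))))); last first.
    by rewrite /Cminus /Cplus /Copp /=; congr pair; ring.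
  apply: Rle_lt_trans (Cmod_triangle _ _) _.
  have := Cmod_triangle (Cminus (mus n F) (mu F)) (Copp (Cminus (mus p F) (mu F))).
  have := Cmod_triangle (Cminus (muhats n g) (mus n F)) (Copp (Cminus (muhats p g) (mus p F))).
  rewrite !Cmod_opp; have := HN n Hn; have := HN p Hp; have := Hclose n; have := Hclose p; lra.
exists nu; split.
  split=> [f g Hf Hg|]; last split=> [c f Hf|K HK].
  - apply: cvC_unique (Hnu _ (Cc_plus Hf Hg)) _.
    rewrite (_ : (fun n => _) = fun n => Cplus (muhats n f) (muhats n g)).
      exact: cvC_plus (Hnu f Hf) (Hnu g Hg).
    by apply: functional_extensionality => n; rewrite measure_plus.
  - apply: cvC_unique (Hnu _ (Cc_scal c Hf)) _.
    rewrite (_ : (fun n => _) = fun n => Cmult c (muhats n f)); first exact: cvC_scal (Hnu f Hf).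
    by apply: functional_extensionality => n; rewrite measure_scal.
  (* Local boundedness of the limit uses the equi bound at the translate of [K] by [vzero], which is
     [K] itself. *)
  have [c Hc] := Htb K HK; exists (c + 1) => g Hg HgK b Hb.
  apply: (cvC_le (Hnu g Hg)) => n; apply: (tv_bound (Hhats n) (Hc n vzero)) => // x Hx.
  apply: (supp_in_zero HgK) => Kx; apply: Hx; rewrite /translate (_ : vsub x vzero = x) //.
  by apply: functional_extensionality => i; rewrite /vsub /vzero; ring.
move=> f Hf; have Hsq := cont_fun_sqmod (cont_fun_fcheck Hf).
have Esq x : Cmod (sqmod (fcheck f) x) = Cmod (fcheck f x) ^ 2.
  by rewrite /sqmod Cmod_R Rabs_pos_eq //; exact: pow2_ge_0.
have [B HB] := Hdom f Hf; split.
  exists B => k Hk Hkf; apply: (cvC_le (Hnu k Hk)) => n; apply: HB => // x.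
  by rewrite -Esq.
move=> eps Heps; have [M HM] := Htail f Hf (eps / 4) ltac:(lra).
exists M => phi Hphi phi01 phi1.
have [_ [M' [_ phi0]]] := proj1 (CcP _) Hphi.
set v := conv f (ftilde f).
have Hv' : Cc v by exact/Cc_conv/Cc_ftilde.
pose X x := Cmult (sqmod (fcheck f) x) (RtoC (phi x)).
have HX : Cc X by exact: Cc_multl.
(* Limits preserve only weak inequalities, so half of [eps] is given up before passing to the [n]-th
   terms. *)
apply: (Rle_lt_trans _ (eps / 2)); last lra.
have Hlim := cvC_plus (Hnu X HX) (cvC_scal (RtoC (-1)) (Hcv v Hv')).
have Em (z z' : C) : Cplus z (Cmult (RtoC (-1)) z') = Cminus z z'.
  by rewrite /Cminus /Cplus /Copp /Cmult /RtoC /=; congr pair; ring.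
rewrite -/X -Em; apply: (cvC_le Hlim) => n; rewrite Em.
have [_ /(_ f Hf) [_ /(_ (eps / 4) ltac:(lra)) [N HN]]] := Hft n.
(* The cutoff [psi] may depend on [n]: it is wide enough for [muhats n Y] to be within [eps / 4] of
   [mus n v]. Both [psi] and [phi] are 1 on the cube of radius [M], so [Y - X] vanishes there and
   the tail bound, uniform in [n], controls it. *)
pose R0 := Rmax N (Rmax M M').
pose psi (x : Rd d) := cutoff R0 x.
have psi1 x : supn x <= N \/ supn x <= M \/ supn x <= M' -> psi x = 1.
  move=> Hx; apply: cutoff_one; have := Rmax_l N (Rmax M M'); have := Rmax_r N (Rmax M M').
  by have := Rmax_l M M'; have := Rmax_r M M'; rewrite /R0; lra.
have psi01 x : 0 <= psi x <= 1 by exact: cutoff_bounds.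
have Hpsi : Cc (fun x => RtoC (psi x)) by exact: Cc_cutoff.
have := HN psi Hpsi psi01 (fun x Hx => psi1 x (or_introl Hx)).
pose Y x := Cmult (sqmod (fcheck f) x) (RtoC (psi x)); rewrite -/Y -/v => HY.
have HYc : Cc Y by exact: Cc_multl.
have HYX : Cc (fun x => Cminus (Y x) (X x)).
  have := Cc_plus HYc (Cc_scal (RtoC (-1)) HX); congr Cc.
  by apply: functional_extensionality => x; rewrite Em.
have YX x : Cminus (Y x) (X x) = Cmult (sqmod (fcheck f) x) (RtoC (psi x - phi x)).
  by rewrite /Y /X /Cminus /Cplus /Copp /Cmult /RtoC /=; congr pair; ring.
have := HM n _ HYX _ _; rewrite measure_sub // => Hdiff.
rewrite (_ : Cminus _ _ = Cplus (Cminus (muhats n Y) (mus n v))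
  (Copp (Cminus (muhats n Y) (muhats n X)))); last first.
  by rewrite /Cminus /Cplus /Copp /=; congr pair; ring.
apply: Rle_trans (Cmod_triangle _ _) _; rewrite Cmod_opp.
have : Cmod (Cminus (muhats n Y) (muhats n X)) <= eps / 4; last lra.
apply: Hdiff => x; rewrite YX.
  rewrite Cmod_mult Esq Cmod_R -[X in _ <= X]Rmult_1_r.
  apply: Rmult_le_compat_l; first exact: pow2_ge_0.
  by apply/Rabs_le; have := psi01 x; have := phi01 x; lra.
by move=> Hx; rewrite phi1 // psi1 ?Rminus_eq_0 ?Cmult_0_r //; right; left.
Qed.
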